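(* Let $G$ be a countable infinite discrete group, $X$ a compact metrizable abelian group with normalized Haar measure $\nu$, and $\sigma: G\curvearrowright (X,\nu)$ an algebraic action which is weakly mixing. Assume moreover that the diagonal actions $\sigma^2:G\curvearrowright (X^2,\nu^2)$ and $\sigma^4:G\curvearrowright(X^4,\nu^4)$ are $\mathbb{T}$-cocycle superrigid, and that $H^2(G,\widehat X)$ is torsion free as an abelian group. Then the natural map $\Psi_2:H^2(G,\mathbb{T})\to H^2(G\curvearrowright X;\mathbb{T})$ is injective, and the map $$\Phi_2: H^2(G,\widehat{X})\to \frac{H^2(G\curvearrowright X;\mathbb{T})}{\Psi_2(H^2(G,\mathbb{T}))},\qquad \Phi_2([c])=[\tilde c]+\Psi_2(H^2(G,\mathbb{T})),$$ where $\tilde c(g,h,x)=c(g,h)(x)$, is a well-defined injective group homomorphism.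
   Context: An algebraic action of $G$ is a homomorphism $G\to \mathrm{Aut}(X)$ into the group of continuous automorphisms of a compact metrizable abelian group $X$; it preserves Haar measure. $\widehat X$ is the Pontryagin dual (continuous homomorphisms $X\to\mathbb{T}$), a left $\mathbb{Z}G$-module via $(g\chi)(x)=\chi(g^{-1}x)$. A p.m.p. action is weakly mixing if the diagonal action on the product of two copies is ergodic. A free, ergodic p.m.p. action $G\curvearrowright(Y,\eta)$ is $\mathbb{T}$-cocycle superrigid if every measurable $c:G\times Y\to\mathbb{T}$ satisfying $c(gh,y)=c(g,y)c(h,g^{-1}y)$ for all $g,h$ and a.e. $y$ is cohomologous to a homomorphism $\lambda:G\to\mathbb{T}$, i.e. there is measurable $b:Y\to\mathbb{T}$ with $c(g,y)=\lambda(g)b(y)b(g^{-1}y)^{-1}$ a.e. Group cohomology $H^n(G,M)$ uses inhomogeneous cochains with the standard coboundary; $\mathbb{T}$ has trivial $G$-action. For a p.m.p. action $G\curvearrowright(X,\mu)$, $H^2(G\curvearrowright X;\mathbb{T})$ is the group of measurable $c:G^2\times X\to\mathbb{T}$ with $c(h,k,g^{-1}x)c(gh,k,x)^{-1}c(g,hk,x)c(g,h,x)^{-1}=1$ for all $g,h,k$ and a.e. $x$, modulo those of the form $c(g,h,x)=b(g,x)b(h,g^{-1}x)b(gh,x)^{-1}$ for a measurable $b:G\times X\to\mathbb{T}$. The natural map $\Psi_2$ sends $[c]\in H^2(G,\mathbb{T})$ to the class of $(g,h,x)\mapsto c(g,h)$. *)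

(* Defs.v *)
From HB Require Import structures.
From mathcomp Require Import all_boot all_order all_algebra.
From mathcomp Require Import all_classical all_reals all_analysis.
Set Implicit Arguments. Unset Strict Implicit. Unset Printing Implicit Defensive.
Import Order.TTheory GRing.Theory Num.Theory.
Import numFieldNormedType.Exports.
Local Open Scope classical_set_scope.
Local Open Scope ring_scope.

(* The circle group T is represented as R/Z: a T-valued quantity is a real *)
(* number, two reals representing the same point of T iff their difference *)
(* is an integer.  Multiplicative notation of the paper becomes additive.  *)
Definition inZ {R : realType} (x : R) : Prop := x \is a Num.int.

(* measurability of a T-valued map, i.e. of y |-> exp(2 pi i f y) *)
Definition Tmeasurable {R : realType} {d} {Y : measurableType d} (f : Y -> R) :=
  measurable_fun setT (fun y => cos (2 * pi * f y)) /\
  measurable_fun setT (fun y => sin (2 * pi * f y)).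

Definition Tcontinuous {R : realType} {Y : topologicalType} (f : Y -> R) :=
  continuous (fun y => cos (2 * pi * f y)) /\
  continuous (fun y => sin (2 * pi * f y)).

Definition group_axioms {G : Type} (mul : G -> G -> G) (one : G) (inv : G -> G) :=
  [/\ (forall a b c, mul a (mul b c) = mul (mul a b) c),
      (forall a, mul one a = a), (forall a, mul a one = a),
      (forall a, mul (inv a) a = one) & (forall a, mul a (inv a) = one)].

Definition abelian_group_axioms {X : Type} (add : X -> X -> X) (zero : X)
  (opp : X -> X) :=
  [/\ (forall a b c, add a (add b c) = add (add a b) c),
      (forall a b, add a b = add b a),
      (forall a, add zero a = a) & (forall a, add (opp a) a = zero)].

Definition infinite_type (G : Type) := ~ finite_set [set: G].

(* compact metrizable abelian group: X is a pseudometric space (hence its  *)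
(* topology is metrizable once Hausdorff), compact, with continuous group  *)
(* operations                                                              *)
Definition compact_metrizable_abelian_group {R : realType}
  (X : pseudoPMetricType R) (add : X -> X -> X) (zero : X) (opp : X -> X) :=
  [/\ abelian_group_axioms add zero opp, hausdorff_space X, compact [set: X],
      continuous (fun p : X * X => add p.1 p.2) & continuous opp].

Notation BorelT X := (g_sigma_algebraType (@open X)).

Definition haar_probability {R : realType} (X : pseudoPMetricType R)
  (add : X -> X -> X) (nu : probability (BorelT X) R) :=
  forall (a : X) (A : set (BorelT X)), measurable A ->
    nu ((fun x : BorelT X => add a x) @^-1` A) = nu A.

Definition algebraic_action {R : realType} {G : Type} (mul : G -> G -> G)
  (one : G) (X : pseudoPMetricType R) (add : X -> X -> X)
  (sigma : G -> X -> X) :=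
  [/\ (forall g x y, sigma g (add x y) = add (sigma g x) (sigma g y)),
      (forall g, continuous (sigma g)),
      (forall x, sigma one x = x) &
      (forall g h x, sigma (mul g h) x = sigma g (sigma h x))].

Local Open Scope ereal_scope.

Definition ergodic {R : realType} {d} {Y : measurableType d} {G : Type}
  (eta : {measure set Y -> \bar R}) (a : G -> Y -> Y) :=
  forall A : set Y, measurable A -> (forall g, (a g) @^-1` A = A) ->
    eta A = 0 \/ eta A = 1.

Definition free_action {R : realType} {d} {Y : measurableType d} {G : Type}
  (one : G) (eta : {measure set Y -> \bar R}) (a : G -> Y -> Y) :=
  forall g, g <> one -> {ae eta, forall y, a g y <> y}.

Local Close Scope ereal_scope.

Definition T_cocycle_superrigid {R : realType} {d} {Y : measurableType d}
  {G : Type} (mul : G -> G -> G) (one : G) (inv : G -> G)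
  (eta : {measure set Y -> \bar R}) (a : G -> Y -> Y) :=
  [/\ free_action one eta a, ergodic eta a &
  forall c : G -> Y -> R,
    (forall g, Tmeasurable (c g)) ->
    (forall g h, {ae eta, forall y, inZ (c (mul g h) y - c g y - c h (a (inv g) y))}) ->
    exists lambda : G -> R,
      (forall g h, inZ (lambda (mul g h) - lambda g - lambda h)) /\
      exists b : Y -> R, Tmeasurable b /\
        forall g, {ae eta, forall y,
          inZ (c g y - lambda g - b y + b (a (inv g) y))}].

Definition diag2 {G X : Type} (sigma : G -> X -> X) (g : G) (p : X * X) :=
  (sigma g p.1, sigma g p.2).
Definition diag4 {G X : Type} (sigma : G -> X -> X) (g : G)
  (p : (X * X) * (X * X)) := (diag2 sigma g p.1, diag2 sigma g p.2).

Definition T_cocycle {R : realType} {G : Type} (mul : G -> G -> G)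
  (c : G -> G -> R) :=
  forall g h k, inZ (c h k - c (mul g h) k + c g (mul h k) - c g h).
Definition T_coboundary {R : realType} {G : Type} (mul : G -> G -> G)
  (c : G -> G -> R) :=
  exists b : G -> R, forall g h, inZ (c g h - (b h - b (mul g h) + b g)).

(* a character X -> T, i.e. a continuous homomorphism, represented by a    *)
(* real lift chi (two lifts differing by an integer-valued function being  *)
(* the same character)                                                     *)
Definition character {R : realType} (X : pseudoPMetricType R)
  (add : X -> X -> X) (chi : X -> R) :=
  (forall x y, inZ (chi (add x y) - chi x - chi y)) /\ Tcontinuous chi.

(* (g chi)(x) = chi (g^-1 x);  cochains c : G -> G -> X^ *)
Definition dual_cocycle {R : realType} {G : Type} (mul : G -> G -> G)
  (inv : G -> G) (X : pseudoPMetricType R) (add : X -> X -> X)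
  (sigma : G -> X -> X) (c : G -> G -> X -> R) :=
  (forall g h, character add (c g h)) /\
  forall g h k x, inZ (c h k (sigma (inv g) x) - c (mul g h) k x
                       + c g (mul h k) x - c g h x).
Definition dual_coboundary {R : realType} {G : Type} (mul : G -> G -> G)
  (inv : G -> G) (X : pseudoPMetricType R) (add : X -> X -> X)
  (sigma : G -> X -> X) (c : G -> G -> X -> R) :=
  exists b : G -> X -> R, (forall g, character add (b g)) /\
    forall g h x, inZ (c g h x - (b h (sigma (inv g) x) - b (mul g h) x + b g x)).

Definition dual_H2_torsion_free {R : realType} {G : Type} (mul : G -> G -> G)
  (inv : G -> G) (X : pseudoPMetricType R) (add : X -> X -> X)
  (sigma : G -> X -> X) :=
  forall (c : G -> G -> X -> R) (n : nat), (0 < n)%N ->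
    dual_cocycle mul inv add sigma c ->
    dual_coboundary mul inv add sigma (fun g h x => n%:R * c g h x) ->
    dual_coboundary mul inv add sigma c.

Definition meas_cocycle {R : realType} {G : Type} (mul : G -> G -> G)
  (inv : G -> G) (X : pseudoPMetricType R) (nu : probability (BorelT X) R)
  (sigma : G -> X -> X) (c : G -> G -> BorelT X -> R) :=
  (forall g h, Tmeasurable (c g h)) /\
  forall g h k, {ae nu, forall x, inZ (c h k (sigma (inv g) x) - c (mul g h) k x
                                       + c g (mul h k) x - c g h x)}.
Definition meas_coboundary {R : realType} {G : Type} (mul : G -> G -> G)
  (inv : G -> G) (X : pseudoPMetricType R) (nu : probability (BorelT X) R)
  (sigma : G -> X -> X) (c : G -> G -> BorelT X -> R) :=
  exists b : G -> BorelT X -> R, (forall g, Tmeasurable (b g)) /\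
    forall g h, {ae nu, forall x,
      inZ (c g h x - (b g x + b h (sigma (inv g) x) - b (mul g h) x))}.

Definition prodP {R : realType} {d1 d2} {T1 : measurableType d1}
  {T2 : measurableType d2} (P1 : probability T1 R) (P2 : probability T2 R) :
  probability (T1 * T2)%type R := (P1 \x P2)%E.

Definition weakly_mixing {R : realType} {G : Type} (X : pseudoPMetricType R)
  (nu : probability (BorelT X) R) (sigma : G -> X -> X) :=
  ergodic (prodP nu nu) (diag2 (sigma : G -> BorelT X -> BorelT X)).

(* Main.v *)
(* Everything is written additively in R/Z.  A coboundary [b] of a constant
   2-cocycle makes [b g x - b g y] a 1-cocycle on the square of the action;
   superrigidity gives it a transfer function, which ergodicity on the fourth
   power splits as [u x + v y], so [b] becomes constant after correction by
   [u].  This is the injectivity of Psi_2.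

   For Phi_2, suppose that a dual 2-cocycle [c] is the coboundary of [b] up to
   a constant cocycle.  Then [b g (x + y) - b g x - b g y] has constant
   coboundary on the square, and the same argument there (which uses the fourth
   power) makes it, after correcting [b] by constants, the coboundary of some
   [w (x, y)].  The commutator [w (s, x) + w (t, s + x) - w (t, x) - w (s, t + x)]
   of the twisted translations [U_t f (x) = e (w (t, x)) f (t + x)] is invariant,
   hence constant, and antisymmetric in [s, t], hence 2-torsion.  So for [2 w]
   the [U_t] commute, and so does their average [\int U_s ds], a nonzero
   Hilbert-Schmidt operator.  In the algebra of Hilbert-Schmidt operators
   commuting with all [U_t] a minimal projection [P] satisfies
   [U_t P = kappa t P], which gives a joint eigenfunction of the [U_t]: thus
   [2 w (t, x) = k t + u x - u (t + x)].  It follows that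
   [2 b g x + k x - k (g^-1 x)] is almost everywhere additive in [x], i.e. agrees
   with a character, and [2 c] is the coboundary of
   these characters; torsion-freeness removes the factor 2. *)
Require Import Defs.
From HB Require Import structures.
From mathcomp Require Import all_boot all_order all_algebra.
From mathcomp Require Import all_classical all_reals all_analysis.
From mathcomp Require Import measurable_realfun complex ring lra.
Import Order.TTheory GRing.Theory Num.Theory.
Import numFieldNormedType.Exports.
Set Implicit Arguments. Unset Strict Implicit. Unset Printing Implicit Defensive.
Local Open Scope classical_set_scope.
Local Open Scope ring_scope.

(** * Almost everywhere statements and measure-preserving maps *)

(** Superrigidity on [X^4] is used as a statement about the square of [Z = X^2], and splitting there
    requires ergodicity on [Z^4 = X^8]. This comes from ergodicity on [Z^2] alone: a factor with
    ergodic square keeps products with ergodic actions ergodic. The same principle turns weak mixing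
    into ergodicity on [X^3], where the commutator lives. The [U_t] need not form a representation;
    only their commutation is used. It enters twice: it puts the average into the algebra, and it
    puts [U_t P] there, so that minimality of [P] applies. The average is nonzero because its kernel
    has modulus 1 everywhere. Kernels are bounded functions, and spectral projections are uniform
    limits of normalised powers, so most operator identities hold at every point rather than modulo
    null sets. Real lifts of circle-valued maps are arbitrary, so measurability and continuity pass
    through cosine and sine. *)

Section almost_everywhere.
Context {R : realType} {d1 d2 : measure_display}.
Context {T1 : measurableType d1} {T2 : measurableType d2}.
Variables (P1 : probability T1 R) (P2 : probability T2 R).

Lemma ae_measurableP (P : set T1) : measurable P ->
  {ae P1, forall x, P x} <-> (P1 (~` P) = 0)%E.
Proof.
move=> mP; have -> : {ae P1, forall x, P x} = P1.-negligible (~` P) by [].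
by apply: negligibleP; exact: measurableC.
Qed.

Lemma ae_probability1 (P : set T1) : measurable P ->
  {ae P1, forall x, P x} -> (P1 P = 1)%E.
Proof.
move=> mP /(ae_measurableP mP) P0.
by rewrite -[P]setCK probability_setC ?P0 ?sube0 //; exact: measurableC.
Qed.

(** A null set is not the whole space. Constants are later obtained this way, by evaluating an
    almost sure identity at one generic point. *)
Lemma ae_ex (P : T1 -> Prop) : {ae P1, forall x, P x} -> exists x, P x.
Proof.
move=> aP; apply: contrapT => /forallNP nP.
have : {ae P1, forall x, (set0 : set T1) x} by apply: filterS aP => x /nP.
move/(ae_measurableP measurable0).
by rewrite setC0 probability_setT => /eqP; rewrite onee_eq0.
Qed.

Lemma prodPE (A : set T1) (B : set T2) : measurable A -> measurable B ->
  (prodP P1 P2 (A `*` B) = P1 A * P2 B)%E.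
Proof. by move=> mA mB; exact: product_measure1E. Qed.

Let ae_section (A : set (T1 * T2)) x : measurable A ->
  {ae P2, forall y, A (x, y)} <-> ((P2 \o xsection (~` A)) x = 0)%E.
Proof.
move=> mA; have -> : {ae P2, forall y, A (x, y)} =
    P2.-negligible (xsection (~` A) x) by rewrite xsectionE.
by apply: negligibleP; apply: measurable_xsection; exact: measurableC.
Qed.

Lemma measurable_ae_section (A : set (T1 * T2)) : measurable A ->
  measurable [set x | {ae P2, forall y, A (x, y)}].
Proof.
move=> mA; have -> : [set x | {ae P2, forall y, A (x, y)}] =
    (P2 \o xsection (~` A)) @^-1` [set 0%E].
  by apply/seteqP; split=> x /=; rewrite ae_section.
rewrite -[X in measurable X]setTI.
by apply: measurable_fun_xsection => //; exact: measurableC.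
Qed.

Lemma ae_prodP (A : set (T1 * T2)) : measurable A ->
  {ae prodP P1 P2, forall p, A p} <->
  {ae P1, forall x, {ae P2, forall y, A (x, y)}}.
Proof.
move=> mA; have -> : {ae prodP P1 P2, forall p, A p} =
  (P1 \x P2)%E.-negligible (~` A) by [].
have mNA := measurableC mA.
rewrite negligibleP //.
change ((\int[P1]_x (P2 \o xsection (~` A)) x)%E = 0%E <->
  {ae P1, forall x, {ae P2, forall y, A (x, y)}}).
have -> : (\int[P1]_x (P2 \o xsection (~` A)) x =
    \int[P1]_x `|(P2 \o xsection (~` A)) x|)%E.
  by apply: eq_integral => x _; rewrite gee0_abs.
rewrite ae_eq_integral_abs //; last exact: measurable_fun_xsection.
split; apply: filterS => x.
  by move=> /(_ I) h; apply/ae_section.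
by move=> /ae_section h _; apply: h.
Qed.

Lemma ae_prodl (P : T1 * T2 -> Prop) : {ae prodP P1 P2, forall p, P p} ->
  {ae P1, forall x, {ae P2, forall y, P (x, y)}}.
Proof.
case=> A [mA A0 PA].
have : {ae prodP P1 P2, forall p, (~` A) p} by exists A; split => // p; rewrite /= notK.
move=> /(ae_prodP (measurableC mA)); apply: filterS => x; apply: filterS => y.
by move=> nA; apply: contrapT => /PA.
Qed.

Lemma ae_fst (P : T1 -> Prop) : {ae P1, forall x, P x} ->
  {ae prodP P1 P2, forall p, P p.1}.
Proof.
case=> A [mA A0 PA]; exists (fst @^-1` A); split.
- by rewrite -[X in measurable X]setTI; exact: measurable_fst.
- have -> : fst @^-1` A = A `*` [set: T2] by apply/seteqP; split=> p //= -[].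
  by rewrite prodPE // A0 mul0e.
- by move=> p /= /PA.
Qed.

Lemma ae_snd (P : T2 -> Prop) : {ae P2, forall x, P x} ->
  {ae prodP P1 P2, forall p, P p.2}.
Proof.
case=> A [mA A0 PA]; exists (snd @^-1` A); split.
- by rewrite -[X in measurable X]setTI; exact: measurable_snd.
- have -> : snd @^-1` A = [set: T1] `*` A by apply/seteqP; split=> p //= -[].
  by rewrite prodPE // A0 mule0.
- by move=> p /= /PA.
Qed.

End almost_everywhere.

Definition measure_preserving {R : realType} {d1 d2} {T1 : measurableType d1}
    {T2 : measurableType d2} (P1 : set T1 -> \bar R) (P2 : set T2 -> \bar R)
    (f : T1 -> T2) :=
  measurable_fun setT f /\ forall A, measurable A -> P1 (f @^-1` A) = P2 A.

Section measure_preserving.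
Context {R : realType} {d1 d2 d3 d4 : measure_display}.
Context {T1 : measurableType d1} {T2 : measurableType d2}.
Context {T3 : measurableType d3} {T4 : measurableType d4}.
Variables (P1 : probability T1 R) (P2 : probability T2 R).
Variables (P3 : probability T3 R) (P4 : probability T4 R).

Lemma ae_preserving f (P : T2 -> Prop) : measure_preserving P1 P2 f ->
  {ae P2, forall y, P y} -> {ae P1, forall x, P (f x)}.
Proof.
move=> [mf Pf] [A [mA A0 PA]]; exists (f @^-1` A); split.
- by rewrite -[X in measurable X]setTI; exact: mf.
- by rewrite Pf.
- by move=> x /= /PA.
Qed.

Lemma preserving_comp f g : measure_preserving P1 P2 f ->
  measure_preserving P2 P3 g -> measure_preserving P1 P3 (g \o f).
Proof.
move=> [mf Pf] [mg Pg]; split; first exact: measurableT_comp.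
move=> A mA; rewrite comp_preimage Pf ?Pg //.
by rewrite -[X in measurable X]setTI; exact: mg.
Qed.

Lemma prodP_unique (m : {measure set (T1 * T2) -> \bar R}) :
  (forall A B, measurable A -> measurable B ->
    m (A `*` B) = (P1 A * P2 B)%E) ->
  forall C, measurable C -> prodP P1 P2 C = m C.
Proof. by move=> h C mC; apply: product_measure_unique. Qed.

End measure_preserving.

Section preserving_prod.
Context {R : realType} {d1 d2 d3 d4 : measure_display}.
Context {T1 : measurableType d1} {T2 : measurableType d2}.
Context {T3 : measurableType d3} {T4 : measurableType d4}.
Variables (P1 : probability T1 R) (P2 : probability T2 R).
Variables (P3 : probability T3 R) (P4 : probability T4 R).

Lemma preserving_prod f g : measure_preserving P1 P3 f ->
  measure_preserving P2 P4 g ->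
  measure_preserving (prodP P1 P2) (prodP P3 P4) (fun p => (f p.1, g p.2)).
Proof.
move=> [mf Pf] [mg Pg].
have mh : measurable_fun setT (fun p : T1 * T2 => (f p.1, g p.2)).
  by apply: measurable_fun_pair; apply: measurableT_comp.
split=> // A mA; symmetry.
pose h := mfun_Sub (mem_set mh).
apply: (@prodP_unique _ _ _ _ _ P3 P4 (distribution (prodP P1 P2) h)) => //.
move=> B C mB mC; rewrite /distribution /pushforward /=.
have -> : (fun p : T1 * T2 => (f p.1, g p.2)) @^-1` (B `*` C) =
  (f @^-1` B) `*` (g @^-1` C) by [].
rewrite prodPE ?Pf ?Pg //.
  by rewrite -[X in measurable X]setTI; exact: mf.
by rewrite -[X in measurable X]setTI; exact: mg.
Qed.

End preserving_prod.

(** Boundedness on a probability space gives integrability, and the class is closed under products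
    and sections, so linearity and Fubini apply without further integrability conditions. *)
Definition bmeas {R : realType} {d} {T : measurableType d} (f : T -> R) :=
  measurable_fun setT f /\ exists M, forall x, `|f x| <= M.

Section bounded_measurable.
Context {R : realType} {d d' : measure_display}.
Context {T : measurableType d} {T' : measurableType d'}.
Implicit Types f g : T -> R.

Lemma bmeas_cst (c : R) : bmeas (fun _ : T => c).
Proof. by split; [exact: measurable_cst|exists `|c|]. Qed.

Lemma bmeasD f g : bmeas f -> bmeas g -> bmeas (fun x => f x + g x).
Proof.
move=> [mf [M fM]] [mg [N gN]]; split; first exact: measurable_funD.
exists (M + N) => x; rewrite (le_trans (ler_normD _ _)) //; exact: lerD.
Qed.

Lemma bmeasM f g : bmeas f -> bmeas g -> bmeas (fun x => f x * g x).
Proof.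
move=> [mf [M fM]] [mg [N gN]]; split; first exact: measurable_funM.
exists (M * N) => x; rewrite normrM; exact: ler_pM.
Qed.

Lemma bmeasN f : bmeas f -> bmeas (fun x => - f x).
Proof.
move=> [mf [M fM]]; split; first exact: measurableT_comp.
by exists M => x; rewrite normrN.
Qed.

Lemma bmeasB f g : bmeas f -> bmeas g -> bmeas (fun x => f x - g x).
Proof. by move=> bf bg; apply: bmeasD => //; exact: bmeasN. Qed.

Lemma bmeas_comp f (h : T' -> T) : measurable_fun setT h -> bmeas f ->
  bmeas (fun x => f (h x)).
Proof.
move=> mh [mf [M fM]]; split; first exact: measurableT_comp.
by exists M => x.
Qed.

Lemma bmeas_indic (A : set T) : measurable A -> bmeas (\1_A : T -> R).
Proof.
move=> mA; split; first exact: measurable_indic.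
by exists 1 => x; rewrite indicE; case: (_ \in _); rewrite ?normr0 ?normr1.
Qed.

End bounded_measurable.

(** * Integration and Fubini for bounded functions *)

Section bounded_integral.
Context {R : realType} {d : measure_display} {T : measurableType d}.
Variable P : probability T R.
Implicit Types f g : T -> R.

Lemma bmeas_integrable f : bmeas f -> P.-integrable setT (EFin \o f).
Proof.
move=> [mf [M fM]]; apply: measurable_bounded_integrable => //.
  by rewrite [X in (X < _)%E](probability_setT P) ltry.
exists M; split; first exact: num_real.
by move=> x Mx y _; exact: le_trans (fM y) (ltW Mx).
Qed.

Lemma RintD f g : bmeas f -> bmeas g ->
  \int[P]_x (f x + g x) = \int[P]_x f x + \int[P]_x g x.
Proof. by move=> bf bg; rewrite RintegralD //; exact: bmeas_integrable. Qed.

Lemma RintB f g : bmeas f -> bmeas g ->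
  \int[P]_x (f x - g x) = \int[P]_x f x - \int[P]_x g x.
Proof. by move=> bf bg; rewrite RintegralB //; exact: bmeas_integrable. Qed.

Lemma RintZ (c : R) f : bmeas f -> \int[P]_x (c * f x) = c * \int[P]_x f x.
Proof. by move=> bf; rewrite RintegralZl //; exact: bmeas_integrable. Qed.

Lemma Rint_cst (c : R) : \int[P]_x c = c.
Proof.
by rewrite Rintegral_cst // [X in fine X](probability_setT P) mulr1.
Qed.

Lemma le_Rint f g : bmeas f -> bmeas g -> (forall x, f x <= g x) ->
  \int[P]_x f x <= \int[P]_x g x.
Proof. by move=> bf bg fg; apply: le_Rintegral => //; exact: bmeas_integrable. Qed.

Lemma Rint_ge0 f : (forall x, 0 <= f x) -> 0 <= \int[P]_x f x.
Proof. by move=> f0; apply: Rintegral_ge0. Qed.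

Lemma Rint_bound f M : bmeas f -> (forall x, `|f x| <= M) ->
  `|\int[P]_x f x| <= M.
Proof.
move=> bf fM; rewrite ler_norml -(Rint_cst (- M)) -[X in _ && (_ <= X)]Rint_cst.
by apply/andP; split; apply: le_Rint => //; try exact: bmeas_cst;
  move=> x; have := fM x; rewrite ler_norml => /andP[].
Qed.

Lemma ae_Rint f g : bmeas f -> bmeas g -> {ae P, forall x, f x = g x} ->
  \int[P]_x f x = \int[P]_x g x.
Proof.
move=> [mf _] [mg _] fg; rewrite /Rintegral; congr fine.
apply: ae_eq_integral => //; try exact/measurable_EFinP.
by apply: filterS fg => x -> _.
Qed.

Lemma Rint_eq0 f : bmeas f -> (forall x, 0 <= f x) -> \int[P]_x f x = 0 ->
  {ae P, forall x, f x = 0}.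
Proof.
move=> bf f0 If0.
have : (\int[P]_x `|(f x)%:E| = 0)%E.
  have := integrable_fin_num measurableT (bmeas_integrable bf).
  move=> /fineK; rewrite -/(Rintegral P setT f) If0 => /esym E.
  transitivity (\int[P]_x (f x)%:E)%E => //.
  by apply: eq_integral => x _; rewrite gee0_abs // lee_fin.
rewrite ae_eq_integral_abs //; last by case: bf => ? _; exact/measurable_EFinP.
by apply: filterS => x /(_ I) [].
Qed.

Lemma Rint_indic (A : set T) : measurable A -> \int[P]_x \1_A x = fine (P A).
Proof. by move=> mA; rewrite /Rintegral integral_indic // setIT. Qed.

End bounded_integral.

Section change_of_variables.
Context {R : realType} {d d' : measure_display}.
Context {T : measurableType d} {T' : measurableType d'}.
Variables (P : probability T R) (P' : probability T' R).

Lemma Rint_preserving (h : T -> T') f : measure_preserving P P' h -> bmeas f ->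
  \int[P]_x f (h x) = \int[P']_x f x.
Proof.
move=> [mh hP] bf; rewrite /Rintegral; congr fine.
pose hh := mfun_Sub (mem_set mh).
have := @integral_distribution _ _ _ _ _ P hh (EFin \o f).
rewrite -(_ : \int[P']_x (EFin \o f) x = \int[distribution P hh]_x (EFin \o f) x)%E; last first.
  by apply: eq_measure_integral => A mA _; exact/esym/hP.
move=> -> //.
  by case: bf => ? _; exact/measurable_EFinP.
by apply: bmeas_integrable; exact: bmeas_comp.
Qed.

End change_of_variables.

Section fubini.
Context {R : realType} {d1 d2 : measure_display}.
Context {T1 : measurableType d1} {T2 : measurableType d2}.
Variables (P1 : probability T1 R) (P2 : probability T2 R).
Implicit Types f : T1 * T2 -> R.

Lemma bmeas_pair1 f x : bmeas f -> bmeas (fun y => f (x, y)).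
Proof. by move=> bf; apply: (bmeas_comp (h := pair x)). Qed.

Lemma bmeas_pair2 f y : bmeas f -> bmeas (fun x => f (x, y)).
Proof. by move=> bf; apply: (bmeas_comp (h := fun x => (x, y))). Qed.

Let int_prodP f : bmeas f -> (P1 \x P2)%E.-integrable setT (EFin \o f).
Proof. exact: (@bmeas_integrable _ _ _ (prodP P1 P2)). Qed.

Lemma bmeas_Rint1 f : bmeas f -> bmeas (fun x => \int[P2]_y f (x, y)).
Proof.
move=> bf; split.
  apply: measurableT_comp; first exact: fine_measurable.
  exact: (measurable_fubini_F (int_prodP bf)).
have [_ [M fM]] := bf; exists M => x.
by apply: Rint_bound => //; exact: bmeas_pair1.
Qed.

Lemma bmeas_Rint2 f : bmeas f -> bmeas (fun y => \int[P1]_x f (x, y)).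
Proof.
move=> bf; split.
  apply: measurableT_comp; first exact: fine_measurable.
  exact: (measurable_fubini_G (int_prodP bf)).
have [_ [M fM]] := bf; exists M => x.
by apply: Rint_bound => //; exact: bmeas_pair2.
Qed.

Lemma Rint_prod1 f : bmeas f ->
  \int[P1]_x \int[P2]_y f (x, y) = \int[prodP P1 P2]_p f p.
Proof.
move=> bf; rewrite /Rintegral.
have E := integral12_prod_meas1 (int_prodP bf); rewrite -[in RHS]E.
congr fine; apply: eq_integral => x _; rewrite /fubini_F /= fineK //.
exact: (integrable_fin_num measurableT (bmeas_integrable P2 (bmeas_pair1 x bf))).
Qed.

Lemma Rint_prod2 f : bmeas f ->
  \int[P2]_y \int[P1]_x f (x, y) = \int[prodP P1 P2]_p f p.
Proof.
move=> bf; rewrite /Rintegral.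
have E := integral21_prod_meas1 (int_prodP bf); rewrite -[in RHS]E.
congr fine; apply: eq_integral => y _; rewrite /fubini_G /= fineK //.
exact: (integrable_fin_num measurableT (bmeas_integrable P1 (bmeas_pair2 y bf))).
Qed.

Lemma Rint_fubini f : bmeas f ->
  \int[P1]_x \int[P2]_y f (x, y) = \int[P2]_y \int[P1]_x f (x, y).
Proof. by move=> bf; rewrite Rint_prod1 // Rint_prod2. Qed.

End fubini.

(** * Almost everywhere vanishing tested on a pi-system *)

Section pi_system_zero.
Context {R : realType} {d : measure_display} {T : measurableType d}.
Variable P : probability T R.

(** The sets over which [F] integrates to 0 form a Dynkin system, hence include [F >= 0] and its
    complement, on each of which [F] has constant sign. *)
Lemma ae0_pi_system (G : set (set T)) (F : T -> R) :
  measurable = <<s G >> -> setI_closed G -> bmeas F ->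
  \int[P]_x F x = 0 -> (forall A, G A -> \int[P]_x (\1_A x * F x) = 0) ->
  {ae P, forall x, F x = 0}.
Proof.
move=> mG GI bF F0 FG.
have iF := bmeas_integrable P bF.
have E A : measurable A ->
    (\int[P]_(x in A) (F x)%:E = (\int[P]_x (\1_A x * F x))%:E)%E.
  move=> mA; have bAF : bmeas (fun x => \1_A x * F x).
    by apply: bmeasM => //; exact: bmeas_indic.
  rewrite /Rintegral fineK; last first.
    exact: (integrable_fin_num measurableT (bmeas_integrable P bAF)).
  rewrite [LHS]integral_mkcond; apply: eq_integral => x _.
  by rewrite /patch indicE; case: ifPn => _; rewrite ?mul1r ?mul0r.
have H A : measurable A -> \int[P]_x (\1_A x * F x) = 0.
  rewrite mG => GA; apply: EFin_inj; rewrite -E; last by rewrite mG.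
  move: A GA; apply: (dynkin_induction (G := G)) => //.
  - rewrite E //; under eq_Rintegral do rewrite indicT mul1r.
    by rewrite F0.
  - move=> A GA; rewrite E ?FG // mG; exact: sub_sigma_algebra.
  - move=> A mA; rewrite !E //; last exact: measurableC.
    move=> [A0]; congr EFin.
    rewrite -[RHS]F0 -[RHS]subr0 -[in RHS]A0 -RintB //; last first.
      by apply: bmeasM => //; exact: bmeas_indic.
    apply: eq_Rintegral => x _; rewrite !indicE in_setC.
    by case: (x \in A); rewrite ?mul0r ?mul1r ?subrr ?subr0.
  - move=> S mS tS S0; rewrite integral_bigcup //.
      by apply: eseries0 => i _ _; exact: S0.
    by apply: integrableS iF => //; exact: bigcup_measurable.
have [mF _] := bF.
have pos (e : R) A : `|e| = 1 -> measurable A -> (forall x, A x -> 0 <= e * F x) ->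
    {ae P, forall x, A x -> F x = 0}.
  move=> e1 mA A0.
  have bAF : bmeas (fun x => \1_A x * F x).
    by apply: bmeasM => //; exact: bmeas_indic.
  have beF : bmeas (fun x => e * (\1_A x * F x)).
    by apply: bmeasM => //; exact: bmeas_cst.
  have e0 : e != 0 by rewrite -normr_eq0 e1 oner_neq0.
  have : {ae P, forall x, e * (\1_A x * F x) = 0}.
    apply: Rint_eq0 => //; last by rewrite RintZ // H // mulr0.
    move=> x; rewrite indicE; have [/set_mem Ax|] := boolP (x \in A).
      by rewrite mul1r A0.
    by rewrite mul0r mulr0.
  apply: filterS => x + Ax; rewrite indicE mem_set // mul1r.
  by move/eqP; rewrite mulf_eq0 (negPf e0) => /eqP.
have mle : measurable [set x | 0 <= F x].
  have -> : [set x | 0 <= F x] = F @^-1` `[0, +oo[.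
    by apply/seteqP; split=> x /=; rewrite in_itv /= andbT.
  by rewrite -[X in measurable X]setTI; exact: mF.
have p1 := pos 1 _ (normr1 _) mle.
have p2 := pos (-1) (~` [set x | 0 <= F x]).
have {}p1 := p1 (fun x h => eq_ind_r (fun y => 0 <= y) h (mul1r (F x))).
have {}p2 : {ae P, forall x, (~` [set x | 0 <= F x]) x -> F x = 0}.
  apply: p2; rewrite ?normrN ?normr1 //; first exact: measurableC.
  by move=> x /negP; rewrite -ltNge mulN1r oppr_ge0 => /ltW.
apply: filterS2 p1 p2 => x p1 p2.
by have [/p1|/p2] := EM (0 <= F x).
Qed.

End pi_system_zero.

Lemma ae0_rectangles {R : realType} {d1 d2} {T1 : measurableType d1}
    {T2 : measurableType d2} (P1 : probability T1 R) (P2 : probability T2 R)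
    (F : T1 * T2 -> R) : bmeas F ->
  (forall A B, measurable A -> measurable B ->
    \int[prodP P1 P2]_p (\1_A p.1 * \1_B p.2 * F p) = 0) ->
  {ae prodP P1 P2, forall p, F p = 0}.
Proof.
move=> bF FAB.
have E A B (p : T1 * T2) : \1_(A `*` B) p = \1_A p.1 * \1_B p.2 :> R.
  by rewrite !indicE in_setX -natrM mulnb.
apply: (@ae0_pi_system _ _ _ _ [set A `*` B | A in measurable & B in measurable]) => //.
- exact: measurable_prod_measurableType.
- move=> _ _ [A mA [B mB <-]] [C mC [D mD <-]]; rewrite -setXI.
  exists (A `&` C); first exact: measurableI.
  by exists (B `&` D) => //; exact: measurableI.
- have := FAB _ _ (@measurableT _ T1) (@measurableT _ T2).
  by move=> <-; apply: eq_Rintegral => p _; rewrite !indicT !mul1r.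
- move=> _ [A mA [B mB <-]]; rewrite -[RHS](FAB A B) //.
  by apply: eq_Rintegral => p _; rewrite E.
Qed.

(** * The circle as R/Z *)

Definition ec {R : realType} (x : R) : R := cos (2 * pi * x).
Definition es {R : realType} (x : R) : R := sin (2 * pi * x).

Section circle.
Context {R : realType}.
Implicit Types x y : R.

Lemma sin_pi_int x : inZ x -> sin (pi * x) = 0.
Proof.
have nat_case n : sin (pi * n%:R : R) = 0.
  by rewrite mulr_natr -[_ *+ _]add0r (alternatingn (@sinDpi R)) sin0 mulr0.
move=> /intrP[[n|n] ->]; first by rewrite -pmulrn.
by rewrite NegzE mulrNz mulrN sinN -pmulrn nat_case oppr0.
Qed.

(** [sin (pi * x)] vanishes exactly at the integers, whereas [es x] also vanishes at half-integers;
    subtracting the floor reduces to [[0, 1[], where the sine is positive off 0. *)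
Lemma inZ_sin x : inZ x <-> sin (pi * x) = 0.
Proof.
split; first exact: sin_pi_int.
move=> sx; pose f := x - (Num.floor x)%:~R.
have sf : sin (pi * f) = 0.
  by rewrite mulrBr sinB sx (sin_pi_int (intr_int R _)) mul0r mulr0 subrr.
have /andP[f0 f1] : 0 <= f < 1.
  by rewrite subr_ge0 floor_le ltrBlDl -[1]/(1%:~R) -intrD floorD1_gt.
move: f0; rewrite le_eqVlt => /orP[/eqP f0|f0].
  by rewrite /inZ -(subrK (Num.floor x)%:~R x) -/f -f0 add0r intr_int.
have := @sin_gt0_pi R (pi * f).
rewrite sf ltxx mulr_gt0 ?pi_gt0 //= => H.
by have := H (_ : pi * f < pi); rewrite gtr_pMr ?pi_gt0 // => /(_ f1).
Qed.

Lemma ec2Des2 x : ec x ^+ 2 + es x ^+ 2 = 1.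
Proof. exact: cos2Dsin2. Qed.

Lemma ecD x y : ec (x + y) = ec x * ec y - es x * es y.
Proof. by rewrite /ec mulrDr cosD. Qed.

Lemma esD x y : es (x + y) = es x * ec y + ec x * es y.
Proof. by rewrite /es mulrDr sinD. Qed.

Lemma ecN x : ec (- x) = ec x.
Proof. by rewrite /ec mulrN cosN. Qed.

Lemma esN x : es (- x) = - es x.
Proof. by rewrite /es mulrN sinN. Qed.

Lemma norm_ec x : `|ec x| <= 1. Proof. exact: cos_max. Qed.
Lemma norm_es x : `|es x| <= 1. Proof. exact: sin_max. Qed.

Lemma ec_sin x : ec x = 1 - 2 * sin (pi * x) ^+ 2.
Proof.
rewrite /ec -mulrA mulr_natl cos_mulr2n cos2sin2; ring.
Qed.

Lemma inZ_ec x : inZ x <-> ec x = 1.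
Proof.
rewrite inZ_sin ec_sin; split=> [->|]; first by rewrite expr0n mulr0 subr0.
move=> /eqP; rewrite -subr_eq0 addrAC subrr add0r oppr_eq0 mulf_eq0.
by rewrite pnatr_eq0 /= expf_eq0 /= => /eqP.
Qed.

Lemma inZ_es x : inZ x -> es x = 0.
Proof.
move=> /inZ_ec cx; have := ec2Des2 x; rewrite cx expr1n -[RHS]addr0.
by move=> /addrI /eqP; rewrite expf_eq0 /= => /eqP.
Qed.

Lemma inZ_eq x y : inZ (x - y) <-> ec x = ec y /\ es x = es y.
Proof.
split=> [|[cxy sxy]].
  move=> h; have /inZ_ec c1 := h; have s0 := inZ_es h.
  have := ecD (x - y) y; have := esD (x - y) y.
  by rewrite subrK c1 s0 !mul1r !mul0r subr0 add0r => -> ->.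
by apply/inZ_ec; rewrite ecD ecN esN cxy sxy mulrN opprK -!expr2 ec2Des2.
Qed.

Lemma circle_lift (a b : R) : a ^+ 2 + b ^+ 2 = 1 -> exists x, ec x = a /\ es x = b.
Proof.
move=> ab1.
have a1 : -1 <= a <= 1.
  by rewrite -ler_norml -(@expr_le1 _ 2) // real_normK ?num_real // -ab1 lerDl sqr_ge0.
have p0 : 2 * pi != 0 :> R by rewrite mulf_neq0 // ?pnatr_eq0 // gt_eqF // pi_gt0.
have E c : 2 * pi * (c / (2 * pi)) = c :> R by rewrite mulrC divfK.
have ca : cos (acos a) = a by apply: acosK; rewrite in_itv.
have sb : sin (acos a) = `|b|.
  by rewrite sin_acos // -ab1 addrAC subrr add0r sqrtr_sqr.
have [b0|b0] := leP 0 b.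
  exists (acos a / (2 * pi)); rewrite /ec /es E ca sb; split=> //.
  exact: ger0_norm.
exists (- acos a / (2 * pi)); rewrite /ec /es E cosN sinN ca sb ltr0_norm //.
by rewrite opprK.
Qed.

End circle.

Section Tmeasurable.
Context {R : realType} {d d' : measure_display}.
Context {T : measurableType d} {T' : measurableType d'}.
Implicit Types f g : T -> R.

Lemma Tmeasurable_ec f : Tmeasurable f -> bmeas (fun x => ec (f x)).
Proof. by move=> [mf _]; split => //; exists 1 => x; exact: norm_ec. Qed.

Lemma Tmeasurable_es f : Tmeasurable f -> bmeas (fun x => es (f x)).
Proof. by move=> [_ mf]; split => //; exists 1 => x; exact: norm_es. Qed.

Lemma Tmeasurable_cst (c : R) : Tmeasurable (fun _ : T => c).
Proof. by split; exact: measurable_cst. Qed.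

Lemma TmeasurableD f g : Tmeasurable f -> Tmeasurable g ->
  Tmeasurable (fun x => f x + g x).
Proof.
move=> mf mg; have [cf _] := Tmeasurable_ec mf; have [sf _] := Tmeasurable_es mf.
have [cg _] := Tmeasurable_ec mg; have [sg _] := Tmeasurable_es mg.
split.
  rewrite (_ : (fun y => _) = fun y => ec (f y) * ec (g y) - es (f y) * es (g y)).
    by apply: measurable_funB; exact: measurable_funM.
  by apply/funext => y; rewrite -ecD.
rewrite (_ : (fun y => _) = fun y => es (f y) * ec (g y) + ec (f y) * es (g y)).
  by apply: measurable_funD; exact: measurable_funM.
by apply/funext => y; rewrite -esD.
Qed.

Lemma TmeasurableN f : Tmeasurable f -> Tmeasurable (fun x => - f x).
Proof.
move=> mf; have [cf _] := Tmeasurable_ec mf; have [sf _] := Tmeasurable_es mf.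
split.
  by rewrite (_ : (fun y => _) = fun y => ec (f y)) //; apply/funext => y; rewrite -ecN.
rewrite (_ : (fun y => _) = fun y => - es (f y)).
  by have [] := bmeasN (Tmeasurable_es mf).
by apply/funext => y; rewrite -esN.
Qed.

Lemma TmeasurableB f g : Tmeasurable f -> Tmeasurable g ->
  Tmeasurable (fun x => f x - g x).
Proof. by move=> mf mg; apply: TmeasurableD => //; exact: TmeasurableN. Qed.

Lemma Tmeasurable_comp f (h : T' -> T) : measurable_fun setT h ->
  Tmeasurable f -> Tmeasurable (fun x => f (h x)).
Proof.
by move=> mh [cf sf]; split; [exact: (measurableT_comp cf)|exact: (measurableT_comp sf)].
Qed.

Lemma measurable_inZ f : Tmeasurable f -> measurable [set x | inZ (f x)].
Proof.
move=> mf; have [cf _] := Tmeasurable_ec mf.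
rewrite (_ : [set x | _] = (fun x => ec (f x)) @^-1` [set 1]).
  by rewrite -[X in measurable X]setTI; exact: cf.
by apply/seteqP; split=> x /inZ_ec.
Qed.

End Tmeasurable.

Section inZ_closed.
Context {R : realType}.
Implicit Types x y : R.

Lemma inZD x y : inZ x -> inZ y -> inZ (x + y). Proof. exact: rpredD. Qed.
Lemma inZB x y : inZ x -> inZ y -> inZ (x - y). Proof. exact: rpredB. Qed.
Lemma inZN x : inZ x -> inZ (- x). Proof. by rewrite /inZ rpredN. Qed.
Lemma inZ0 : inZ (0 : R). Proof. exact: rpred0. Qed.

End inZ_closed.

Section countable_families.
Context {R : realType} {d : measure_display} {T : measurableType d}.
Variables (G : countType) (P : probability T R).

Lemma ae_forall (Q : G -> T -> Prop) : (forall g, {ae P, forall x, Q g x}) ->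
  {ae P, forall x, forall g, Q g x}.
Proof.
move=> aQ; pose Q' n x := if unpickle n is Some g then Q g x else True.
have : {ae P, forall x, forall n, Q' n x}.
  apply: ae_foralln => n; rewrite /Q'; case: unpickle => [g|]; first exact: aQ.
  exact: aeW.
by apply: filterS => x Q'x g; have := Q'x (pickle g); rewrite /Q' pickleK.
Qed.

Lemma measurable_forall (Q : G -> set T) : (forall g, measurable (Q g)) ->
  measurable [set x | forall g, Q g x].
Proof.
move=> mQ; pose Q' n := if unpickle n is Some g then Q g else setT.
rewrite (_ : [set x | _] = \bigcap_n Q' n).
  by apply: bigcapT_measurable => n; rewrite /Q'; case: unpickle.
apply/seteqP; split=> x /= Qx.
  by move=> n _; rewrite /Q'; case: unpickle.
by move=> g; have := Qx (pickle g) I; rewrite /Q' pickleK.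
Qed.

End countable_families.

(** * Ergodicity and superrigidity *)

Definition mp_action {R : realType} {d} {Y : measurableType d} {G : Type}
    (mul : G -> G -> G) (one : G) (eta : set Y -> \bar R) (a : G -> Y -> Y) :=
  [/\ forall g, measure_preserving eta eta (a g), forall y, a one y = y &
      forall g h y, a (mul g h) y = a g (a h y)].

Section ergodic_constant.
Context {R : realType} {d : measure_display} {Y : measurableType d}.
Variables (G : countType) (mul : G -> G -> G) (one : G) (inv : G -> G).
Hypothesis groupG : group_axioms mul one inv.
Variables (eta : probability Y R) (a : G -> Y -> Y).
Hypothesis mpa : mp_action mul one eta a.
Hypothesis erg : ergodic eta a.

(** Each level set [F y < r] has measure 0 or 1. Testing rational [r] suffices: at a generic point
    [y0] these tests identify [F y0] as the almost sure value. *)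
Lemma ergodic_const_real (F : Y -> R) : measurable_fun setT F ->
  (forall g, {ae eta, forall y, F (a g y) = F y}) ->
  exists k, {ae eta, forall y, F y = k}.
Proof.
move=> mF Fa; have [ma a1 aM] := mpa; have [_ _ mulg1 mulVg mulgV] := groupG.
have cut r : {ae eta, forall y, F y < r} \/ {ae eta, forall y, ~ F y < r}.
  (* [ergodic] speaks of exactly invariant sets while [F] is invariant only almost everywhere;
     quantifying over the countable [G] gives an exactly invariant set that agrees with the level
     set up to a null set. *)
  pose A := [set y | forall g, F (a g y) < r].
  have mA : measurable A.
    apply: measurable_forall => g.
    rewrite [X in measurable X](_ : _ = setT `&` (F \o a g) @^-1` `]-oo, r[).
      by apply: (measurableT_comp mF) => //; case: (ma g).
    by apply/seteqP; split=> y /=; rewrite in_itv /=; [|case].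
  have Ainv g : a g @^-1` A = A.
    apply/seteqP; split=> y /= Ay h.
      by have := Ay (mul h (inv g)); rewrite -aM; case: groupG => mulA _ _ _ _;
        rewrite -mulA mulVg mulg1.
    by rewrite -aM; exact: Ay.
  have := ae_forall Fa => /= aeF.
  have [A0|A1] := erg mA Ainv.
    right; have : {ae eta, forall y, (~` A) y}.
      apply/ae_measurableP; first exact: measurableC.
      by rewrite setCK.
    by apply: filterS2 aeF => y Fy nA Fr; apply: nA => g; rewrite Fy.
  left; have : {ae eta, forall y, A y}.
    by apply/ae_measurableP => //; rewrite probability_setC // A1 subee.
  by apply: filterS => y /(_ one); rewrite a1.
pose b q := {ae eta, forall y, F y < ratr q :> R}.
have gen : {ae eta, forall y, forall q, F y < ratr q <-> b q}.
  apply: ae_forall => q; have [h|h] := cut (ratr q).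
    by apply: filterS (h) => y Fy; split.
  apply: filterS (h) => y Fy; split=> // bq.
  have [z []] := ae_ex (filterI bq h); by [].
have [y0 g0] := ae_ex gen; exists (F y0).
apply: filterS gen => y gy; apply/eqP; rewrite eq_le !leNgt.
apply/andP; split; apply/negP => /rat_in_itvoo[q]; rewrite in_itv /= => /andP[].
  move=> /g0 /gy; by move=> h /(lt_trans h); rewrite ltxx.
by move=> /gy /g0 h /(lt_trans h); rewrite ltxx.
Qed.

Lemma ergodic_const (f : Y -> R) : Tmeasurable f ->
  (forall g, {ae eta, forall y, inZ (f (a g y) - f y)}) ->
  exists k, {ae eta, forall y, inZ (f y - k)}.
Proof.
move=> mf fa.
have [mc _] := Tmeasurable_ec mf; have [ms _] := Tmeasurable_es mf.
have [k1 c1] := ergodic_const_real mc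
  (fun g => filterS (fun y h => proj1 (proj1 (inZ_eq _ _) h)) (fa g)).
have [k2 c2] := ergodic_const_real ms
  (fun g => filterS (fun y h => proj2 (proj1 (inZ_eq _ _) h)) (fa g)).
have [y0 [e1 e2]] := ae_ex (filterI c1 c2); exists (f y0).
by apply: filterS2 c1 c2 => y h1 h2; apply/inZ_eq; rewrite h1 h2 e1 e2.
Qed.

End ergodic_constant.

Ltac meas := repeat first
  [ assumption
  | match goal with
    | |- measurable_fun _ (fun x => x) => exact: measurable_id
    | |- measurable_fun _ (fun _ => ?c) => exact: measurable_cst
    | |- measurable_fun _ (fun x => (@?f x, @?g x)) =>
        apply: (@measurable_fun_pair _ _ _ _ _ _ f g)
    | |- measurable_fun _ (fun x => fst (@?f x)) =>
        apply: (@measurableT_comp _ _ _ _ _ _ fst _ f); first exact: measurable_fst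
    | |- measurable_fun _ (fun x => snd (@?f x)) =>
        apply: (@measurableT_comp _ _ _ _ _ _ snd _ f); first exact: measurable_snd
    | H : measurable_fun _ ?h |- measurable_fun _ (fun x => ?h (@?f x)) =>
        apply: (@measurableT_comp _ _ _ _ _ _ h _ f H)
    end ].

Ltac bmeas_tac := repeat first
  [ assumption
  | match goal with
    | |- bmeas (fun _ => ?c) => exact: bmeas_cst
    | |- bmeas (fun x => @?f x * @?g x) => apply: (@bmeasM _ _ _ f g)
    | |- bmeas (fun x => @?f x - @?g x) => apply: (@bmeasB _ _ _ f g)
    | |- bmeas (fun x => @?f x + @?g x) => apply: (@bmeasD _ _ _ f g)
    | |- bmeas (fun x => - @?f x) => apply: (@bmeasN _ _ _ f)
    | H : bmeas ?h |- bmeas (fun x => ?h (@?f x)) =>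
        apply: (@bmeas_comp _ _ _ _ _ h f _ H)
    | H : measurable ?A |- bmeas (fun x => \1_?A (@?f x)) =>
        apply: (@bmeas_comp _ _ _ _ _ \1_A f _ (bmeas_indic H))
    end
  | progress meas ].

Section ergodic_product.
Context {R : realType} {d1 d2 : measure_display}.
Context {Z : measurableType d1} {Y : measurableType d2}.
Variables (G : countType) (mul : G -> G -> G) (one : G) (inv : G -> G).
Hypothesis groupG : group_axioms mul one inv.
Variables (nu : probability Z R) (eta : probability Y R).
Variables (a : G -> Z -> Z) (a' : G -> Y -> Y).
Hypothesis mpa : mp_action mul one nu a.
Hypothesis mpa' : mp_action mul one eta a'.

Lemma mp_action_prod : mp_action mul one (prodP nu eta)
  (fun g p => (a g p.1, a' g p.2)).
Proof.
have [ma a1 aM] := mpa; have [ma' a1' aM'] := mpa'; split.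
- by move=> g; exact: preserving_prod.
- by move=> [z y] /=; rewrite a1 a1'.
- by move=> g h [z y] /=; rewrite aM aM'.
Qed.

End ergodic_product.

Section ergodic_product.
Context {R : realType} {d1 d2 : measure_display}.
Context {Z : measurableType d1} {Y : measurableType d2}.
Variables (G : countType) (mul : G -> G -> G) (one : G) (inv : G -> G).
Hypothesis groupG : group_axioms mul one inv.
Variables (nu : probability Z R) (eta : probability Y R).
Variables (a : G -> Z -> Z) (a' : G -> Y -> Y).
Hypothesis mpa : mp_action mul one nu a.
Hypothesis mpa' : mp_action mul one eta a'.

(* For an invariant set with indicator [f], the function
   [(z, z') |-> \int f(z,y) f(z',y) dy] is invariant on [Z * Z], hence
   constant; this forces [\int_E f(z,y) dz = nu(E) \int f(z,y) dz] for almost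
   every [y], i.e. [f] does not depend on [z]. *)
Lemma ergodic_prod :
  ergodic (prodP nu nu) (fun g p => (a g p.1, a g p.2)) ->
  ergodic eta a' ->
  ergodic (prodP nu eta) (fun g p => (a g p.1, a' g p.2)).
Proof.
move=> ergZZ ergY A mA Ainv.
have [ma a1 aM] := mpa; have [ma' a1' aM'] := mpa'.
pose f : Z * Y -> R := \1_A.
have bf : bmeas f by exact: bmeas_indic.
have fg g z y : f (a g z, a' g y) = f (z, y).
  have E : A (a g z, a' g y) = A (z, y) by rewrite -[in RHS](Ainv g).
  by rewrite /f !indicE; congr (nat_of_bool _)%:R; apply/idP/idP; rewrite !in_setE E.
pose K (q : Z * Z) := \int[eta]_y (f (q.1, y) * f (q.2, y)).
have bff : bmeas (fun p : (Z * Z) * Y => f (p.1.1, p.2) * f (p.1.2, p.2)).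
  by bmeas_tac.
have bK : bmeas K by exact: (bmeas_Rint1 (prodP nu nu) eta bff).
have [k Kk] : exists k, {ae prodP nu nu, forall q, K q = k}.
  apply: (ergodic_const_real groupG (mp_action_prod mpa mpa) ergZZ).
    by case: bK.
  move=> g; apply: aeW => -[z z']; rewrite /K /=.
  rewrite -(Rint_preserving (ma' g)) //; last by bmeas_tac.
  by apply: eq_Rintegral => y _; rewrite !fg.
pose p (E : set Z) y := \int[nu]_z (\1_E z * f (z, y)).
have bp E : measurable E -> bmeas (p E).
  move=> mE; apply: (bmeas_Rint2 nu eta (f := fun q => \1_E q.1 * f (q.1, q.2))).
  by bmeas_tac.
have pp E E' : measurable E -> measurable E' ->
    \int[eta]_y (p E y * p E' y) = k * (fine (nu E) * fine (nu E')).
  move=> mE mE'.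
  have bE1 y : bmeas (fun z => \1_E z * f (z, y)) by bmeas_tac.
  have bE2 y : bmeas (fun z => \1_E' z * f (z, y)) by bmeas_tac.
  transitivity (\int[eta]_y \int[prodP nu nu]_q
      (\1_E q.1 * \1_E' q.2 * (f (q.1, y) * f (q.2, y)))).
    apply: eq_Rintegral => y _.
    rewrite -(Rint_prod1 nu nu (f := fun q => \1_E q.1 * \1_E' q.2 * (f (q.1, y) * f (q.2, y)))); last by bmeas_tac.
    rewrite mulrC -RintZ //; apply: eq_Rintegral => z _ /=.
    rewrite mulrC -RintZ //; apply: eq_Rintegral => z' _ /=.
    ring.
  rewrite -(Rint_fubini (prodP nu nu) eta (f := fun q => \1_E q.1.1 * \1_E' q.1.2 * (f (q.1.1, q.2) * f (q.1.2, q.2)))); last by bmeas_tac.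
  transitivity (\int[prodP nu nu]_q (\1_E q.1 * \1_E' q.2 * K q)).
    by apply: eq_Rintegral => q _; rewrite -RintZ //; bmeas_tac.
  transitivity (\int[prodP nu nu]_q (k * (\1_E q.1 * \1_E' q.2))).
    apply: ae_Rint; try by bmeas_tac.
    by apply: filterS Kk => q ->; rewrite mulrC.
  rewrite RintZ; last by bmeas_tac.
  rewrite -(Rint_prod1 nu nu (f := fun q => \1_E q.1 * \1_E' q.2)); last by bmeas_tac.
  congr (_ * _); rewrite -!Rint_indic //.
  transitivity (\int[nu]_z (\int[nu]_z' \1_E' z' * \1_E z)).
    by apply: eq_Rintegral => z _; rewrite mulrC -RintZ //; exact: bmeas_indic.
  by rewrite (RintZ nu (\int[nu]_z' \1_E' z') (bmeas_indic mE)); exact: mulrC.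
have [m pm] : exists m, {ae eta, forall y, p setT y = m}.
  apply: (ergodic_const_real groupG mpa' ergY); first by case: (bp setT).
  move=> g; apply: aeW => y; rewrite /p; have mT := @measurableT _ Z.
  rewrite -(Rint_preserving (ma g)) //; last by bmeas_tac.
  by apply: eq_Rintegral => z _; rewrite fg !indicT.
have nuT : fine (nu setT) = 1 by rewrite [X in fine X](probability_setT nu).
have pE E : measurable E -> {ae eta, forall y, p E y = fine (nu E) * m}.
  move=> mE; pose e := fine (nu E).
  have bpE := bp _ mE; have bpT := bp _ measurableT.
  (* By [pp] the integral is [k * (e ^ 2 - 2 * e * e + e ^ 2) = 0]. *)
  have : {ae eta, forall y, (p E y - e * p setT y) * (p E y - e * p setT y) = 0}.
    apply: Rint_eq0; [by bmeas_tac|by move=> y; rewrite -expr2 sqr_ge0|].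
    transitivity (\int[eta]_y (p E y * p E y - (2 * e) * (p E y * p setT y)
        + (e * e) * (p setT y * p setT y))).
      by apply: eq_Rintegral => y _; ring.
    rewrite RintD; try by bmeas_tac.
    rewrite RintB; try by bmeas_tac.
    rewrite !RintZ; try by bmeas_tac.
    by rewrite !pp // nuT /e; ring.
  apply: filterS2 pm => y -> /eqP.
  by rewrite mulf_eq0 orbb subr_eq0 => /eqP.
have : {ae prodP nu eta, forall q, f q - m = 0}.
  apply: ae0_rectangles; first by bmeas_tac.
  move=> E B mE mB.
  rewrite -(Rint_prod2 nu eta (f := fun q => \1_E q.1 * \1_B q.2 * (f q - m))); last by bmeas_tac.
  transitivity (\int[eta]_y (\1_B y * (p E y - fine (nu E) * m))).
    apply: eq_Rintegral => y _.
    have bE1 : bmeas (fun z => \1_E z * f (z, y)) by bmeas_tac.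
    rewrite -Rint_indic // mulrC [_ * m]mulrC -RintZ; last exact: bmeas_indic.
    rewrite -RintB //; last by bmeas_tac; exact: bmeas_indic.
    rewrite mulrC -RintZ; last by bmeas_tac; exact: bmeas_indic.
    by apply: eq_Rintegral => z _ /=; ring.
  rewrite -[RHS](Rint_cst eta 0); apply: ae_Rint.
  - have := bp _ mE => bpE; by bmeas_tac; exact: bmeas_indic.
  - exact: bmeas_cst.
  - by apply: filterS (pE _ mE) => y ->; rewrite subrr mulr0.
move=> fm; have [q fq] := ae_ex fm.
have {}fm : {ae prodP nu eta, forall x, (x \in A) = (q \in A)}.
  apply: filterS fm => x /subr0_eq; rewrite -(subr0_eq fq) /f !indicE => /eqP.
  by rewrite eqr_nat; do 2!case: (_ \in A).
have [qA|qA] := boolP (q \in A).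
  right; apply: ae_probability1 => //.
  by apply: filterS fm => x; rewrite qA => /set_mem.
left; have : {ae prodP nu eta, forall x, (~` A) x}.
  by apply: filterS fm => x; rewrite (negPf qA) => + /mem_set => ->.
by move/(ae_measurableP _ (measurableC mA)); rewrite setCK.
Qed.

End ergodic_product.

Section preserving_maps.
Context {R : realType} {d1 d2 : measure_display}.
Context {T1 : measurableType d1} {T2 : measurableType d2}.
Variables (P1 : probability T1 R) (P2 : probability T2 R).

Lemma preserving_id : measure_preserving P1 P1 id.
Proof. by split; [exact: measurable_id|]. Qed.

Lemma preserving_fst : measure_preserving (prodP P1 P2) P1 fst.
Proof.
split=> [|A mA]; first exact: measurable_fst.
rewrite (_ : fst @^-1` A = A `*` [set: T2]); last first.
  by apply/seteqP; split=> p //= -[].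
by rewrite prodPE // [X in (_ * X)%E](probability_setT P2) mule1.
Qed.

Lemma preserving_snd : measure_preserving (prodP P1 P2) P2 snd.
Proof.
split=> [|A mA]; first exact: measurable_snd.
rewrite (_ : snd @^-1` A = [set: T1] `*` A); last first.
  by apply/seteqP; split=> p //= -[].
by rewrite prodPE // [X in (X * _)%E](probability_setT P1) mul1e.
Qed.

Lemma preserving_swap :
  measure_preserving (prodP P1 P2) (prodP P2 P1) (fun p => (p.2, p.1)).
Proof.
have mh : measurable_fun setT (fun p : T1 * T2 => (p.2, p.1)) by meas.
split=> // A mA; symmetry; pose h := mfun_Sub (mem_set mh).
apply: (@prodP_unique _ _ _ _ _ P2 P1 (distribution (prodP P1 P2) h)) => //.
move=> B C mB mC; rewrite /distribution /pushforward /=.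
have -> : (fun p : T1 * T2 => (p.2, p.1)) @^-1` (B `*` C) = C `*` B.
  by apply/seteqP; split=> p /= [].
by rewrite prodPE // muleC.
Qed.

End preserving_maps.

Section group_inverse.
Context {G : Type} (mul : G -> G -> G) (one : G) (inv : G -> G).
Hypothesis groupG : group_axioms mul one inv.

Lemma group_invK g : inv (inv g) = g.
Proof.
have [mulA mul1 mulg1 mulVg mulgV] := groupG.
by rewrite -[LHS]mulg1 -(mulVg g) mulA mulVg mul1.
Qed.

Lemma group_invM g h : inv (mul g h) = mul (inv h) (inv g).
Proof.
have [mulA mul1 mulg1 mulVg mulgV] := groupG.
rewrite -[RHS]mulg1 -(mulgV (mul g h)) !mulA.
by rewrite -(mulA (inv h)) mulVg mulg1 mulVg mul1.
Qed.

End group_inverse.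

(** * Splitting the transfer function on a superrigid square *)

Section superrigid_split.
Context {R : realType} {d : measure_display} {Z : measurableType d}.
Variables (G : countType) (mul : G -> G -> G) (one : G) (inv : G -> G).
Hypothesis groupG : group_axioms mul one inv.
Variables (nu : probability Z R) (a : G -> Z -> Z).
Hypothesis mpa : mp_action mul one nu a.
Hypothesis rigid : T_cocycle_superrigid mul one inv (prodP nu nu) (diag2 a).

(** [rigid] contains ergodicity of the square of [Z], which serves both as weak mixing of the factor
    [Z] and as the starting product; each use of [ergodic_prod] adds one factor, up to [Z^4]. *)
Lemma superrigid_cube_ergodic : ergodic (prodP nu (prodP nu (prodP nu nu)))
  (fun g p => (a g p.1, (a g p.2.1, (a g p.2.2.1, a g p.2.2.2)))).
Proof.
have [_ erg _] := rigid; have m2 := mp_action_prod mpa mpa.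
have e3 := ergodic_prod groupG mpa m2 erg erg.
exact: (ergodic_prod groupG mpa (mp_action_prod mpa m2) erg e3).
Qed.

(* The transfer function [W] of the cocycle [b g x - b g y] satisfies: the
   alternating sum of [W] over the sides of a quadrilateral is invariant on
   [Z^4], hence constant; fixing two vertices, [W (x, y)] splits as
   [u x + v y]. *)
Lemma superrigid_split (b : G -> Z -> R) (c : G -> G -> R) :
  (forall g, Tmeasurable (b g)) ->
  (forall g h, {ae nu, forall z,
     inZ (c g h - (b g z + b h (a (inv g) z) - b (mul g h) z))}) ->
  exists beta : G -> R, exists u : Z -> R, Tmeasurable u /\
    forall g, {ae nu, forall z, inZ (b g z - beta g - u z + u (a (inv g) z))}.
Proof.
move=> mb cb; have [_ _ sr] := rigid; have [ma a1 aM] := mpa.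
have [lambda [_ [W [mW bW]]]] : exists lambda : G -> R,
    (forall g h, inZ (lambda (mul g h) - lambda g - lambda h)) /\
    exists W : Z * Z -> R, Tmeasurable W /\
      forall g, {ae prodP nu nu, forall p,
        inZ ((b g p.1 - b g p.2) - lambda g - W p + W (diag2 a (inv g) p))}.
  apply: sr => [g|g h].
    by apply: TmeasurableB; (apply: Tmeasurable_comp; last exact: mb); meas.
  have := cb g h => cgh.
  apply: filterS2 (ae_fst nu cgh) (ae_snd nu cgh) => p h1 h2.
  have := inZB h1 h2; congr inZ; rewrite /diag2 /=; ring.
(* With [q = (z, (t, (x, y)))] this is [W (x, y) - W (z, y) + W (z, t) - W (x, t)]; the [b g] and
   [lambda g] terms of the cocycle relation cancel in it. *)
pose V (q : Z * (Z * (Z * Z))) :=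
  W (q.2.2.1, q.2.2.2) - W (q.1, q.2.2.2) + W (q.1, q.2.1) - W (q.2.2.1, q.2.1).
have mV : Tmeasurable V.
  by apply: TmeasurableB; [apply: TmeasurableD; [apply: TmeasurableB|]|];
    (apply: Tmeasurable_comp; last exact: mW); meas.
have [k Vk] : exists k, {ae prodP nu (prodP nu (prodP nu nu)), forall q, inZ (V q - k)}.
  have m4 := mp_action_prod mpa (mp_action_prod mpa (mp_action_prod mpa mpa)).
  apply: (ergodic_const groupG m4 superrigid_cube_ergodic mV) => g.
  (* The relation is used at [inv g], so that the moved argument becomes [a g], the form needed for
     invariance. *)
  have := bW (inv g); rewrite (group_invK groupG) => Wg.
  have s2 := preserving_snd nu nu.
  have pid := preserving_id nu.
  have p1 := ae_preserving (preserving_comp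
    (preserving_snd nu (prodP nu (prodP nu nu))) (preserving_snd nu (prodP nu nu))) Wg.
  have p2 := ae_preserving (preserving_prod pid (preserving_comp
    (preserving_snd nu (prodP nu nu)) s2)) Wg.
  have p3 := ae_preserving (preserving_prod pid (preserving_fst nu (prodP nu nu))) Wg.
  have p4 := ae_preserving (preserving_comp (preserving_snd nu (prodP nu (prodP nu nu)))
    (preserving_comp (preserving_swap nu (prodP nu nu))
      (preserving_prod (preserving_fst nu nu) pid))) Wg.
  apply: filterS2 (filterI p1 p2) (filterI p3 p4) => q [h1 h2] [h3 h4].
  have := inZB (inZD (inZB h1 h2) h3) h4; congr inZ.
  move: q {h1 h2 h3 h4} => [z [t [x y]]]; rewrite /V /diag2 /=; ring.
have [z0 Vz] := ae_ex (ae_prodl Vk); have [t0 Vt] := ae_ex (ae_prodl Vz).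
pose u x := W (x, t0); pose v y := W (z0, y) - W (z0, t0) + k.
have Wuv : {ae prodP nu nu, forall p, inZ (W p - u p.1 - v p.2)}.
  apply: filterS Vt => -[x y]; rewrite /V /= /u /v; congr inZ; ring.
have H g : exists beta, {ae nu, forall z,
    inZ (b g z - beta - u z + u (a (inv g) z))}.
  have [mag _ _] := mp_action_prod mpa mpa.
  have Wuvg := ae_preserving (mag (inv g)) Wuv.
  (* The parenthesis depends on [y] alone and the rest on [x] alone; freezing [y] at a generic point
     gives the constant [beta]. *)
  have : {ae prodP nu nu, forall p, inZ (b g p.1 - (b g p.2 + lambda g + v p.2 -
      v (a (inv g) p.2)) - u p.1 + u (a (inv g) p.1))}.
    apply: filterS2 (bW g) (filterI Wuv Wuvg) => p h1 [h2 h3].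
    have := inZB (inZD h1 h2) h3; congr inZ.
    move: p {h1 h2 h3} => [x y]; rewrite /diag2 /=; ring.
  move=> /(ae_preserving (preserving_swap nu nu)) /ae_prodl /ae_ex [y Hy].
  by exists (b g y + lambda g + v y - v (a (inv g) y)).
have {H} [beta H] := choice H.
exists beta, u; split=> //.
by apply: Tmeasurable_comp mW; meas.
Qed.

(** In the coboundary of [b] the [u] terms telescope, so at a generic point [c] differs from the
    coboundary of [beta] by an integer, and both are constant in the point. *)
Lemma superrigid_split_cst (b : G -> Z -> R) (c : G -> G -> R) :
  (forall g, Tmeasurable (b g)) ->
  (forall g h, {ae nu, forall z,
     inZ (c g h - (b g z + b h (a (inv g) z) - b (mul g h) z))}) ->
  exists beta : G -> R, exists u : Z -> R, [/\ Tmeasurable u,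
    (forall g, {ae nu, forall z, inZ (b g z - beta g - u z + u (a (inv g) z))}) &
    (forall g h, inZ (c g h - (beta g + beta h - beta (mul g h))))].
Proof.
move=> mb cb; have [beta [u [mu bu]]] := superrigid_split mb cb.
exists beta, u; split=> // g h; have [ma a1 aM] := mpa.
have bh := ae_preserving (ma (inv g)) (bu h).
have [z [[h1 h2] [h3 h4]]] :=
  ae_ex (filterI (filterI (cb g h) (bu g)) (filterI bh (bu (mul g h)))).
have := inZB (inZD h1 (inZD h2 h3)) h4; congr inZ.
rewrite (group_invM groupG) aM; ring.
Qed.

End superrigid_split.

(** * Complex-valued integrals and Hilbert-Schmidt kernels *)

Local Open Scope complex_scope.

Section complex_aux.
Context {R : realType}.
Implicit Types z w : R[i].

(** The squared modulus is polynomial in the real and imaginary parts: real valued, multiplicative,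
    and measurable without square roots. *)
Definition sqn z : R := complex.Re z ^+ 2 + complex.Im z ^+ 2.

Lemma ReM z w : complex.Re (z * w) = complex.Re z * complex.Re w - complex.Im z * complex.Im w.
Proof. by case: z w => [a b] [c d]. Qed.

Lemma ImM z w : complex.Im (z * w) = complex.Re z * complex.Im w + complex.Im z * complex.Re w.
Proof. by case: z w => [a b] [c d]. Qed.

Lemma ReD z w : complex.Re (z + w) = complex.Re z + complex.Re w.
Proof. by case: z w => [a b] [c d]. Qed.

Lemma ImD z w : complex.Im (z + w) = complex.Im z + complex.Im w.
Proof. by case: z w => [a b] [c d]. Qed.

Lemma ReN z : complex.Re (- z) = - complex.Re z. Proof. by case: z. Qed.
Lemma ImN z : complex.Im (- z) = - complex.Im z. Proof. by case: z. Qed.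
Lemma ReJ z : complex.Re (conjc z) = complex.Re z. Proof. by case: z. Qed.
Lemma ImJ z : complex.Im (conjc z) = - complex.Im z. Proof. by case: z. Qed.

Lemma complex_eq z w : complex.Re z = complex.Re w -> complex.Im z = complex.Im w -> z = w.
Proof. by case: z w => [a b] [c d] /= -> ->. Qed.

Lemma conjcD z w : conjc (z + w) = conjc z + conjc w.
Proof. by apply: complex_eq; rewrite !(ReJ, ImJ, ReD, ImD) ?opprD. Qed.

Lemma conjcB z w : conjc (z - w) = conjc z - conjc w.
Proof. by apply: complex_eq; rewrite !(ReJ, ImJ, ReD, ImD, ReN, ImN) ?opprD. Qed.

Lemma conjcM z w : conjc (z * w) = conjc z * conjc w.
Proof. by apply: complex_eq; rewrite !(ReJ, ImJ, ReM, ImM); ring. Qed.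

Lemma sqn_ge0 z : 0 <= sqn z.
Proof. by rewrite addr_ge0 ?sqr_ge0. Qed.

Lemma sqnE z : (sqn z)%:C = z * conjc z.
Proof. by apply: complex_eq; rewrite !(ReM, ImM, ReJ, ImJ) /= /sqn; ring. Qed.

Lemma sqnM z w : sqn (z * w) = sqn z * sqn w.
Proof. rewrite /sqn ReM ImM; ring. Qed.

Lemma sqnJ z : sqn (conjc z) = sqn z.
Proof. by rewrite /sqn ReJ ImJ sqrrN. Qed.

Lemma sqnN z : sqn (- z) = sqn z.
Proof. by rewrite /sqn ReN ImN !sqrrN. Qed.

Lemma sqn_real (a : R) : sqn a%:C = a ^+ 2.
Proof. by rewrite /sqn /= expr0n addr0. Qed.

Lemma sqn_eq0 z : sqn z = 0 -> z = 0.
Proof.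
move=> /eqP; rewrite /sqn paddr_eq0 ?sqr_ge0 // !expf_eq0 /=.
by move=> /andP[/eqP h1 /eqP h2]; apply: complex_eq.
Qed.

Lemma sqn0 : sqn 0 = 0.
Proof. by rewrite /sqn /= expr0n addr0. Qed.

Lemma sqn_gt0 z : z != 0 -> 0 < sqn z.
Proof.
move=> z0; rewrite lt_neqAle sqn_ge0 andbT eq_sym.
by apply: contra z0 => /eqP /sqn_eq0 ->.
Qed.

Lemma le_sqnD z w : sqn (z + w) <= 2 * (sqn z + sqn w).
Proof.
rewrite /sqn ReD ImD -subr_ge0.
rewrite (_ : _ - _ = (complex.Re z - complex.Re w) ^+ 2 + (complex.Im z - complex.Im w) ^+ 2).
  by rewrite addr_ge0 ?sqr_ge0.
ring.
Qed.

End complex_aux.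

Definition cbmeas {R : realType} {d} {T : measurableType d} (f : T -> R[i]) :=
  bmeas (fun x => complex.Re (f x)) /\ bmeas (fun x => complex.Im (f x)).

Definition Cint {R : realType} {d} {T : measurableType d}
    (P : probability T R) (f : T -> R[i]) : R[i] :=
  (\int[P]_x complex.Re (f x)) +i* (\int[P]_x complex.Im (f x)).

Section complex_bounded.
Context {R : realType} {d d' : measure_display}.
Context {T : measurableType d} {T' : measurableType d'}.
Implicit Types f g : T -> R[i].

Lemma cbmeas_cst (c : R[i]) : cbmeas (fun _ : T => c).
Proof. by split; exact: bmeas_cst. Qed.

Lemma cbmeasD f g : cbmeas f -> cbmeas g -> cbmeas (fun x => f x + g x).
Proof.
move=> [f1 f2] [g1 g2]; split.
  by under eq_fun do rewrite ReD; exact: bmeasD.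
by under eq_fun do rewrite ImD; exact: bmeasD.
Qed.

Lemma cbmeasM f g : cbmeas f -> cbmeas g -> cbmeas (fun x => f x * g x).
Proof.
move=> [f1 f2] [g1 g2]; split.
  by under eq_fun do rewrite ReM; apply: bmeasB; exact: bmeasM.
by under eq_fun do rewrite ImM; apply: bmeasD; exact: bmeasM.
Qed.

Lemma cbmeasN f : cbmeas f -> cbmeas (fun x => - f x).
Proof.
move=> [f1 f2]; split.
  by under eq_fun do rewrite ReN; exact: bmeasN.
by under eq_fun do rewrite ImN; exact: bmeasN.
Qed.

Lemma cbmeasB f g : cbmeas f -> cbmeas g -> cbmeas (fun x => f x - g x).
Proof. by move=> cf cg; apply: cbmeasD => //; exact: cbmeasN. Qed.

Lemma cbmeasJ f : cbmeas f -> cbmeas (fun x => conjc (f x)).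
Proof.
move=> [f1 f2]; split; first by under eq_fun do rewrite ReJ.
by under eq_fun do rewrite ImJ; exact: bmeasN.
Qed.

Lemma cbmeas_comp f (h : T' -> T) : measurable_fun setT h -> cbmeas f ->
  cbmeas (fun x => f (h x)).
Proof.
move=> mh [f1 f2]; split.
  exact: (bmeas_comp (f := fun x => complex.Re (f x)) mh f1).
exact: (bmeas_comp (f := fun x => complex.Im (f x)) mh f2).
Qed.

Lemma cbmeas_real (f : T -> R) : bmeas f -> cbmeas (fun x => (f x)%:C).
Proof. by move=> bf; split => //; exact: bmeas_cst. Qed.

Lemma bmeas_sqn f : cbmeas f -> bmeas (fun x => sqn (f x)).
Proof.
move=> [f1 f2].
rewrite /sqn; under eq_fun do rewrite !expr2; apply: bmeasD; exact: bmeasM.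
Qed.

Lemma cbmeas_sqn_bound f : cbmeas f -> exists M, forall x, sqn (f x) <= M.
Proof.
move=> /bmeas_sqn[_ [M fM]]; exists M => x.
exact: le_trans (ler_norm _) (fM x).
Qed.

Lemma measurable_eq_complex f g : cbmeas f -> cbmeas g ->
  measurable [set x | f x = g x].
Proof.
move=> cf cg; have [ms _] := bmeas_sqn (cbmeasB cf cg).
rewrite (_ : [set x | _] = (fun x => sqn (f x - g x)) @^-1` [set 0]).
  by rewrite -[X in measurable X]setTI; exact: ms.
apply/seteqP; split=> x /=; first by move=> ->; rewrite subrr sqn0.
by move=> /sqn_eq0 /subr0_eq.
Qed.

End complex_bounded.

Ltac cbmeas_tac := repeat first
  [ assumption
  | match goal with
    | |- cbmeas (fun _ => ?c) => exact: cbmeas_cst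
    | |- cbmeas (fun x => @?f x * @?g x) => apply: (@cbmeasM _ _ _ f g)
    | |- cbmeas (fun x => @?f x - @?g x) => apply: (@cbmeasB _ _ _ f g)
    | |- cbmeas (fun x => @?f x + @?g x) => apply: (@cbmeasD _ _ _ f g)
    | |- cbmeas (fun x => - @?f x) => apply: (@cbmeasN _ _ _ f)
    | |- cbmeas (fun x => conjc (@?f x)) => apply: (@cbmeasJ _ _ _ f)
    | |- bmeas (fun x => sqn (@?f x)) => apply: (@bmeas_sqn _ _ _ f)
    | H : cbmeas ?h |- cbmeas (fun x => ?h (@?f x)) =>
        apply: (@cbmeas_comp _ _ _ _ _ h f _ H)
    | H : forall y, cbmeas (?h y) |- cbmeas (fun x => ?h ?y (@?f x)) =>
        apply: (@cbmeas_comp _ _ _ _ _ (h y) f _ (H y))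
    end
  | progress bmeas_tac ].

Section complex_integral.
Context {R : realType} {d d' : measure_display}.
Context {T : measurableType d} {T' : measurableType d'}.
Variables (P : probability T R) (P' : probability T' R).
Implicit Types f g : T -> R[i].

Lemma eq_Cint f g : f =1 g -> Cint P f = Cint P g.
Proof. by move=> /funext ->. Qed.

Lemma CintD f g : cbmeas f -> cbmeas g ->
  Cint P (fun x => f x + g x) = Cint P f + Cint P g.
Proof.
move=> [f1 f2] [g1 g2]; apply: complex_eq; rewrite ?ReD ?ImD /= -RintD //;
  by apply: eq_Rintegral => x _; rewrite ?ReD ?ImD.
Qed.

Lemma CintZ (c : R[i]) f : cbmeas f -> Cint P (fun x => c * f x) = c * Cint P f.
Proof.
move=> [f1 f2]; apply: complex_eq; rewrite ?ReM ?ImM /=.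
  rewrite -!RintZ // -RintB; [|by apply: bmeasM => //; exact: bmeas_cst..].
  by apply: eq_Rintegral => x _; rewrite ReM.
rewrite -!RintZ // -RintD; [|by apply: bmeasM => //; exact: bmeas_cst..].
by apply: eq_Rintegral => x _; rewrite ImM.
Qed.

Lemma CintB f g : cbmeas f -> cbmeas g ->
  Cint P (fun x => f x - g x) = Cint P f - Cint P g.
Proof.
move=> cf cg; rewrite CintD //; last exact: cbmeasN.
by rewrite -mulN1r -CintZ //; congr (_ + _); apply: eq_Cint => x; rewrite mulN1r.
Qed.

Lemma CintJ f : cbmeas f -> Cint P (fun x => conjc (f x)) = conjc (Cint P f).
Proof.
move=> [f1 f2]; apply: complex_eq; rewrite ?ReJ ?ImJ /=.
  by apply: eq_Rintegral => x _; rewrite ReJ.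
rewrite -[RHS]mulN1r -RintZ //.
by apply: eq_Rintegral => x _; rewrite ImJ mulN1r.
Qed.

Lemma Cint_real (f : T -> R) : Cint P (fun x => (f x)%:C) = (\int[P]_x f x)%:C.
Proof. by apply: complex_eq => //=; rewrite Rint_cst. Qed.

Lemma Cint_cst (c : R[i]) : Cint P (fun _ => c) = c.
Proof. by apply: complex_eq => /=; rewrite Rint_cst. Qed.

Lemma ae_Cint f g : cbmeas f -> cbmeas g -> {ae P, forall x, f x = g x} ->
  Cint P f = Cint P g.
Proof.
move=> [f1 f2] [g1 g2] fg; apply: complex_eq; apply: ae_Rint => //;
  by apply: filterS fg => x ->.
Qed.

Lemma Cint_preserving (h : T' -> T) f : measure_preserving P' P h -> cbmeas f ->
  Cint P' (fun x => f (h x)) = Cint P f.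
Proof.
move=> ph [f1 f2]; apply: complex_eq => /=.
  exact: (Rint_preserving (f := fun x => complex.Re (f x)) ph f1).
exact: (Rint_preserving (f := fun x => complex.Im (f x)) ph f2).
Qed.

(** Nonnegativity of the integral of [|f - t z conj(g)|^2] reads [key t], a quadratic inequality in
    the real [t]; [t] is the inverse of the integral of [|g|^2], or large enough for a contradiction
    when that integral is 0. *)
Lemma cauchy_schwarz f g : cbmeas f -> cbmeas g ->
  sqn (Cint P (fun x => f x * g x)) <=
    (\int[P]_x sqn (f x)) * (\int[P]_x sqn (g x)).
Proof.
move=> cf cg; set z := Cint P _; set F := \int[P]_x sqn (f x).
set Gg := \int[P]_x sqn (g x).
have key t : 0 <= F - 2 * t * sqn z + t ^+ 2 * sqn z * Gg.
  pose c := t%:C * z.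
  have : 0 <= \int[P]_x sqn (f x - c * conjc (g x)) by apply: Rint_ge0 => x; exact: sqn_ge0.
  congr (_ <= _); apply: complexI.
  rewrite -Cint_real.
  under eq_Cint.
    move=> x.
    rewrite sqnE (_ : _ * _ = (sqn (f x))%:C - conjc c * (f x * g x)
      - c * conjc (f x * g x) + c * conjc c * (sqn (g x))%:C); last first.
      by rewrite !sqnE conjcB !conjcM conjcK; ring.
    over.
  have c1 : cbmeas (fun x => (sqn (f x))%:C) by apply: cbmeas_real; cbmeas_tac.
  have c2 : cbmeas (fun x => (sqn (g x))%:C) by apply: cbmeas_real; cbmeas_tac.
  have c3 : cbmeas (fun x => f x * g x) by cbmeas_tac.
  rewrite CintD; [|by cbmeas_tac..].
  rewrite CintB; [|by cbmeas_tac..].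
  rewrite CintB; [|by cbmeas_tac..].
  rewrite !CintZ; [|by cbmeas_tac..].
  rewrite CintJ // !Cint_real -/z -/F -/Gg /c conjcM conjc_real.
  clear c; clearbody z.
  by rewrite !rmorphD !rmorphN !rmorphM /= (rmorph_nat (@real_complex R) 2) sqnE; ring.
have F0 : 0 <= F by apply: Rint_ge0 => x; exact: sqn_ge0.
have G0 : 0 <= Gg by apply: Rint_ge0 => x; exact: sqn_ge0.
have := sqn_ge0 z; rewrite le_eqVlt => /orP[/eqP <-|z0]; first exact: mulr_ge0.
move: G0; rewrite le_eqVlt => /orP[/eqP GE|G0].
  have := key ((F + 1) / (2 * sqn z)); rewrite -GE mulr0 addr0.
  rewrite (_ : F - _ = -1); first by rewrite lerNr oppr0 ler10.
  by field; rewrite gt_eqF.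
have := key Gg^-1.
rewrite (_ : _ + _ = (F * Gg - sqn z) / Gg); last by field; rewrite gt_eqF.
by rewrite pmulr_lge0 ?invr_gt0 // subr_ge0.
Qed.

Lemma sqn_Cint_le f M : cbmeas f -> (forall x, sqn (f x) <= M) ->
  sqn (Cint P f) <= M.
Proof.
move=> cf fM.
have -> : Cint P f = Cint P (fun x => f x * 1) by apply: eq_Cint => x; rewrite mulr1.
apply: le_trans (cauchy_schwarz cf (cbmeas_cst 1)) _.
rewrite (_ : sqn 1 = 1 :> R); last by rewrite -[1]/(1%:C) sqn_real expr1n.
rewrite Rint_cst mulr1 -(Rint_cst P M); apply: le_Rint => //; first by cbmeas_tac.
exact: bmeas_cst.
Qed.

End complex_integral.

Section complex_fubini.
Context {R : realType} {d1 d2 : measure_display}.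
Context {T1 : measurableType d1} {T2 : measurableType d2}.
Variables (P1 : probability T1 R) (P2 : probability T2 R).
Implicit Types f : T1 * T2 -> R[i].

Lemma cbmeas_Cint1 f : cbmeas f -> cbmeas (fun x => Cint P2 (fun y => f (x, y))).
Proof. by move=> [f1 f2]; split; [exact: (bmeas_Rint1 P1 P2 f1)|exact: (bmeas_Rint1 P1 P2 f2)]. Qed.

Lemma Cint_fubini f : cbmeas f ->
  Cint P1 (fun x => Cint P2 (fun y => f (x, y))) =
  Cint P2 (fun y => Cint P1 (fun x => f (x, y))).
Proof.
by move=> [f1 f2]; apply: complex_eq; [exact: (Rint_fubini P1 P2 f1)|exact: (Rint_fubini P1 P2 f2)].
Qed.

End complex_fubini.

Arguments Cint : simpl never.
Arguments conjc : simpl never.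

(** * Integral kernels: composition, adjoint, Hilbert-Schmidt inner product *)

Section kernels.
Context {R : realType} {d : measure_display} {X : measurableType d}.
Variable nu : probability X R.
Implicit Types K L M : X * X -> R[i].

(** Composition of the operators [f |-> \int K (x, z) f (z) dz]. Kernels are bounded functions
    rather than classes modulo null sets, so associativity and bilinearity are equalities of
    functions. *)
Definition kcomp K L : X * X -> R[i] :=
  fun p => Cint nu (fun z => K (p.1, z) * L (z, p.2)).

Definition kadj K : X * X -> R[i] := fun p => conjc (K (p.2, p.1)).

Definition kip K L : R[i] := Cint (prodP nu nu) (fun p => K p * conjc (L p)).

Definition knrm K : R := \int[prodP nu nu]_p sqn (K p).

Lemma cbmeas_kcomp K L : cbmeas K -> cbmeas L -> cbmeas (kcomp K L).
Proof.
move=> cK cL; apply: (cbmeas_Cint1 (prodP nu nu) nu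
  (f := fun q : (X * X) * X => K (q.1.1, q.2) * L (q.2, q.1.2))).
by cbmeas_tac.
Qed.

Lemma cbmeas_kadj K : cbmeas K -> cbmeas (kadj K).
Proof. by move=> cK; rewrite /kadj; cbmeas_tac. Qed.

Lemma kadjK K : kadj (kadj K) = K.
Proof. by apply/funext => -[x y]; rewrite /kadj /= conjcK. Qed.

Lemma kadj_comp K L : cbmeas K -> cbmeas L ->
  kadj (kcomp K L) = kcomp (kadj L) (kadj K).
Proof.
move=> cK cL; apply/funext => -[x y]; rewrite /kadj /kcomp /= -CintJ.
  by apply: eq_Cint => z; rewrite conjcM mulrC.
by cbmeas_tac.
Qed.

Lemma kcompA K L M : cbmeas K -> cbmeas L -> cbmeas M ->
  kcomp (kcomp K L) M = kcomp K (kcomp L M).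
Proof.
move=> cK cL cM; apply/funext => -[x y]; rewrite /kcomp /=.
transitivity (Cint nu (fun w => Cint nu (fun z => K (x, z) * L (z, w) * M (w, y)))).
  apply: eq_Cint => w; rewrite mulrC -CintZ; last by cbmeas_tac.
  by apply: eq_Cint => z; rewrite mulrC.
rewrite (Cint_fubini nu nu (f := fun q => K (x, q.2) * L (q.2, q.1) * M (q.1, y))); last by cbmeas_tac.
apply: eq_Cint => z; rewrite -CintZ; last by cbmeas_tac.
by apply: eq_Cint => w; rewrite mulrA.
Qed.

Lemma kcompDl K L M : cbmeas K -> cbmeas L -> cbmeas M ->
  kcomp (fun p => K p + L p) M = fun p => kcomp K M p + kcomp L M p.
Proof.
move=> cK cL cM; apply/funext => -[x y]; rewrite /kcomp /= -CintD; try by cbmeas_tac.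
by apply: eq_Cint => z; rewrite mulrDl.
Qed.

Lemma kcompDr K L M : cbmeas K -> cbmeas L -> cbmeas M ->
  kcomp M (fun p => K p + L p) = fun p => kcomp M K p + kcomp M L p.
Proof.
move=> cK cL cM; apply/funext => -[x y]; rewrite /kcomp /= -CintD; try by cbmeas_tac.
by apply: eq_Cint => z; rewrite mulrDr.
Qed.

Lemma kcompZl (c : R[i]) K M : cbmeas K -> cbmeas M ->
  kcomp (fun p => c * K p) M = fun p => c * kcomp K M p.
Proof.
move=> cK cM; apply/funext => -[x y]; rewrite /kcomp /= -CintZ; try by cbmeas_tac.
by apply: eq_Cint => z; rewrite mulrA.
Qed.

Lemma kcompZr (c : R[i]) K M : cbmeas K -> cbmeas M ->
  kcomp M (fun p => c * K p) = fun p => c * kcomp M K p.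
Proof.
move=> cK cM; apply/funext => -[x y]; rewrite /kcomp /= -CintZ; try by cbmeas_tac.
by apply: eq_Cint => z; ring.
Qed.

Lemma kcompBl K L M : cbmeas K -> cbmeas L -> cbmeas M ->
  kcomp (fun p => K p - L p) M = fun p => kcomp K M p - kcomp L M p.
Proof.
move=> cK cL cM; apply/funext => -[x y]; rewrite /kcomp /= -CintB; try by cbmeas_tac.
by apply: eq_Cint => z; rewrite mulrBl.
Qed.

Lemma kcompBr K L M : cbmeas K -> cbmeas L -> cbmeas M ->
  kcomp M (fun p => K p - L p) = fun p => kcomp M K p - kcomp M L p.
Proof.
move=> cK cL cM; apply/funext => -[x y]; rewrite /kcomp /= -CintB; try by cbmeas_tac.
by apply: eq_Cint => z; rewrite mulrBr.
Qed.

Lemma Cint_prod2 (f : X * X -> R[i]) : cbmeas f ->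
  Cint nu (fun y => Cint nu (fun x => f (x, y))) = Cint (prodP nu nu) f.
Proof.
by move=> [f1 f2]; apply: complex_eq; [exact: (Rint_prod2 nu nu f1)|exact: (Rint_prod2 nu nu f2)].
Qed.

Lemma kipE K L : cbmeas K -> cbmeas L ->
  kip K L = Cint nu (fun y => Cint nu (fun x => K (x, y) * conjc (L (x, y)))).
Proof.
by move=> cK cL; rewrite (Cint_prod2 (f := fun p => K p * conjc (L p))) //; cbmeas_tac.
Qed.

(** Left composition by [K] has adjoint left composition by [kadj K]. For self-adjoint [S], inner
    products of powers then depend only on the total exponent. *)
Lemma kip_comp K L M : cbmeas K -> cbmeas L -> cbmeas M ->
  kip (kcomp K L) M = kip L (kcomp (kadj K) M).
Proof.
move=> cK cL cM.
have cKL := cbmeas_kcomp cK cL.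
have cKM := cbmeas_kcomp (cbmeas_kadj cK) cM.
rewrite (kipE cKL cM) (kipE cL cKM); apply: eq_Cint => y; rewrite /kcomp /kadj /=.
transitivity (Cint nu (fun x => Cint nu (fun z => K (x, z) * L (z, y) * conjc (M (x, y))))).
  apply: eq_Cint => x; rewrite mulrC -CintZ; last by cbmeas_tac.
  by apply: eq_Cint => z; rewrite mulrC.
rewrite (Cint_fubini nu nu (f := fun q => K (q.1, q.2) * L (q.2, y) * conjc (M (q.1, y)))); last by cbmeas_tac.
apply: eq_Cint => z; rewrite -CintJ; last by cbmeas_tac.
rewrite -CintZ; last by cbmeas_tac.
by apply: eq_Cint => x; rewrite conjcM conjcK; ring.
Qed.

Lemma knrmE K : (knrm K)%:C = kip K K.
Proof. by rewrite -Cint_real; apply: eq_Cint => p; rewrite sqnE. Qed.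

Lemma kipC K L : cbmeas K -> cbmeas L -> kip L K = conjc (kip K L).
Proof.
move=> cK cL; rewrite /kip -CintJ; last by cbmeas_tac.
by apply: eq_Cint => p; rewrite conjcM conjcK mulrC.
Qed.

Lemma knrm_ge0 K : 0 <= knrm K.
Proof. by apply: Rint_ge0 => p; exact: sqn_ge0. Qed.

Lemma knrmB K L : cbmeas K -> cbmeas L ->
  knrm (fun p => K p - L p) = knrm K - 2 * complex.Re (kip K L) + knrm L.
Proof.
move=> cK cL; rewrite /knrm /kip /=.
have c1 : cbmeas (fun p => K p * conjc (L p)) by cbmeas_tac.
have [c2 _] := c1.
rewrite -RintZ // -RintB; try by cbmeas_tac.
rewrite -RintD; try by cbmeas_tac.
apply: eq_Rintegral => p _.
by rewrite ReM ReJ ImJ /sqn ReD ImD ReN ImN; ring.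
Qed.

Lemma knrm_eq0 K : cbmeas K -> knrm K = 0 ->
  {ae prodP nu nu, forall p, K p = 0}.
Proof.
move=> cK /Rint_eq0 h; have : {ae prodP nu nu, forall p, sqn (K p) = 0}.
  by apply: h; [cbmeas_tac|move=> p; exact: sqn_ge0].
by apply: filterS => p /sqn_eq0.
Qed.

Lemma knrm_ae K L : cbmeas K -> cbmeas L ->
  {ae prodP nu nu, forall p, K p = L p} -> knrm K = knrm L.
Proof.
move=> cK cL KL; apply: ae_Rint; try by cbmeas_tac.
by apply: filterS KL => p ->.
Qed.

Lemma kcauchy_schwarz K L : cbmeas K -> cbmeas L ->
  sqn (kip K L) <= knrm K * knrm L.
Proof.
move=> cK cL; apply: le_trans (cauchy_schwarz _ cK (cbmeasJ cL)) _.
by rewrite le_eqVlt; apply/orP; left; apply/eqP; congr (_ * _);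
  apply: eq_Rintegral => p _; rewrite sqnJ.
Qed.

Lemma kcomp_sqn_le K L x y : cbmeas K -> cbmeas L ->
  sqn (kcomp K L (x, y)) <=
  (\int[nu]_z sqn (K (x, z))) * (\int[nu]_z sqn (L (z, y))).
Proof. by move=> cK cL; apply: cauchy_schwarz; cbmeas_tac. Qed.

Lemma knrm_comp K L : cbmeas K -> cbmeas L ->
  knrm (kcomp K L) <= knrm K * knrm L.
Proof.
move=> cK cL; have cKL := cbmeas_kcomp cK cL.
have bK : bmeas (fun p => sqn (K p)) by cbmeas_tac.
have bL : bmeas (fun p => sqn (L p)) by cbmeas_tac.
pose k x := \int[nu]_z sqn (K (x, z)); pose l y := \int[nu]_z sqn (L (z, y)).
have bk : bmeas k by exact: (bmeas_Rint1 nu nu bK).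
have bl : bmeas l by exact: (bmeas_Rint2 nu nu bL).
apply: (@le_trans _ _ (\int[prodP nu nu]_p (k p.1 * l p.2))).
  apply: le_Rint; [by cbmeas_tac|by bmeas_tac|].
  by move=> [x y]; exact: kcomp_sqn_le.
rewrite -(Rint_prod1 nu nu (f := fun p => k p.1 * l p.2)); last by bmeas_tac.
rewrite (_ : \int[nu]_x _ = \int[nu]_x ((\int[nu]_y l y) * k x)); last first.
  by apply: eq_Rintegral => x _ /=; rewrite RintZ // mulrC.
by rewrite RintZ // mulrC /k /l (Rint_prod1 nu nu bK) (Rint_prod2 nu nu bL).
Qed.

(** The supremum is bounded by the Hilbert-Schmidt norm of the middle factor: between two bounded
    kernels, convergence in norm becomes uniform convergence. *)
Lemma kcomp3_sqn_le K L M BK BM p : cbmeas K -> cbmeas L -> cbmeas M ->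
  (forall q, sqn (K q) <= BK) -> (forall q, sqn (M q) <= BM) ->
  sqn (kcomp K (kcomp L M) p) <= BK * BM * knrm L.
Proof.
move=> cK cL cM KB MB; case: p => x y.
have cLM := cbmeas_kcomp cL cM.
have bL : bmeas (fun p => sqn (L p)) by cbmeas_tac.
have B0 : 0 <= BM by apply: le_trans (MB (x, y)); exact: sqn_ge0.
apply: le_trans (kcomp_sqn_le x y cK cLM) _.
have h1 : \int[nu]_z sqn (K (x, z)) <= BK.
  by rewrite -(Rint_cst nu BK); apply: le_Rint; [cbmeas_tac|exact: bmeas_cst|].
have h2 z : sqn (kcomp L M (z, y)) <= BM * \int[nu]_w sqn (L (z, w)).
  apply: le_trans (kcomp_sqn_le z y cL cM) _; rewrite mulrC.
  apply: ler_wpM2r; first by apply: Rint_ge0 => w; exact: sqn_ge0.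
  by rewrite -(Rint_cst nu BM); apply: le_Rint; [cbmeas_tac|exact: bmeas_cst|].
have h3 : \int[nu]_z sqn (kcomp L M (z, y)) <= BM * knrm L.
  have bl : bmeas (fun z => \int[nu]_w sqn (L (z, w))) by exact: (bmeas_Rint1 nu nu bL).
  rewrite /knrm -(Rint_prod1 nu nu bL) -RintZ //.
  by apply: le_Rint => //; cbmeas_tac.
rewrite -mulrA; apply: ler_pM => //; apply: Rint_ge0 => w; exact: sqn_ge0.
Qed.

Lemma kcomp_sqn_bound K L BK BL p : cbmeas K -> cbmeas L ->
  (forall q, sqn (K q) <= BK) -> (forall q, sqn (L q) <= BL) ->
  sqn (kcomp K L p) <= BK * BL.
Proof.
move=> cK cL KB LB; apply: sqn_Cint_le; first by cbmeas_tac.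
by move=> z; rewrite sqnM; apply: ler_pM; rewrite ?sqn_ge0.
Qed.

Lemma kcomp_ae K L L' : cbmeas K -> cbmeas L -> cbmeas L' ->
  {ae prodP nu nu, forall p, L p = L' p} ->
  {ae prodP nu nu, forall p, kcomp K L p = kcomp K L' p}.
Proof.
move=> cK cL cL' LL.
have /ae_prodl := ae_preserving (preserving_swap nu nu) LL.
move=> /(ae_snd nu); apply: filterS => -[x y] /= h.
apply: ae_Cint; try by cbmeas_tac.
by apply: filterS h => z ->.
Qed.

End kernels.

(** * Uniform limits of bounded kernels *)

Lemma uniform_cauchy {R : realType} {d} {T : measurableType d} (u : nat -> T -> R) :
  (forall n, bmeas (u n)) ->
  (forall e : R, 0 < e -> exists N, forall n m, (N <= n)%N -> (N <= m)%N ->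
     forall x, `|u n x - u m x| <= e) ->
  exists v, bmeas v /\ forall e : R, 0 < e -> exists N, forall n, (N <= n)%N ->
     forall x, `|u n x - v x| <= e.
Proof.
move=> bu ucau.
have cu x : cvgn (fun n => u n x).
  apply/cauchy_cvgP/cauchy_exP => e e0.
  have [N HN] := ucau (e / 2) (divr_gt0 e0 (ltr0Sn _ _)).
  exists (u N x); exists N => // n /= Nn; rewrite /ball /=.
  apply: le_lt_trans (HN _ _ (leqnn N) Nn x) _.
  by rewrite ltr_pdivrMr // ltr_pMr // ltr1n.
pose v x := limn (fun n => u n x).
have uv e : 0 < e -> exists N, forall n, (N <= n)%N ->
     forall x, `|u n x - v x| <= e.
  move=> e0; have [N HN] := ucau _ e0; exists N => n Nn x.
  apply/ler_addgt0Pr => s s0.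
  have /cvgrPdist_lt/(_ _ s0)[M _ HM] := cu x.
  have := HM (maxn N M) (leq_maxr _ _); rewrite -/(v x) distrC => h.
  rewrite -(subrKA (u (maxn N M) x)) (le_trans (ler_normD _ _)) // lerD //.
    exact: HN (leq_maxl _ _) _.
  exact: ltW.
exists v; split=> //; split.
  apply: (measurable_fun_cvg (h := u)) => [n|x _]; first by case: (bu n).
  exact: cu.
have [N /(_ N (leqnn N)) HN] := uv 1 ltr01.
have [_ [M uM]] := bu N; exists (M + 1) => x.
rewrite -(subrK (u N x) (v x)) addrC (le_trans (ler_normD _ _)) // lerD //.
by rewrite distrC HN.
Qed.

Section uniform_convergence.
Context {R : realType} {d : measure_display} {X : measurableType d}.
Variable nu : probability X R.
Implicit Types (K L : X * X -> R[i]) (q : nat -> X * X -> R[i]).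

(** Uniform rather than mean-square convergence: limits are then unique as functions, and
    composition passes to the limit at every point. *)
Definition ucvg q K := forall e : R, 0 < e -> exists N, forall n, (N <= n)%N ->
  forall p, sqn (q n p - K p) <= e.

Lemma ucauchy_ucvg q : (forall n, cbmeas (q n)) ->
  (forall e : R, 0 < e -> exists N, forall n m, (N <= n)%N -> (N <= m)%N ->
     forall p, sqn (q n p - q m p) <= e) ->
  exists K, cbmeas K /\ ucvg q K.
Proof.
move=> cq qcau.
have sq (a e : R) : 0 < e -> a ^+ 2 <= e ^+ 2 -> `|a| <= e.
  by move=> e0 ae; rewrite -(@ler_pXn2r _ 2) ?nnegrE ?(ltW e0) // real_normK ?num_real.
have [|v1 [b1 c1]] := @uniform_cauchy _ _ _ (fun n p => complex.Re (q n p)) (fun n => proj1 (cq n)).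
  move=> e e0; have [|N HN] := qcau (e ^+ 2); first exact: exprn_gt0.
  exists N => n m Nn Nm p; apply: sq => //; apply: le_trans (HN _ _ Nn Nm p).
  by rewrite /sqn ReD ReN lerDl sqr_ge0.
have [|v2 [b2 c2]] := @uniform_cauchy _ _ _ (fun n p => complex.Im (q n p)) (fun n => proj2 (cq n)).
  move=> e e0; have [|N HN] := qcau (e ^+ 2); first exact: exprn_gt0.
  exists N => n m Nn Nm p; apply: sq => //; apply: le_trans (HN _ _ Nn Nm p).
  by rewrite /sqn ImD ImN lerDr sqr_ge0.
exists (fun p => v1 p +i* v2 p); split=> // e e0.
pose s := Num.sqrt (e / 2).
have s0 : 0 < s by rewrite sqrtr_gt0 divr_gt0.
have se : s ^+ 2 = e / 2 by rewrite sqr_sqrtr // ltW // divr_gt0.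
have [N1 h1] := c1 _ s0; have [N2 h2] := c2 _ s0.
exists (maxn N1 N2) => n; rewrite geq_max => /andP[n1 n2] p.
rewrite /sqn ReD ImD ReN ImN /= [e]splitr -se -[X in X + _ <= _]real_normK ?num_real //.
rewrite -[X in _ + X <= _]real_normK ?num_real //.
by apply: lerD; rewrite ler_pXn2r ?nnegrE ?(ltW s0) // ?h1 ?h2.
Qed.

Lemma ucvg_unique q K L : ucvg q K -> ucvg q L -> K = L.
Proof.
move=> qK qL; apply/funext => p; apply/subr0_eq/sqn_eq0/eqP.
rewrite eq_le sqn_ge0 andbT; apply/ler_addgt0Pr => e e0; rewrite add0r.
have e4 : 0 < e / 4 by rewrite divr_gt0.
have [N1 h1] := qK _ e4; have [N2 h2] := qL _ e4.
have {}h1 := h1 _ (leq_maxl N1 N2) p; have {}h2 := h2 _ (leq_maxr N1 N2) p.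
have -> : K p - L p = (q (maxn N1 N2) p - L p) + - (q (maxn N1 N2) p - K p) by ring.
apply: le_trans (le_sqnD _ _) _; rewrite sqnN.
apply: le_trans (_ : 2 * (e / 4 + e / 4) <= _); last by rewrite le_eqVlt; apply/orP; left; apply/eqP; field.
by rewrite ler_pM2l // lerD.
Qed.

Lemma ucvg_sub q K (f : nat -> nat) : (forall n, (n <= f n)%N) -> ucvg q K ->
  ucvg (fun n => q (f n)) K.
Proof.
move=> fn qK e e0; have [N HN] := qK _ e0; exists N => n Nn p.
exact: HN (leq_trans Nn (fn n)) p.
Qed.

Lemma ucvgZ (c : R[i]) q K : ucvg q K -> ucvg (fun n p => c * q n p) (fun p => c * K p).
Proof.
move=> qK e e0; have c0 := sqn_ge0 c.
have [|N HN] := qK (e / (sqn c + 1)); first by rewrite divr_gt0 // ltr_wpDl.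
exists N => n Nn p; rewrite -mulrBr sqnM.
apply: le_trans (ler_wpM2l c0 (HN _ Nn p)) _.
rewrite mulrCA ler_piMr ?(ltW e0) // ler_pdivrMr ?ltr_wpDl // mul1r.
by rewrite lerDl.
Qed.

Lemma ucvg_adj q K : ucvg q K -> ucvg (fun n => kadj (q n)) (kadj K).
Proof.
move=> qK e e0; have [N HN] := qK _ e0; exists N => n Nn p.
by rewrite /kadj -conjcB sqnJ HN.
Qed.

Lemma ucvg_compr q K L : (forall n, cbmeas (q n)) -> cbmeas K -> cbmeas L ->
  ucvg q K -> ucvg (fun n => kcomp nu L (q n)) (kcomp nu L K).
Proof.
move=> cq cK cL qK e e0; have [B LB] := cbmeas_sqn_bound cL.
have LB' p : sqn (L p) <= `|B| + 1.
  by apply: le_trans (LB p) _; rewrite (le_trans (ler_norm _)) // lerDl.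
have B0 : 0 < `|B| + 1 by rewrite ltr_wpDl.
have [|N HN] := qK (e / (`|B| + 1)); first by rewrite divr_gt0.
exists N => n Nn p.
have cqK : cbmeas (fun p => q n p - K p) by apply: cbmeasB.
have -> : kcomp nu L (q n) p - kcomp nu L K p = kcomp nu L (fun p => q n p - K p) p.
  by rewrite kcompBr.
apply: le_trans (kcomp_sqn_bound nu p cL cqK LB' (HN _ Nn)) _.
by rewrite mulrCA divff ?mulr1 // gt_eqF.
Qed.

Lemma ucvg_compl q K L : (forall n, cbmeas (q n)) -> cbmeas K -> cbmeas L ->
  ucvg q K -> ucvg (fun n => kcomp nu (q n) L) (kcomp nu K L).
Proof.
move=> cq cK cL qK.
have h := ucvg_compr (fun n => cbmeas_kadj (cq n)) (cbmeas_kadj cK)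
  (cbmeas_kadj cL) (ucvg_adj qK).
have := ucvg_adj h.
rewrite (kadj_comp nu (cbmeas_kadj cL) (cbmeas_kadj cK)) !kadjK.
by under eq_fun do rewrite (kadj_comp nu (cbmeas_kadj cL) (cbmeas_kadj (cq _))) !kadjK.
Qed.

Lemma ucvg_knrm q K : (forall n, cbmeas (q n)) -> cbmeas K -> ucvg q K ->
  (forall n, 1 <= knrm nu (q n)) -> 0 < knrm nu K.
Proof.
move=> cq cK qK q1.
(* With [1 / 4], the bound [1 <= 2 * (1 / 4 + knrm nu K)] leaves [knrm nu K >= 1 / 4]. *)
have [//|N HN] := qK (4^-1); have {}HN := HN N (leqnn N).
have : 1 <= 2 * (4^-1 + knrm nu K).
  apply: le_trans (q1 N) _.
  rewrite /knrm -(Rint_cst (prodP nu nu) 4^-1).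
  have b1 : bmeas (fun p => sqn (K p)) by cbmeas_tac.
  have bc : bmeas (fun _ : X * X => 4^-1 : R) by exact: bmeas_cst.
  rewrite -RintD // -RintZ; last exact: bmeasD.
  have cqN := cq N.
  apply: le_Rint; [by cbmeas_tac|by apply: bmeasM; [exact: bmeas_cst|exact: bmeasD]|].
  move=> p; rewrite -[q N p](subrK (K p)); apply: le_trans (le_sqnD _ _) _.
  by rewrite ler_pM2l // lerD2r.
by lra.
Qed.

(* If the square of [S] vanished, all [S g] with [g] an indicator would. *)
Lemma knrm_comp_self S : cbmeas S -> kadj S = S -> 0 < knrm nu S ->
  0 < knrm nu (kcomp nu S S).
Proof.
move=> cS aS S0; rewrite lt_neqAle knrm_ge0 andbT eq_sym; apply/negP => /eqP SS0.
have cSS := cbmeas_kcomp nu cS cS.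
have SS := knrm_eq0 cSS SS0.
have SB (B : set X) : measurable B ->
    {ae nu, forall x, Cint nu (fun z => S (x, z) * (\1_B z)%:C) = 0}.
  (* This kernel ignores its second variable, so [kcomp nu S L (x, y)] is the integral of [S (x, _)]
     over [B]; its squared norm is the inner product of [L] with [S S L], which vanishes. *)
  move=> mB; pose L (p : X * X) : R[i] := (\1_B p.1)%:C.
  have cL : cbmeas L by apply: cbmeas_real; bmeas_tac.
  have cSL := cbmeas_kcomp nu cS cL.
  have : {ae prodP nu nu, forall p, kcomp nu S L p = 0}.
    apply: (knrm_eq0 cSL); apply: complexI.
    rewrite knrmE (kip_comp nu cS cL cSL) aS -(kcompA nu cS cS cL).
    transitivity (kip nu L (fun _ => 0)).
      apply: ae_Cint; first by have := cbmeas_kcomp nu cSS cL => h; cbmeas_tac.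
        by cbmeas_tac.
      have := ae_fst nu (ae_prodl SS); apply: filterS => -[x y] /= h; congr (_ * conjc _).
      rewrite -[RHS](Cint_cst nu 0); apply: ae_Cint; try by cbmeas_tac.
      by apply: filterS h => z; rewrite /= => ->; rewrite mul0r.
    rewrite /kip -[RHS](Cint_cst (prodP nu nu) 0); apply: eq_Cint => p.
    by rewrite (_ : conjc 0 = 0) ?mulr0 // -[0]/(0%:C) conjc_real.
  move=> /ae_prodl; apply: filterS => x /ae_ex[y]; by [].
have part (f : X * X -> R) : bmeas f -> (forall B, measurable B ->
    {ae nu, forall x, \int[nu]_z (f (x, z) * \1_B z) = 0}) ->
    {ae prodP nu nu, forall p, f p = 0}.
  move=> bf fB; apply: ae0_rectangles => // A B mA mB.
  have b1 : bmeas (fun p => \1_A p.1 * \1_B p.2 * f p) by bmeas_tac.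
  rewrite -(Rint_prod1 nu nu b1) -[RHS](Rint_cst nu 0).
  apply: ae_Rint; [exact: (bmeas_Rint1 nu nu b1)|exact: bmeas_cst|].
  apply: filterS (fB _ mB) => x h /=.
  transitivity (\1_A x * \int[nu]_z (f (x, z) * \1_B z)); last by rewrite h mulr0.
  rewrite -RintZ; last by bmeas_tac.
  by apply: eq_Rintegral => z _ /=; ring.
have {}part1 := part _ (proj1 cS); have {}part2 := part _ (proj2 cS).
have r0 : {ae prodP nu nu, forall p, complex.Re (S p) = 0}.
  apply: part1 => B mB; apply: filterS (SB B mB) => x /(congr1 (@complex.Re R)) /= h.
  by rewrite -[RHS]h; apply: eq_Rintegral => z _; rewrite ReM /= mulr0 subr0.
have i0 : {ae prodP nu nu, forall p, complex.Im (S p) = 0}.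
  apply: part2 => B mB; apply: filterS (SB B mB) => x /(congr1 (@complex.Im R)) /= h.
  by rewrite -[RHS]h; apply: eq_Rintegral => z _; rewrite ImM /= mulr0 add0r.
suff : knrm nu S = 0 by move=> E; rewrite E ltxx in S0.
rewrite /knrm -[RHS](Rint_cst (prodP nu nu) 0); apply: ae_Rint.
- by cbmeas_tac.
- exact: bmeas_cst.
- by apply: filterS2 r0 i0 => p h1 h2; rewrite /sqn h1 h2 expr0n addr0.
Qed.

End uniform_convergence.

(* With [r k = b k.+1 / b k] nondecreasing, submultiplicativity gives
   [r m ^+ k.+1 <= b k] for all [m]; take [rho = lim r]. *)
Lemma log_convex_submultiplicative {R : realType} (b : nat -> R) :
  (forall k, 0 < b k) -> (forall k, b k.+1 ^+ 2 <= b k * b k.+2) ->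
  (forall i j, b (i + j).+1 <= b i * b j) ->
  exists rho, [/\ 0 < rho, forall k, 1 <= b k / rho ^+ k.+1 &
    cvgn (fun k => b k / rho ^+ k.+1)].
Proof.
move=> b0 bconv bsub; pose r k := b k.+1 / b k.
have rb k : b k.+1 = r k * b k by rewrite /r divfK // gt_eqF.
have r_gt0 k : 0 < r k by rewrite divr_gt0.
have rS k : r k <= r k.+1.
  by rewrite ler_pdivrMr // mulrAC ler_pdivlMr // -expr2 mulrC.
have rnd : nondecreasing_seq r by apply/nondecreasing_seqP.
have rub : has_ubound (range r).
  exists (b 0%N) => _ [k _ <-]; rewrite ler_pdivrMr // mulrC.
  by have := bsub k 0%N; rewrite addn0.
have rcv := nondecreasing_is_cvgn rnd rub.
pose rho := limn r.
have r_le k : r k <= rho by exact: nondecreasing_cvgn_le.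
have rho0 : 0 < rho by exact: lt_le_trans (r_gt0 0%N) (r_le _).
have rpow m j : r m ^+ j * b m <= b (m + j)%N.
  elim: j => [|j IH]; first by rewrite expr0 mul1r addn0.
  rewrite addnS rb exprS -mulrA; apply: ler_pM => //.
  - exact: ltW.
  - by rewrite mulr_ge0 ?exprn_ge0 // ltW.
  - by apply: rnd; rewrite leq_addr.
have rho_le k : rho ^+ k.+1 <= b k.
  have h : (fun m => r m ^+ k.+1) @ \oo --> rho ^+ k.+1.
    elim: k.+1 => [|j IH].
      rewrite expr0 (_ : (fun m => _) = fun=> 1); first exact: cvg_cst.
      by apply/funext => m; rewrite expr0.
    rewrite exprS (_ : (fun m => _) = fun m => r m * r m ^+ j); first exact: cvgM.
    by apply/funext => m; rewrite exprS.
  rewrite -(cvg_lim _ h) //; apply: limr_le; first exact: cvgP h.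
  (* [rpow] and submultiplicativity bound [r m ^+ k.+1 * b m] by [b k * b m]; the positive factor
     [b m] cancels. *)
  apply: nearW => m; rewrite -(ler_pM2r (b0 m)) mulrC.
  rewrite -[X in X <= _]mulrC; apply: le_trans (rpow m k.+1) _.
  by rewrite addnS mulrC; exact: bsub.
have rhoX k : 0 < rho ^+ k by exact: exprn_gt0.
exists rho; split=> //; first by move=> k; rewrite ler_pdivlMr // mul1r.
apply: nonincreasing_is_cvgn.
  apply/nonincreasing_seqP => k; rewrite rb [rho ^+ k.+2]exprS.
  rewrite invfM mulrACA ger_pMl ?divr_gt0 //.
  by rewrite ler_pdivrMr // mul1r.
by exists 0 => _ [k _ <-]; rewrite divr_ge0 // ltW.
Qed.

(** An involutive algebra of kernels, closed under uniform limits because this is the convergence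
    that power iteration provides. No unit is required: in general the identity operator has no
    bounded kernel. *)
Definition kernel_algebra {R : realType} {d} {X : measurableType d}
    (nu : probability X R) (A : (X * X -> R[i]) -> Prop) :=
  [/\ forall K, A K -> cbmeas K,
      forall K L, A K -> A L -> A (kcomp nu K L),
      forall (c : R[i]) K L, A K -> A L -> A (fun p => c * K p + L p),
      forall K, A K -> A (kadj K) &
      forall q K, (forall n, A (q n)) -> cbmeas K -> ucvg q K -> A K].

(** * Spectral projection by power iteration *)

Section power_iteration.
Context {R : realType} {d : measure_display} {X : measurableType d}.
Variable nu : probability X R.
Variable A : (X * X -> R[i]) -> Prop.
Hypothesis algA : kernel_algebra nu A.
Implicit Types (K L : X * X -> R[i]).

Lemma kernel_algebra_meas K : A K -> cbmeas K.
Proof. by case: algA => h _ _ _ _; exact: h. Qed.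

Lemma kernel_algebra_comp K L : A K -> A L -> A (kcomp nu K L).
Proof. by case: algA => _ h _ _ _; exact: h. Qed.

Lemma kernel_algebra_lin (c : R[i]) K L : A K -> A L -> A (fun p => c * K p + L p).
Proof. by case: algA => _ _ h _ _; exact: h. Qed.

Lemma kernel_algebra_adj K : A K -> A (kadj K).
Proof. by case: algA => _ _ _ h _; exact: h. Qed.

Lemma kernel_algebraB K L : A K -> A L -> A (fun p => K p - L p).
Proof.
move=> aK aL; have := kernel_algebra_lin (-1) aL aK; congr A.
by apply/funext => p; rewrite mulN1r addrC.
Qed.

Lemma kernel_algebraZ (c : R[i]) K : A K -> A (fun p => c * K p).
Proof.
move=> aK; have := kernel_algebra_lin c aK (kernel_algebraB aK aK); congr A.
by apply/funext => p; rewrite subrr addr0.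
Qed.

Lemma kernel_algebraD K L : A K -> A L -> A (fun p => K p + L p).
Proof.
move=> aK aL; have := kernel_algebra_lin 1 aK aL; congr A.
by apply/funext => p; rewrite mul1r.
Qed.

(** For such [P] the number [knrm nu P] is the rank, the squared Hilbert-Schmidt norm of an
    orthogonal projection; positivity excludes the zero projection. *)
Definition is_projection P :=
  [/\ A P, kadj P = P, kcomp nu P P = P & 0 < knrm nu P].

Section iteration.
Variable S : X * X -> R[i].
Hypothesis AS : A S.
Hypothesis aS : kadj S = S.
Hypothesis S0 : 0 < knrm nu S.

(** [kpow n] is the power [n.+1] of [S], since there is no identity kernel to start from; hence the
    shifted indices below, as in [kpowD]. *)
Fixpoint kpow n := if n is m.+1 then kcomp nu S (kpow m) else S.

Let cS : cbmeas S := kernel_algebra_meas AS.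

Lemma Akpow n : A (kpow n).
Proof. by elim: n => // n IH; exact: kernel_algebra_comp. Qed.

Let cpow n : cbmeas (kpow n) := kernel_algebra_meas (Akpow n).

Lemma kpowD i j : kcomp nu (kpow i) (kpow j) = kpow (i + j).+1.
Proof.
elim: i => [|i IH] //.
by rewrite [kpow i.+1]/= (kcompA nu cS (cpow i) (cpow j)) IH.
Qed.

Lemma kadj_kpow n : kadj (kpow n) = kpow n.
Proof.
elim: n => [|n IH] //.
rewrite [kpow n.+1]/= (kadj_comp nu cS (cpow n)) IH aS.
by rewrite -[X in kcomp nu _ X]/(kpow 0) kpowD addn0.
Qed.

Lemma kip_kpow i j : kip nu (kpow i) (kpow j) = kip nu S (kpow (i + j)).
Proof.
elim: i j => [|i IH] j //.
rewrite [kpow i.+1]/= (kip_comp nu cS (cpow i) (cpow j)) aS.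
by rewrite -[kcomp nu S (kpow j)]/(kpow j.+1) IH addSnnS.
Qed.

Let b k := knrm nu (kpow k).

Let b_kip k : (b k)%:C = kip nu S (kpow (k + k)).
Proof. by rewrite knrmE kip_kpow. Qed.

(** Self-adjointness moves one factor across the inner product, so the squared norm of [kpow k.+1]
    is the inner product of [kpow k] and [kpow k.+2]; then Cauchy-Schwarz. *)
Lemma knrm_kpow_convex k : b k.+1 ^+ 2 <= b k * b k.+2.
Proof.
rewrite -[X in X <= _]sqn_real b_kip addSnnS -(kip_kpow k k.+2).
exact: kcauchy_schwarz.
Qed.

Lemma knrm_kpow_sub i j : b (i + j).+1 <= b i * b j.
Proof. by rewrite /b -kpowD; exact: knrm_comp. Qed.

(** [knrm_comp_self] gives the square, and log-convexity propagates positivity to all higher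
    powers. *)
Lemma knrm_kpow_gt0 k : 0 < b k.
Proof.
suff : 0 < b k /\ 0 < b k.+1 by case.
elim: k => [|k [IH1 IH2]]; first by split=> //; exact: knrm_comp_self.
split; first exact: IH2.
rewrite -(pmulr_rgt0 _ IH1).
by apply: lt_le_trans (knrm_kpow_convex k); exact: exprn_gt0.
Qed.

(* [Q] is the limit of [S ^ 2n / rho ^ n], the spectral projection of [S ^ 2]
   for its largest eigenvalue [rho]; it converges uniformly because
   [S ^ 2 (S ^ 2n) S ^ 2] is bounded by the Hilbert-Schmidt norm of [S ^ 2n]. *)
Lemma top_projection : exists rho : R, exists Q, [/\ 0 < rho, is_projection Q,
  kcomp nu (kcomp nu S S) Q = (fun p => rho%:C * Q p) &
  forall P, cbmeas P -> kcomp nu P S = S -> kcomp nu P Q = Q].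
Proof.
have [rho [rho0 b1 bcv]] :=
  log_convex_submultiplicative knrm_kpow_gt0 knrm_kpow_convex knrm_kpow_sub.
pose be k := b k / rho ^+ k.+1.
(* As [b] consists of squared norms, [rho] is an eigenvalue of [S ^ 2]; hence the even power
   [S ^ (2 n + 2)] is normalised by [rho ^ (n + 1)]. *)
pose q n p := (rho ^- n.+1)%:C * kpow (n.*2.+1) p.
have Aq n : A (q n) by apply: kernel_algebraZ; exact: Akpow.
have cq n : cbmeas (q n) := kernel_algebra_meas (Aq n).
have qcomp i j : kcomp nu (q i) (q j) = q (i + j).+1.
  rewrite /q kcompZl //; [|by apply: cbmeasM => //; exact: cbmeas_cst].
  rewrite kcompZr // kpowD; apply/funext => p.
  rewrite mulrA -rmorphM -invfM -exprD addSn addnS.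
  by rewrite doubleS doubleD addSn addnS.
have qq n m : kip nu (q n) (q m) = (be (n + m).+1)%:C.
  transitivity ((rho ^- n.+1 * rho ^- m.+1)%:C * kip nu (kpow n.*2.+1) (kpow m.*2.+1)).
    have c1 := cpow n.*2.+1; have c2 := cpow m.*2.+1.
    rewrite /kip -CintZ; last by cbmeas_tac.
    by apply: eq_Cint => p; rewrite /q conjcM conjc_real rmorphM /=; ring.
  rewrite kip_kpow (_ : _ + _ = (n + m).+1 + (n + m).+1)%N; last first.
    by rewrite addnn !doubleS doubleD addSn addnS.
  rewrite -b_kip -rmorphM /be; congr _%:C.
  by rewrite -invfM -exprD addSn addnS mulrC.
have qn n : knrm nu (q n) = be (n + n).+1.
  by apply: complexI; rewrite knrmE qq.
have qd n m : knrm nu (fun p => q n p - q m p) =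
    be (n + n).+1 - 2 * be (n + m).+1 + be (m + m).+1.
  by rewrite knrmB // !qn qq.
have qcau (e : R) : 0 < e -> exists N, forall n m, (N <= n)%N -> (N <= m)%N ->
    knrm nu (fun p => q n p - q m p) <= e.
  (* The four occurrences of [be] in [qd], one term counting twice, each lie within [e / 4] of the
     limit, and the limits cancel. *)
  move=> e0; have /cvgrPdist_lt/(_ (e / 4))[|N _ HN] := bcv; first by rewrite divr_gt0.
  exists N => n m Nn Nm; rewrite qd.
  have H k l : (N <= k)%N -> (N <= l)%N -> `|limn be - be (k + l).+1| < e / 4.
    by move=> Nk _; apply: HN => /=; rewrite (leq_trans Nk) // leqW // leq_addr.
  have := H _ _ Nn Nn; have := H _ _ Nn Nm; have := H _ _ Nm Nm.
  by rewrite !ltr_norml => /andP[? ?] /andP[? ?] /andP[? ?]; lra.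
(* Shifting by two makes [t n] the sandwich of [q n] between two copies of [q 0], where norm
   convergence becomes uniform. *)
pose t n := q n.+2.
have tE n : t n = kcomp nu (q 0%N) (kcomp nu (q n) (q 0%N)).
  by rewrite !qcomp addn0.
have ct n : cbmeas (t n) by exact: cq.
have [B0 HB0] := cbmeas_sqn_bound (cq 0%N).
have [Q [cQ tQ]] : exists Q, cbmeas Q /\ ucvg t Q.
  apply: ucauchy_ucvg => // e e0; pose B := `|B0| + 1.
  have Bq p : sqn (q 0%N p) <= B.
    by apply: le_trans (HB0 p) _; rewrite (le_trans (ler_norm _)) // lerDl.
  have Bpos : 0 < B by rewrite ltr_wpDl.
  have [|N HN] := qcau (e / (B * B)); first by rewrite divr_gt0 // mulr_gt0.
  exists N => n m Nn Nm p.
  have cd : cbmeas (fun p => q n p - q m p) by apply: cbmeasB.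
  have -> : t n p - t m p =
      kcomp nu (q 0%N) (kcomp nu (fun p => q n p - q m p) (q 0%N)) p.
    rewrite (kcompBl nu (cq n) (cq m) (cq 0%N)) !tE.
    by rewrite (kcompBr nu (cbmeas_kcomp nu (cq n) (cq 0%N))
      (cbmeas_kcomp nu (cq m) (cq 0%N)) (cq 0%N)).
  apply: le_trans (kcomp3_sqn_le nu p (cq 0%N) cd (cq 0%N) Bq Bq) _.
  by rewrite mulrC -ler_pdivlMr ?mulr_gt0 //; exact: HN.
have AQ : A Q.
  have [_ _ _ _ h] := algA; by apply: (h t) => // n; exact: Aq.
have aQ : kadj Q = Q.
  apply: (ucvg_unique (ucvg_adj tQ)).
  rewrite (_ : (fun n => kadj (t n)) = t) //; apply/funext => n; apply/funext => p.
  by rewrite /t /q -[in RHS](kadj_kpow n.+2.*2.+1) /kadj conjcM conjc_real.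
(* The composite of [t n] and [t m] is again a term of the sequence, of index beyond [m]; letting
   [m] and later [n] tend to infinity gives idempotence of [Q]. *)
have tQn n : kcomp nu (t n) Q = Q.
  apply: (ucvg_unique (ucvg_compr nu ct cQ (ct n) tQ)).
  rewrite (_ : (fun m => _) = fun m => t (n + m).+3); last first.
    by apply/funext => m; rewrite qcomp !addSn !addnS.
  by apply: ucvg_sub (tQ) => m; do 3!apply: leqW; exact: leq_addl.
exists rho, Q; split=> //.
- split=> //; last first.
    by apply: (ucvg_knrm ct cQ tQ) => n; rewrite qn; exact: b1.
  apply: (ucvg_unique (ucvg_compl nu ct cQ cQ tQ)).
  rewrite (_ : (fun n => _) = fun n => Q); last by apply/funext => n; exact: tQn.
  by move=> e e0; exists 0%N => n _ p; rewrite subrr sqn0 ltW.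
- apply: (ucvg_unique (ucvg_compr nu ct cQ (cpow 1) tQ)).
  rewrite (_ : (fun n => _) = fun n p => rho%:C * t n.+1 p).
    by apply: ucvgZ; apply: ucvg_sub (tQ) => m.
  apply/funext => n; rewrite /t /q kcompZr // kpowD add1n; apply/funext => p.
  have -> : rho ^- n.+3 = rho * rho ^- n.+4.
    have rhoN0 : rho != 0 by rewrite gt_eqF.
    have E (x : R) : rho * (rho * x)^-1 = x^-1 by rewrite invfM mulVKf.
    by rewrite [rho ^+ n.+4]exprS E.
  by rewrite rmorphM mulrA.
- move=> P cP PS.
  have Pk n : kcomp nu P (kpow n) = kpow n.
    by case: n => [|n] //=; rewrite -(kcompA nu cP cS (cpow n)) PS.
  apply: (ucvg_unique (ucvg_compr nu ct cQ cP tQ)).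
  rewrite (_ : (fun n => _) = t) //; apply/funext => n.
  by rewrite /t /q (kcompZr nu _ (cpow _) cP) Pk.
Qed.

End iteration.

End power_iteration.

(** * Minimal projections and their scalar corners *)

Section minimal_projection.
Context {R : realType} {d : measure_display} {X : measurableType d}.
Variable nu : probability X R.
Variable A : (X * X -> R[i]) -> Prop.
Hypothesis algA : kernel_algebra nu A.
Implicit Types (K L P Q S T : X * X -> R[i]).

Let Acb K : A K -> cbmeas K := kernel_algebra_meas algA (K := K).

Lemma knrm_projection_ge1 P : is_projection nu A P -> 1 <= knrm nu P.
Proof.
move=> [/Acb cP aP PP P0]; have := knrm_comp nu cP cP.
by rewrite PP -[X in X <= _]mulr1 ler_pM2l.
Qed.

Let kadjD K L : kadj (fun p => K p + L p) = fun p => kadj K p + kadj L p.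
Proof. by apply/funext => p; rewrite /kadj conjcD. Qed.

Let kadjZ (c : R[i]) K : kadj (fun p => c * K p) = fun p => conjc c * kadj K p.
Proof. by apply/funext => p; rewrite /kadj conjcM. Qed.

Let I_ : R[i] := 0 +i* 1.

Let conjI : conjc I_ = - I_. Proof. by rewrite /I_; apply: complex_eq; rewrite ?ReJ ?ImJ /= ?oppr0. Qed.

Let II : I_ * I_ = -1.
Proof. by apply: complex_eq; rewrite ?ReM ?ImM /=; ring. Qed.

(** [S1 = K + kadj K] and [S2 = I_ * (K - kadj K)], without the halves. The last clause stays in the
    corner cut out by [P]: if [P] fixes [K] on both sides, it fixes [kadj K] too. *)
Lemma hermitian_part K : A K ->
  exists S1 S2, [/\ A S1, kadj S1 = S1, A S2, kadj S2 = S2 &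
    forall p, 2 * K p = S1 p - I_ * S2 p] /\
    (forall P, cbmeas P -> kadj P = P -> kcomp nu P K = K -> kcomp nu K P = K ->
      kcomp nu P S1 = S1 /\ kcomp nu P S2 = S2).
Proof.
move=> aK; have aJ := kernel_algebra_adj algA aK.
have aN := kernel_algebraZ algA (-1) aJ.
have aKN := kernel_algebraD algA aK aN.
exists (fun p => K p + kadj K p), (fun p => I_ * (K p + -1 * kadj K p)); split.
  split.
  - exact: (kernel_algebraD algA aK aJ).
  - by rewrite kadjD kadjK; apply/funext => p; rewrite addrC.
  - exact: (kernel_algebraZ algA I_ aKN).
  - rewrite kadjZ kadjD kadjZ kadjK conjI; apply/funext => p.
    by rewrite (_ : conjc (-1) = -1); [ring|rewrite -[-1]/((-1) +i* (-0)) oppr0;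
      apply: complex_eq; rewrite ?ReJ ?ImJ /= ?oppr0].
  - by move=> p; rewrite [I_ * (I_ * _)]mulrA II; ring.
move=> P cP aP PK KP; have cK := Acb aK; have cJ := Acb aJ.
have PJ : kcomp nu P (kadj K) = kadj K.
  by rewrite -[in RHS]KP (kadj_comp nu cK cP) aP.
split; first by rewrite (kcompDr nu cK cJ cP) PK PJ.
by rewrite (kcompZr nu _ (Acb aKN) cP) (kcompDr nu cK (Acb aN) cP) (kcompZr nu _ cJ cP) PK PJ.
Qed.

Lemma exists_projection K : A K -> 0 < knrm nu K -> exists P, is_projection nu A P.
Proof.
move=> aK K0; have [S1 [S2 [[a1 h1 a2 h2 E] _]]] := hermitian_part aK.
have H S : A S -> kadj S = S -> 0 < knrm nu S -> exists P, is_projection nu A P.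
  move=> aS hS S0; have [rho [Q [_ pQ _ _]]] := top_projection algA aS hS S0.
  by exists Q.
have := knrm_ge0 nu S1; rewrite le_eqVlt => /orP[/eqP z1|]; last exact: H.
have := knrm_ge0 nu S2; rewrite le_eqVlt => /orP[/eqP z2|]; last exact: H.
have e1 := knrm_eq0 (Acb a1) (esym z1); have e2 := knrm_eq0 (Acb a2) (esym z2).
suff : knrm nu K = 0 by move=> z; rewrite z ltxx in K0.
rewrite (knrm_ae (Acb aK) (cbmeas_cst 0)) ?/knrm.
  by rewrite -[RHS](Rint_cst (prodP nu nu) 0); apply: eq_Rintegral => p _; exact: sqn0.
apply: filterS2 e1 e2 => p s1 s2; have := E p; rewrite s1 s2 mulr0 subr0 => /eqP.
by rewrite mulf_eq0 pnatr_eq0 /= => /eqP.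
Qed.

(* A projection whose squared norm is within 1 of the infimum is minimal,
   since every nonzero projection has squared norm at least 1. *)
Lemma minimal_projection K : A K -> 0 < knrm nu K ->
  exists P, is_projection nu A P /\
    forall T, A T -> exists k : R[i],
      {ae prodP nu nu, forall p, kcomp nu P (kcomp nu T P) p = k * P p}.
Proof.
move=> aK K0; have [P0 prP0] := exists_projection aK K0.
pose V := [set v | exists2 P, is_projection nu A P & v = knrm nu P].
have infV : has_inf V.
  split; first by exists (knrm nu P0), P0.
  by exists 1 => _ [P prP ->]; exact: knrm_projection_ge1.
have [_ [P prP ->] Pinf] := inf_adherent ltr01 infV.
have [aP hP PP nP] := prP; have cP := Acb aP.
exists P; split=> //.
(* A subprojection [Q] that differs from [P] would leave the projection [P - Q], of squared norm at
   most [knrm nu P - 1], below the infimum. *)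
have min Q : is_projection nu A Q -> kcomp nu P Q = Q ->
    {ae prodP nu nu, forall p, P p = Q p}.
  move=> prQ PQ; have [aQ hQ QQ nQ] := prQ; have cQ := Acb aQ.
  have QP : kcomp nu Q P = Q by rewrite -{1}hQ -{1}hP -(kadj_comp nu cP cQ) PQ hQ.
  have aD := kernel_algebraB algA aP aQ; have cD := Acb aD.
  have ipPQ : kip nu P Q = (knrm nu Q)%:C.
    rewrite (kipC nu cQ cP) -[X in kip nu X P]QQ (kip_comp nu cQ cQ cP) hQ QP.
    by rewrite -knrmE conjc_real.
  have nD : knrm nu (fun p => P p - Q p) = knrm nu P - knrm nu Q.
    by rewrite (knrmB nu cP cQ) ipPQ /=; ring.
  have := knrm_ge0 nu (fun p => P p - Q p); rewrite le_eqVlt => /orP[/eqP z|D0].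
    by apply: filterS (knrm_eq0 cD (esym z)) => p /subr0_eq.
  have prD : is_projection nu A (fun p => P p - Q p).
    split=> //.
      by apply/funext => p; rewrite -[in RHS]hP -[in RHS]hQ /kadj conjcB.
    rewrite (kcompBl nu cP cQ cD) (kcompBr nu cP cQ cP) (kcompBr nu cP cQ cQ).
    by rewrite PP PQ QP QQ; apply/funext => p; ring.
  have : inf V <= knrm nu (fun p => P p - Q p).
    by apply: ge_inf; [case: infV|exists (fun p => P p - Q p)].
  have := knrm_projection_ge1 prQ; rewrite nD; move: Pinf.
  by move=> *; exfalso; lra.
(* The top spectral projection of [S ^ 2] lies under [P], hence equals [P] by [min]; so [S ^ 2] is
   scalar on the range of [P]. *)
have sq S : A S -> kadj S = S -> kcomp nu P S = S -> exists rho : R,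
    {ae prodP nu nu, forall p, kcomp nu S S p = rho%:C * P p}.
  move=> aS hS PS; have cS := Acb aS; have cSS := cbmeas_kcomp nu cS cS.
  have := knrm_ge0 nu S; rewrite le_eqVlt => /orP[/eqP z|S0].
    have SS0 : knrm nu (kcomp nu S S) = 0.
      apply/eqP; rewrite eq_le knrm_ge0 andbT.
      by have := knrm_comp nu cS cS; rewrite -z mul0r.
    by exists 0; apply: filterS (knrm_eq0 cSS SS0) => p ->; rewrite mul0r.
  have [rho [Q [rho0 prQ SSQ PQ]]] := top_projection algA aS hS S0.
  have PeQ := min _ prQ (PQ _ cP PS); have cQ : cbmeas Q by case: prQ => /Acb.
  exists rho; have := kcomp_ae cSS cP cQ PeQ.
  have -> : kcomp nu (kcomp nu S S) P = kcomp nu S S.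
    have hSS : kadj (kcomp nu S S) = kcomp nu S S by rewrite (kadj_comp nu cS cS) hS.
    have PSS : kcomp nu P (kcomp nu S S) = kcomp nu S S by rewrite -(kcompA nu cP cS cS) PS.
    by rewrite -{1}hSS -{1}hP -(kadj_comp nu cP cSS) PSS hSS.
  by rewrite SSQ; apply: filterS2 PeQ => p -> ->.
(* Polarization: [(S + P) ^ 2 = S ^ 2 + 2 S + P] and both squares are multiples of [P], so
   [2 S = (r2 - r1 - 1) P]. *)
have lin S : A S -> kadj S = S -> kcomp nu P S = S -> exists c : R,
    {ae prodP nu nu, forall p, S p = c%:C * P p}.
  move=> aS hS PS; have cS := Acb aS.
  have SP : kcomp nu S P = S by rewrite -{1}hS -{1}hP -(kadj_comp nu cP cS) PS hS.
  have aSP := kernel_algebraD algA aS aP; have cSP := Acb aSP.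
  have [r1 E1] := sq _ aS hS PS.
  have [||r2 E2] := sq _ aSP.
  - by rewrite kadjD hS hP.
  - by rewrite (kcompDr nu cS cP cP) PS PP.
  exists ((r2 - r1 - 1) / 2); apply: filterS2 E1 E2 => p E1 E2.
  move: E2; rewrite (kcompDl nu cS cP cSP) (kcompDr nu cS cP cS) (kcompDr nu cS cP cP).
  rewrite E1 SP PS PP => E2.
  have {}E2 : 2 * S p = (r2%:C - r1%:C - 1) * P p by rewrite !mulrBl -E2; ring.
  rewrite rmorphM rmorphB rmorphB rmorph1 /= fmorphV rmorph_nat.
  by rewrite mulrAC -E2 mulrC mulKf // pnatr_eq0.
move=> T aT; have cT := Acb aT.
pose T' := kcomp nu P (kcomp nu T P).
have aT' : A T' by apply: (kernel_algebra_comp algA) => //; exact: (kernel_algebra_comp algA).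
have cTP := cbmeas_kcomp nu cT cP.
have PT' : kcomp nu P T' = T' by rewrite /T' -(kcompA nu cP cP cTP) PP.
have T'P : kcomp nu T' P = T'.
  by have := kcompA nu cP cTP cP; rewrite (kcompA nu cT cP cP) PP.
have [S1 [S2 [[a1 h1 a2 h2 E] HS]]] := hermitian_part aT'.
have [PS1 PS2] := HS P cP hP PT' T'P.
have [c1 C1] := lin _ a1 h1 PS1; have [c2 C2] := lin _ a2 h2 PS2.
exists ((c1%:C - I_ * c2%:C) / 2); apply: filterS2 C1 C2 => p C1 C2.
have {}E : 2 * T' p = (c1%:C - I_ * c2%:C) * P p by rewrite E C1 C2; ring.
by rewrite mulrAC -E mulrC mulKf // pnatr_eq0.
Qed.

End minimal_projection.

(** * Phases of complex functions *)

Definition ce {R : realType} (x : R) : R[i] := ec x +i* es x.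

Section ce.
Context {R : realType}.
Implicit Types x y : R.

Lemma ceD x y : ce (x + y) = ce x * ce y.
Proof. by apply: complex_eq; rewrite ?ReM ?ImM /= ?ecD ?esD //; ring. Qed.

Lemma sqn_ce x : sqn (ce x) = 1.
Proof. exact: ec2Des2. Qed.

Lemma ceJ x : ce x * conjc (ce x) = 1.
Proof. by rewrite -sqnE sqn_ce. Qed.

Lemma inZ_ce x y : inZ (x - y) <-> ce x = ce y.
Proof.
rewrite inZ_eq; split; first by case=> h1 h2; apply: complex_eq.
by move=> h; split; [have := congr1 (@complex.Re R) h|have := congr1 (@complex.Im R) h].
Qed.

(* [1 / |z|] *)
Definition modV (z : R[i]) : R := sqn z `^ (- 2^-1).

Lemma modV_sqr z : z != 0 -> modV z ^+ 2 * sqn z = 1.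
Proof.
move=> z0; have s0 := sqn_gt0 z0.
have s0' : sqn z != 0 by rewrite gt_eqF.
rewrite /modV expr2 -powRD; last by rewrite s0' implybT.
rewrite (_ : - 2^-1 + - 2^-1 = -1 :> R); last by field.
by rewrite powRN powRr1 ?(ltW s0) // mulVf.
Qed.

Lemma angle_exists (z : R[i]) : exists x, if z == 0 then x = 0 else ce x = (modV z)%:C * z.
Proof.
have [z0|z0] := eqVneq z 0; first by exists 0.
have [|x [h1 h2]] := @circle_lift R (modV z * complex.Re z) (modV z * complex.Im z).
  by rewrite !exprMn -mulrDr modV_sqr.
exists x; apply: complex_eq; rewrite ?ReM ?ImM /= ?h1 ?h2; ring.
Qed.

(* The argument of [z] in R/Z, with [ang 0 = 0]. *)
Definition ang (z : R[i]) : R := sval (cid (angle_exists z)).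

Lemma angE z : z != 0 -> ce (ang z) = (modV z)%:C * z.
Proof. by rewrite /ang; case: cid => x /= + z0; rewrite (negPf z0). Qed.

Lemma ang0 : ang 0 = 0.
Proof. by rewrite /ang; case: cid => x /=; rewrite eqxx. Qed.

Lemma modVM z w : modV (z * w) = modV z * modV w.
Proof. by rewrite /modV sqnM powRM ?sqn_ge0. Qed.

Lemma angM z w : z != 0 -> w != 0 -> ce (ang (z * w)) = ce (ang z) * ce (ang w).
Proof.
move=> z0 w0; rewrite !angE ?mulf_neq0 // modVM rmorphM /=; ring.
Qed.

Lemma ang_ce x : ce (ang (ce x)) = ce x.
Proof.
rewrite angE; first by rewrite /modV sqn_ce powR1 mul1r.
by apply/eqP => h; have := sqn_ce x; rewrite h sqn0 => /eqP; rewrite eq_sym oner_eq0.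
Qed.

End ce.

Lemma cbmeas_ce {R : realType} {d} {T : measurableType d} (f : T -> R) :
  Tmeasurable f -> cbmeas (fun x => ce (f x)).
Proof. by move=> mf; split; [exact: Tmeasurable_ec|exact: Tmeasurable_es]. Qed.

Lemma Tmeasurable_ang {R : realType} {d} {T : measurableType d} (f : T -> R[i]) :
  cbmeas f -> Tmeasurable (fun x => ang (f x)).
Proof.
move=> cf; have [[m1 _] [m2 _]] := cf; have [ms _] := bmeas_sqn cf.
have mV : measurable_fun setT (fun x => modV (f x)).
  exact: (measurableT_comp (measurable_powR (- 2^-1)) ms).
have mZ := measurable_eq_complex cf (cbmeas_cst 0).
have mI : measurable_fun setT (\1_[set x | f x = 0] : T -> R) by exact: measurable_indic.
split.
  (* Since [ang 0 = 0] has cosine 1, the indicator of the zero set has to be added; the sine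
     requires no such correction. *)
  rewrite (_ : (fun x => _) = fun x => modV (f x) * complex.Re (f x) + \1_[set x | f x = 0] x).
    by apply: measurable_funD => //; exact: measurable_funM.
  apply/funext => x; rewrite -/(ec _) indicE.
  have [fx|fx] := eqVneq (f x) 0.
    by rewrite fx ang0 mulr0 add0r mem_set // /ec mulr0 cos0.
  rewrite memNset ?addr0; last exact/eqP.
  by have /(congr1 (@complex.Re R)) := angE fx; rewrite ReM /= mul0r subr0.
rewrite (_ : (fun x => _) = fun x => modV (f x) * complex.Im (f x)).
  exact: measurable_funM.
apply/funext => x; rewrite -/(es _).
have [fx|fx] := eqVneq (f x) 0.
  by rewrite fx ang0 mulr0 /es mulr0 sin0.
by have /(congr1 (@complex.Im R)) := angE fx; rewrite ImM /= mul0r addr0.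
Qed.

(** * Commuting twisted translations *)

Definition measured_group {R : realType} {d} {X : measurableType d}
    (nu : probability X R) (add : X -> X -> X) (zero : X) (opp : X -> X) :=
  [/\ abelian_group_axioms add zero opp,
      measurable_fun setT (fun p : X * X => add p.1 p.2),
      measurable_fun setT opp &
      forall a, measure_preserving nu nu (add a)].

Section measured_group.
Context {R : realType} {d : measure_display} {X : measurableType d}.
Variables (nu : probability X R) (add : X -> X -> X) (zero : X) (opp : X -> X).
Hypothesis grp : measured_group nu add zero opp.

Lemma mg_addA x y z : add x (add y z) = add (add x y) z.
Proof. by case: grp => -[]. Qed.

Lemma mg_addC x y : add x y = add y x.
Proof. by case: grp => -[]. Qed.

Lemma mg_addNK x y : add (opp x) (add x y) = y.
Proof. by case: grp => -[A C Z N] _ _ _; rewrite A N Z. Qed.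

Lemma mg_addKN x y : add x (add (opp x) y) = y.
Proof. by rewrite mg_addA (mg_addC x) -mg_addA mg_addNK. Qed.

Lemma mg_diff t x y : add (opp (add t x)) (add t y) = add (opp x) y.
Proof. by rewrite -{1}(mg_addKN x y) (mg_addA t x) mg_addNK. Qed.

Lemma measurable_add2 {d'} {T : measurableType d'} (f g : T -> X) :
  measurable_fun setT f -> measurable_fun setT g ->
  measurable_fun setT (fun t => add (f t) (g t)).
Proof.
move=> mf mg; case: grp => _ ma _ _.
exact: (measurableT_comp ma (measurable_fun_pair mf mg)).
Qed.

Lemma preserving_translation a : measure_preserving nu nu (add a).
Proof. by case: grp. Qed.

Lemma preserving_skew (h : X -> X) : measurable_fun setT h ->
  measure_preserving (prodP nu nu) (prodP nu nu) (fun p => (p.1, add (h p.1) p.2)).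
Proof.
move=> mh; split.
  apply: measurable_fun_pair; first by meas.
  by apply: measurable_add2; meas.
move=> A mA.
transitivity (\int[nu]_x nu (xsection ((fun p => (p.1, add (h p.1) p.2)) @^-1` A) x))%E.
  by [].
transitivity (\int[nu]_x nu (xsection A x))%E; last by [].
apply: eq_integral => x _; rewrite !xsectionE.
have [_ pr] := preserving_translation (h x); rewrite -[RHS]pr //.
by rewrite -xsectionE; exact: measurable_xsection.
Qed.

(** Turns statements about a translation and a point into statements about kernels: at [(x, y)] the
    translation is [y - x] and the point is [x]. *)
Lemma preserving_diff :
  measure_preserving (prodP nu nu) (prodP nu nu) (fun p => (add (opp p.1) p.2, p.1)).
Proof.
case: grp => _ _ mo _.
exact: (preserving_comp (preserving_skew mo) (preserving_swap nu nu)).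
Qed.

Lemma ae_translate a (Q : X -> Prop) : {ae nu, forall x, Q (add a x)} ->
  {ae nu, forall x, Q x}.
Proof.
move=> /(ae_preserving (preserving_translation (opp a))).
by apply: filterS => x; rewrite mg_addKN.
Qed.

End measured_group.

Section commuting_cocycle.
Context {R : realType} {d : measure_display} {X : measurableType d}.
Variables (nu : probability X R) (add : X -> X -> X) (zero : X) (opp : X -> X).
Hypothesis grp : measured_group nu add zero opp.
Variable w : X * X -> R.
Hypothesis mw : Tmeasurable w.
Hypothesis comm : {ae nu, forall t, {ae prodP nu nu, forall p : X * X,
  inZ (w (p.1, p.2) + w (t, add p.1 p.2) - w (t, p.2) - w (p.1, add t p.2))}}.

Let om (p : X * X) : R[i] := ce (w p).
Let com : cbmeas om := cbmeas_ce mw.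
Let omJ p : om p * conjc (om p) = 1 := ceJ (w p).
Let sqn_om p : sqn (om p) = 1 := sqn_ce (w p).

Let om_comm : {ae nu, forall t, {ae prodP nu nu, forall p : X * X,
  om (p.1, p.2) * om (t, add p.1 p.2) = om (t, p.2) * om (p.1, add t p.2)}}.
Proof.
apply: filterS comm => t; apply: filterS => p h.
by rewrite -!ceD; apply/inZ_ce; move: h; congr inZ; ring.
Qed.

(* Kernels of operators commuting with [U_t f (x) = om (t, x) f (t + x)]. *)
Definition twisted (K : X * X -> R[i]) := cbmeas K /\
  {ae nu, forall t, {ae prodP nu nu, forall p : X * X,
    om (t, p.1) * conjc (om (t, p.2)) * K (add t p.1, add t p.2) = K p}}.

Let madd := preserving_translation grp.

Let add_meas t : measurable_fun setT (add t) := proj1 (madd t).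

(** For products, the substitution [z |-> t + z] in the inner integral brings out
    [om (t, z) * conjc (om (t, z)) = 1]. *)
Lemma kernel_algebra_twisted : kernel_algebra nu twisted.
Proof.
split.
- by move=> K [].
- move=> K L [cK hK] [cL hL]; split; first exact: cbmeas_kcomp.
  apply: filterS2 hK hL => t hK hL.
  have hL' := ae_prodl (ae_preserving (preserving_swap nu nu) hL).
  apply: filterS2 (ae_fst nu (ae_prodl hK)) (ae_snd nu hL') => -[x y] /= h1 h2.
  have ma := add_meas t.
  have c1 : cbmeas (fun z => K (add t x, z) * L (z, add t y)) by cbmeas_tac.
  rewrite /kcomp /= -(Cint_preserving (madd t) c1) -CintZ; last by cbmeas_tac.
  apply: ae_Cint; [by cbmeas_tac|by cbmeas_tac|].
  apply: filterS2 h1 h2 => z <- <-.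
  transitivity (om (t, x) * conjc (om (t, y)) * (om (t, z) * conjc (om (t, z))) *
    (K (add t x, add t z) * L (add t z, add t y))); last by ring.
  by rewrite omJ mulr1.
- move=> c K L [cK hK] [cL hL]; split; first by cbmeas_tac.
  apply: filterS2 hK hL => t hK hL; apply: filterS2 hK hL => p <- <-; ring.
- move=> K [cK hK]; split; first exact: cbmeas_kadj.
  apply: filterS hK => t hK.
  apply: filterS (ae_preserving (preserving_swap nu nu) hK) => p; rewrite /kadj => <- /=.
  by rewrite !conjcM conjcK; ring.
- move=> q K aq cK qK; split=> //.
  have : {ae nu, forall t, forall n, {ae prodP nu nu, forall p : X * X,
    om (t, p.1) * conjc (om (t, p.2)) * q n (add t p.1, add t p.2) = q n p}}.
    by apply: ae_foralln => n; case: (aq n).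
  apply: filterS => t /ae_foralln; apply: filterS => p hn.
  set c := om (t, p.1) * _; set p' := (add t p.1, add t p.2).
  (* Convergence at a single point is packaged as uniform convergence of constant kernels, so that
     [ucvg_unique] applies. *)
  have u1 : ucvg (fun n (_ : X * X) => q n p) (fun _ => K p).
    by move=> e e0; have [N HN] := qK e e0; exists N => n Nn _; exact: HN.
  have u2 : ucvg (fun n (_ : X * X) => c * q n p') (fun _ => c * K p').
    apply: ucvgZ => e e0; have [N HN] := qK e e0; exists N => n Nn _; exact: HN.
  have := ucvg_unique u2; move=> /(_ (fun _ => K p)).
  rewrite (_ : (fun n (_ : X * X) => c * q n p') = fun n _ => q n p).
    by move=> /(_ u1) /(congr1 (fun f => f p)).
  by apply/funext => n; apply/funext => _; exact: hn.
Qed.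

(* The kernel of [\int U_s ds]. *)
Definition base_kernel (p : X * X) : R[i] := om (add (opp p.1) p.2, p.1).

Lemma twisted_base : twisted base_kernel /\ 0 < knrm nu base_kernel.
Proof.
have [_ _ mo _] := grp.
have [md _] := preserving_diff grp.
have cb : cbmeas base_kernel by exact: (cbmeas_comp md com).
split; last first.
  rewrite /knrm (_ : \int[prodP nu nu]_p _ = \int[prodP nu nu]_p 1).
    by rewrite Rint_cst.
  by apply: eq_Rintegral => p _; exact: sqn_ce.
split=> //; apply: filterS om_comm => t /(ae_preserving (preserving_diff grp)).
apply: filterS => -[x y] /=; rewrite /base_kernel /= (mg_diff grp).
rewrite [add (add (opp x) y) x](mg_addC grp) (mg_addKN grp) => h.
rewrite mulrAC -h mulrAC -[RHS]mulr1 -(omJ (t, y)); ring.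
Qed.

(** The kernel is that of [U_t P], which commutes with almost every [U_s] because [U_t] and [P]
    do. *)
Lemma twisted_translate P t : twisted P ->
  {ae prodP nu nu, forall p : X * X,
    om (p.1, p.2) * om (t, add p.1 p.2) = om (t, p.2) * om (p.1, add t p.2)} ->
  twisted (fun p => om (t, p.1) * P (add t p.1, p.2)).
Proof.
move=> [cP hP] ct; have ma := add_meas t.
split; first by cbmeas_tac.
apply: filterS2 hP (ae_prodl ct) => s hs cs.
have pt := preserving_prod (madd t) (preserving_id nu).
apply: filterS2 (ae_preserving pt hs) (ae_fst nu cs) => -[x y] /= <- h.
rewrite (mg_addA grp t s) (mg_addC grp t s) -(mg_addA grp s t).
transitivity (om (s, x) * om (t, add s x) * (conjc (om (s, y)) *
  P (add s (add t x), add s y))); first by ring.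
by rewrite h; ring.
Qed.

(* For a minimal projection [P], [U_t P = P (U_t P) P] is a scalar multiple of
   [P]; a column [P (_, y)] is the eigenfunction. *)
Lemma commuting_eigenfunction : exists kap f : X -> R[i],
  [/\ cbmeas kap, cbmeas f, ~ {ae nu, forall x, f x = 0} &
    {ae nu, forall t, {ae nu, forall x, om (t, x) * f (add t x) = kap t * f x}}].
Proof.
have algA := kernel_algebra_twisted; have [tK nK] := twisted_base.
have [P [[tP hP PP P0] Pmin]] := minimal_projection algA tK nK.
have [cP iP] := tP; have [_ madd2 _ _] := grp.
pose T t (p : X * X) := om (t, p.1) * P (add t p.1, p.2).
have cT : cbmeas (fun q : X * (X * X) => T q.1 q.2).
  have m1 : measurable_fun setT (fun q : X * (X * X) => add q.1 q.2.1).
    by apply: (measurable_add2 grp); meas.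
  by rewrite /T; cbmeas_tac.
have cTt t : cbmeas (T t) by have ma := add_meas t; rewrite /T; cbmeas_tac.
have TP t : kcomp nu (T t) P = T t.
  apply/funext => -[x y]; rewrite /kcomp /T /= -[in RHS]PP /kcomp /= -CintZ; last by cbmeas_tac.
  by apply: eq_Cint => z; rewrite mulrA.
(* [P] commutes with [U_t], so [P U_t P = U_t P P = U_t P]. *)
have PT : {ae nu, forall t, {ae prodP nu nu, forall p, kcomp nu P (T t) p = T t p}}.
  apply: filterS iP => t it; have ma := add_meas t.
  apply: filterS (ae_fst nu (ae_prodl it)) => -[x y] /= h.
  have c1 : cbmeas (fun z => P (add t x, z) * P (z, y)) by cbmeas_tac.
  have -> : T t (x, y) = Cint nu (fun z => om (t, x) * (P (add t x, add t z) * P (add t z, y))).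
    rewrite CintZ; last by cbmeas_tac.
    by rewrite (Cint_preserving (madd t) c1) /T /= -[in LHS]PP.
  rewrite /kcomp /T /=; apply: ae_Cint; [by cbmeas_tac|by cbmeas_tac|].
  apply: filterS h => z <-.
  transitivity (om (t, z) * conjc (om (t, z)) *
    (om (t, x) * (P (add t x, add t z) * P (add t z, y)))); first by ring.
  by rewrite omJ mul1r.
(* The eigenvalue is recovered as an inner product with [P]; this makes it measurable in [t], which
   a pointwise choice would not. *)
pose kap t := Cint (prodP nu nu) (fun p => T t p * conjc (P p)) * (knrm nu P)^-1%:C.
have ckap : cbmeas kap.
  apply: cbmeasM; last exact: cbmeas_cst.
  apply: (cbmeas_Cint1 nu (prodP nu nu) (f := fun q => T q.1 q.2 * conjc (P q.2))).
  by cbmeas_tac.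
have Tkap : {ae nu, forall t, {ae prodP nu nu, forall p, T t p = kap t * P p}}.
  apply: filterS2 om_comm PT => t ct PTt.
  have tT := twisted_translate tP ct.
  have [k Hk] := Pmin _ tT.
  have {}Hk : {ae prodP nu nu, forall p, T t p = k * P p}.
    by apply: filterS2 Hk PTt => p; rewrite -/(T t) TP => -> ->.
  suff -> : kap t = k by [].
  rewrite /kap (_ : Cint _ _ = k * kip nu P P).
    by rewrite -knrmE -mulrA -rmorphM mulfV ?mulr1 // gt_eqF.
  rewrite /kip -CintZ; last by cbmeas_tac.
  apply: ae_Cint; [by have := cTt t => ?; cbmeas_tac|by cbmeas_tac|].
  by apply: filterS Hk => p ->; rewrite mulrA.
(* Fubini changes the order of quantifiers, so that one column [y] serves for almost all [t]. *)
have {}Tkap : {ae nu, forall y, {ae nu, forall t, {ae nu, forall x,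
    T t (x, y) = kap t * P (x, y)}}}.
  pose B := [set q : X * X | {ae nu, forall x, T q.1 (x, q.2) = kap q.1 * P (x, q.2)}].
  have mB : measurable B.
    pose B' := [set q : (X * X) * X | T q.1.1 (q.2, q.1.2) = kap q.1.1 * P (q.2, q.1.2)].
    apply: (measurable_ae_section nu (A := B')).
    apply: measurable_eq_complex; last by cbmeas_tac.
    apply: (@cbmeas_comp _ _ _ _ _ (fun q : X * (X * X) => T q.1 q.2)
      (fun q : (X * X) * X => (q.1.1, (q.2, q.1.2)))) => //; by meas.
  have : {ae prodP nu nu, forall q, B q}.
    apply/ae_prodP => //; apply: filterS Tkap => t.
    by move=> /(ae_preserving (preserving_swap nu nu)) /ae_prodl.
  by move=> /(ae_preserving (preserving_swap nu nu)) /ae_prodl.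
have [y [Hy Py]] : exists y, {ae nu, forall t, {ae nu, forall x,
    T t (x, y) = kap t * P (x, y)}} /\ ~ {ae nu, forall x, P (x, y) = 0}.
  apply: contrapT => /forallNP nex.
  have P00 : {ae nu, forall y, {ae nu, forall x, P (x, y) = 0}}.
    apply: filterS Tkap => y Hy; apply: contrapT => nP; exact: (nex y).
  have : {ae prodP nu nu, forall p, P p = 0}.
    have : {ae prodP nu nu, forall q, [set q | P (q.2, q.1) = 0] q}.
      apply/ae_prodP => //.
      by apply: measurable_eq_complex; cbmeas_tac.
    by move=> /(ae_preserving (preserving_swap nu nu)); apply: filterS => -[x y].
  move=> Pz; suff z : knrm nu P = 0 by rewrite z ltxx in P0.
  rewrite (knrm_ae cP (cbmeas_cst 0)) // /knrm.
  by rewrite -[RHS](Rint_cst (prodP nu nu) 0); apply: eq_Rintegral => p _; exact: sqn0.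
exists kap, (fun x => P (x, y)); split=> //.
by cbmeas_tac.
Qed.

(** If [kap t] vanished, a translate of [f] would vanish almost everywhere; and from one good point
    with [f x0 != 0] the equation carries nonvanishing to almost every [t + x0]. The arguments of
    [kap] and [f] then give [k] and [u]. *)
Lemma commuting_cocycle_trivial : exists k u : X -> R,
  [/\ Tmeasurable k, Tmeasurable u & {ae nu, forall t, {ae nu, forall x,
    inZ (w (t, x) - k t - u x + u (add t x))}}].
Proof.
have [kap [f [ckap cf f0 H]]] := commuting_eigenfunction.
have [_ madd2 _ _] := grp.
have H' : {ae nu, forall x, {ae nu, forall t, om (t, x) * f (add t x) = kap t * f x}}.
  pose B := [set q : X * X | om q * f (add q.1 q.2) = kap q.1 * f q.2].
  have : {ae prodP nu nu, forall q, B q}.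
    apply/(ae_prodP nu nu (A := B)); last exact: H.
    apply: measurable_eq_complex; last by cbmeas_tac.
    apply: cbmeasM => //; exact: (cbmeas_comp madd2 cf).
  by move=> /(ae_preserving (preserving_swap nu nu)) /ae_prodl.
have om0 p : om p != 0.
  by apply/eqP => h; have := sqn_om p; rewrite h sqn0 => /eqP; rewrite eq_sym oner_eq0.
have kap0 : {ae nu, forall t, kap t != 0}.
  apply: filterS H => t Ht; apply/eqP => k0; apply: f0.
  apply: (ae_translate grp (a := t)); apply: filterS Ht => x.
  by rewrite k0 mul0r => /eqP; rewrite mulf_eq0 (negPf (om0 _)) => /eqP.
have {}f0 : {ae nu, forall x, f x != 0}.
  have [x0 [Hx0 fx0]] : exists x0, {ae nu, forall t, om (t, x0) * f (add t x0) = kap t * f x0}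
      /\ f x0 != 0.
    apply: contrapT => /forallNP nex; apply: f0; apply: filterS H' => x Hx.
    by apply/eqP; apply: contrapT => /negP fx; exact: (nex x).
  apply: (ae_translate grp (a := x0)); apply: filterS2 Hx0 kap0 => t Ht kt.
  rewrite (mg_addC grp); apply/eqP => fz; move: Ht; rewrite fz mulr0 => /esym /eqP.
  by rewrite mulf_eq0 (negPf kt) (negPf fx0).
exists (fun t => ang (kap t)), (fun x => ang (f x)); split.
- exact: Tmeasurable_ang.
- exact: Tmeasurable_ang.
apply: filterS2 H kap0 => t Ht kt.
have := ae_preserving (madd t) f0 => f0t.
apply: filterS2 Ht (filterI f0 f0t) => x E [fx ftx].
rewrite (_ : _ + _ = w (t, x) + ang (f (add t x)) - (ang (kap t) + ang (f x))); last by ring.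
apply/inZ_ce; rewrite !ceD -angM // -E angM // ang_ce //.
Qed.

End commuting_cocycle.

(** * Compact groups and their characters *)

Section borel.
Context {R : realType}.

Lemma countable_bigcup_measurable {d} {T : measurableType d} {U : Type}
    (D : set U) (F : U -> set T) : countable D ->
  (forall i, D i -> measurable (F i)) -> measurable (\bigcup_(i in D) F i).
Proof.
move=> /pfcard_geP[->|[f]] mF; first by rewrite bigcup_set0.
rewrite (_ : \bigcup_(i in D) F i = \bigcup_n F (f n)).
  by apply: bigcupT_measurable => n; apply: mF; exact: funS.
apply/seteqP; split=> x [i Di Fx]; last by exists (f i) => //; exact: funS.
by have [n _ fn] := @surj _ _ _ _ f _ Di; exists n; rewrite //= fn.
Qed.

Lemma continuous_measurable_real (X : pseudoPMetricType R) (f : X -> R) :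
  continuous f -> measurable_fun setT (f : BorelT X -> R).
Proof.
move=> cf; apply: (measurability _ (RGenOInfty.measurableE R)).
move=> _ [_ [x ->] <-]; rewrite setTI; apply: sub_sigma_algebra.
by apply: open_comp; [move=> y _; exact: cf|exact: interval_open].
Qed.

Lemma borelE (X : pseudoPMetricType R) :
  @measurable _ (BorelT X) = <<s @open X >>.
Proof. by []. Qed.

Lemma continuous_measurable_borel (X : pseudoPMetricType R) (f : X -> X) :
  continuous f -> measurable_fun setT (f : BorelT X -> BorelT X).
Proof.
move=> cf; apply: (measurability _ (borelE X)).
move=> _ [A oA <-]; rewrite setTI; apply: sub_sigma_algebra.
by apply: open_comp => // y _; exact: cf.
Qed.

Lemma measurable_open (X : pseudoPMetricType R) (U : set X) : open U ->
  measurable (U : set (BorelT X)).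
Proof. by move=> oU; exact: sub_sigma_algebra. Qed.

(* On a second countable space an open subset of the square is a countable
   union of open rectangles. *)
Lemma continuous2_measurable_borel (X : pseudoPMetricType R) (f : X * X -> X) :
  compact [set: X] -> continuous f ->
  measurable_fun setT (f : (BorelT X * BorelT X)%type -> BorelT X).
Proof.
move=> cX cf; have [B cB [Bo Bb]] := compact_second_countable cX.
apply: (measurability _ (borelE X)).
move=> _ [A oA <-]; rewrite setTI.
have oU : open (f @^-1` A) by apply: open_comp => // y _; exact: cf.
pose D := [set b : set X * set X | [/\ B b.1, B b.2 & b.1 `*` b.2 `<=` f @^-1` A]].
rewrite (_ : f @^-1` A = \bigcup_(b in D) (b.1 `*` b.2)).
  apply: countable_bigcup_measurable.
    apply: (@sub_countable _ _ _ (B `*` B)); last exact: countableX.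
    by apply: subset_card_le => b [].
  by move=> b [b1 b2 _]; apply: measurableX; apply: measurable_open; exact: Bo.
apply/seteqP; split=> [[x y] Uxy|p [b [_ _ bU] /bU]//].
have : nbhs (x, y) (f @^-1` A) by exact: open_nbhs_nbhs.
move=> [[V1 V2] /= [nV1 nV2] VU].
have [b1 [Bb1 b1x] b1V] := Bb x _ nV1; have [b2 [Bb2 b2y] b2V] := Bb y _ nV2.
exists (b1, b2) => //; split=> // -[u v] [/b1V u1 /b2V v2].
exact: (VU (u, v)).
Qed.

End borel.

Lemma Rint_dominated {R : realType} {d} {T : measurableType d}
    (P : probability T R) (f_ : nat -> T -> R) (f : T -> R) (M : R) :
  (forall n, bmeas (f_ n)) -> bmeas f -> (forall n x, `|f_ n x| <= M) ->
  (forall x, (fun n => f_ n x) @ \oo --> f x) ->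
  (forall n, \int[P]_x f_ n x = 0) -> \int[P]_x f x = 0.
Proof.
move=> bf_ bf fM cf I0.
have [|||_ _ h] := @dominated_convergence _ _ _ P setT measurableT
  (fun n x => (f_ n x)%:E) (fun x => (f x)%:E) (fun _ => M%:E)
  (fun n => proj2 (measurable_EFinP _ _) (proj1 (bf_ n)))
  (proj2 (measurable_EFinP _ _) (proj1 bf)).
- by apply: aeW => x _; apply: cvg_EFin; [exact: nearW|exact: cf].
- exact: (bmeas_integrable P (bmeas_cst M)).
- by apply: aeW => x n _; rewrite lee_fin.
have E n : (\int[P]_x (f_ n x)%:E = 0)%E.
  have := integrable_fin_num measurableT (bmeas_integrable P (bf_ n)).
  by move=> /fineK <-; rewrite -/(Rintegral P setT (f_ n)) I0.
have : (fun n => \int[P]_x (f_ n x)%:E)%E @ \oo --> 0%E.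
  by under eq_fun do rewrite E; exact: cvg_cst.
by move=> /(cvg_lim (@ereal_hausdorff R)) h0; rewrite /Rintegral -(cvg_lim _ h) // h0.
Qed.

(** * Continuous functions as tests for almost everywhere vanishing *)

Section continuous_test.
Context {R : realType} (X : pseudoPMetricType R).
Variable nu : probability (BorelT X) R.

Lemma bmeas_continuous (f : X -> R) M : continuous f -> (forall x, `|f x| <= M) ->
  bmeas (f : BorelT X -> R).
Proof. by move=> cf fM; split; [exact: continuous_measurable_real|exists M]. Qed.

(* The indicator of an open set [U] is the pointwise limit of the functions
   [1 - Urysohn (An n) (~` U)], where [An n] is the set of points whose
   [n.+1^-1]-ball is contained in [U]. *)
Lemma ae0_continuous_test (F : BorelT X -> R) : bmeas F ->
  (forall phi : X -> R, continuous phi -> (forall x, `|phi x| <= 1) ->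
    \int[nu]_x (F x * phi x) = 0) ->
  {ae nu, forall x, F x = 0}.
Proof.
move=> bF Fphi; have [mF [M FM]] := bF.
apply: (ae0_pi_system (borelE X) _ bF).
- by move=> U V; exact: openI.
- rewrite -[RHS](Fphi (fun _ => 1)) //; first by apply: eq_Rintegral => x _; rewrite mulr1.
    by move=> x; exact: cvg_cst.
  by move=> x; rewrite normr1.
move=> U oU; have mU := measurable_open oU.
pose An n := [set x : X | ball x (n.+1%:R^-1) `<=` U].
pose phi n x : R := 1 - Urysohn (An n) (~` U) x.
have rng n x : 0 <= (Urysohn (An n) (~` U) x : R) <= 1.
  have /= := @Urysohn_range X R (An n) (~` U) (Urysohn (An n) (~` U) x).
  by rewrite in_itv; apply; exists x.
have sep n : uniform_separator (An n) (~` U).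
  apply: uniform_separatorW; exists [set xy : X * X | ball xy.1 (n.+1%:R^-1) xy.2].
    have p : 0 < n.+1%:R^-1 :> R by rewrite invr_gt0.
    exact: (entourage_ball X (PosNum p)).
  by apply/seteqP; split=> // -[x y] [[/= Ax Uy] b]; apply: Uy; exact: Ax.
have pU n x : U x -> An n x -> phi n x = 1.
  move=> Ux Ax; rewrite /phi.
  have -> : Urysohn (An n) (~` U) x = 0 :> R by apply: (Urysohn_sub0 (sep n)); exists x.
  by rewrite subr0.
have pN n x : ~ U x -> phi n x = 0.
  move=> Ux; rewrite /phi.
  have -> : Urysohn (An n) (~` U) x = 1 :> R by apply: (Urysohn_sub1 (sep n)); exists x.
  by rewrite subrr.
have cphi n : continuous (phi n).
  by move=> x; apply: cvgB; [exact: cvg_cst|exact: Urysohn_continuous].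
have bphi n x : `|phi n x| <= 1.
  by have /andP[? ?] := rng n x; rewrite ger0_norm ?subr_ge0 // lerBlDr lerDl.
have bphi' n : bmeas (phi n : BorelT X -> R) by exact: bmeas_continuous.
apply: (@Rint_dominated _ _ _ nu (fun n x => F x * phi n x) _ M).
- by move=> n; exact: bmeasM.
- by apply: bmeasM => //; exact: bmeas_indic.
- move=> n x; rewrite normrM -[M]mulr1; exact: ler_pM.
- move=> x; rewrite indicE; have [/set_mem Ux|Ux] := boolP (x \in U); last first.
    rewrite mul0r (_ : (fun n => _) = fun=> 0); first exact: cvg_cst.
    apply/funext => n; rewrite pN ?mulr0 // => /mem_set.
    exact: (negP Ux).
  rewrite mul1r; apply: cvg_near_cst.
  have /nbhs_ballP[e /= e0 eU] : nbhs x U by exact: open_nbhs_nbhs.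
  near=> n; rewrite pU ?mulr1 // => y yb; apply: eU.
  apply: le_ball yb; apply: ltW; near: n; exact: near_infty_natSinv_lt (PosNum e0).
- by move=> n; exact: Fphi.
Unshelve. all: by end_near. Qed.

End continuous_test.

(** * Haar measure, automorphisms and measurable characters *)

Section haar.
Context {R : realType} (X : pseudoPMetricType R).
Variables (add : X -> X -> X) (zero : X) (opp : X -> X).
Variable nu : probability (BorelT X) R.
Hypothesis cX : compact_metrizable_abelian_group add zero opp.
Hypothesis haar : haar_probability add nu.

Lemma haar_measured_group :
  measured_group nu (add : BorelT X -> BorelT X -> BorelT X) zero opp.
Proof.
have [ab _ kX cadd copp] := cX; split=> //.
- exact: continuous2_measurable_borel.
- exact: continuous_measurable_borel.
- move=> a; split; last by move=> A mA; exact: haar.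
  have ma := continuous2_measurable_borel kX cadd.
  exact: (measurableT_comp ma (measurable_fun_pair (measurable_cst a) (@measurable_id _ _ _))).
Qed.

(** Integrate the indicator of [A] at [x + h z] in both orders: with [z] first it gives [nu] of the
    preimage, as [x = h (h' x)] is absorbed by a translation; with [x] first it gives [nu A]. *)
Lemma haar_hom_preserving (h h' : X -> X) :
  (forall x y, h (add x y) = add (h x) (h y)) -> continuous h ->
  (forall x, h (h' x) = x) ->
  measure_preserving nu nu (h : BorelT X -> BorelT X).
Proof.
move=> hD ch hK; have grp := haar_measured_group.
have mh : measurable_fun setT (h : BorelT X -> BorelT X) by exact: continuous_measurable_borel.
split=> // A mA.
have mhA : measurable ((h : BorelT X -> BorelT X) @^-1` A).
  by rewrite -[X in measurable X]setTI; exact: mh.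
pose F (p : BorelT X * BorelT X) : R := \1_A (add p.1 (h p.2) : BorelT X).
have bF : bmeas F.
  apply: (bmeas_comp _ (bmeas_indic mA)).
  by apply: (measurable_add2 grp); [exact: measurable_fst|
    exact: (measurableT_comp mh measurable_snd)].
have : fine (nu ((h : BorelT X -> BorelT X) @^-1` A)) = fine (nu A).
  have I1 (x : BorelT X) :
      \int[nu]_z F (x, z) = fine (nu ((h : BorelT X -> BorelT X) @^-1` A)).
    rewrite -Rint_indic //.
    rewrite -[RHS](Rint_preserving (preserving_translation grp (h' x)) (bmeas_indic mhA)).
    apply: eq_Rintegral => z _; rewrite /F !indicE; congr (nat_of_bool _)%:R.
    by apply/idP/idP; rewrite !in_setE /= hD hK.
  have I2 (z : BorelT X) : \int[nu]_x F (x, z) = fine (nu A).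
    rewrite -Rint_indic //.
    rewrite -[RHS](Rint_preserving (preserving_translation grp (h z)) (bmeas_indic mA)).
    by apply: eq_Rintegral => x _; rewrite /F /= (mg_addC grp).
  have := Rint_fubini nu nu bF.
  under eq_Rintegral do rewrite I1.
  under [X in _ = X]eq_Rintegral do rewrite I2.
  by rewrite !Rint_cst.
move=> fE; rewrite -[LHS](fineK (fin_num_measure nu _ mhA)) fE.
by rewrite (fineK (fin_num_measure nu _ mA)).
Qed.

Lemma algebraic_mp_action (G : countType) (mul : G -> G -> G) (one : G) (inv : G -> G)
    (sigma : G -> X -> X) : group_axioms mul one inv ->
  algebraic_action mul one add sigma ->
  mp_action mul one nu (sigma : G -> BorelT X -> BorelT X).
Proof.
move=> [_ _ _ _ mulgV] [sD sc s1 sM]; split=> //.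
move=> g; apply: (@haar_hom_preserving (sigma g) (sigma (inv g))) => //.
by move=> x; rewrite -sM mulgV s1.
Qed.

(** A conull subgroup is the whole group: any [x] is the difference of [x + y] and [y] for a generic
    [y]. *)
Lemma additive_ae_inZ (f : X -> R) :
  (forall x y, inZ (f (add x y) - f x - f y)) ->
  {ae nu, forall x : BorelT X, inZ (f x)} -> forall x, inZ (f x).
Proof.
move=> fD fZ x; have grp := haar_measured_group.
have fZx := ae_preserving (preserving_translation grp x) fZ.
have [y [h1 h2]] := ae_ex (filterI fZ fZx).
have := inZB (inZB h2 h1) (fD x y); congr inZ; ring.
Qed.

(** Compactness makes [phi (y - x')] close to [phi (y - x)] uniformly in [y], while the factor [M]
    is merely bounded and measurable. *)
Lemma continuous_convolution (M phi : X -> R) : bmeas (M : BorelT X -> R) ->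
  (forall y, `|M y| <= 1) -> continuous phi -> (forall y, `|phi y| <= 1) ->
  continuous (fun x : X => \int[nu]_y (M y * phi (add (opp x) y))).
Proof.
move=> bM M1 cphi phi1; have [_ _ kX cadd copp] := cX; have grp := haar_measured_group.
have mphi x : bmeas (fun y : BorelT X => phi (add (opp x) y)).
  have mt : measurable_fun setT (add (opp x) : BorelT X -> BorelT X).
    exact: (proj1 (preserving_translation grp (opp x))).
  exact: (bmeas_comp (f := phi : BorelT X -> R) mt (bmeas_continuous cphi phi1)).
have cpsi : continuous (fun p : X * X => phi (add (opp p.2) p.1)).
  move=> [y x]; apply: (continuous_comp (f := fun p : X * X => add (opp p.2) p.1)); last exact: cphi.
  apply: (continuous_comp (f := fun p : X * X => (opp p.2, p.1)) (g := fun p => add p.1 p.2)); last exact: cadd.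
  apply: cvg_pair; last exact: cvg_fst.
  by apply: (continuous_comp (f := snd) (g := opp)); [exact: cvg_snd|exact: copp].
move=> x; apply/cvgrPdist_le => e e0.
have : \forall x' \near x, [set: X] `<=` [set y | `|phi (add (opp x) y) - phi (add (opp x') y)| <= e].
  move/compact_near_coveringP : kX; apply => y _.
  have c2 : continuous (fun p : X * X => phi (add (opp x) p.1)).
    move=> p; apply: (continuous_comp (f := fun p : X * X => (p.1, x))
      (g := fun p : X * X => phi (add (opp p.2) p.1))); last exact: cpsi.
    by apply: cvg_pair; [exact: cvg_fst|exact: cvg_cst].
  have := cvgB (c2 (y, x)) (cpsi (y, x)); rewrite /= subrr => h.
  exact: (cvgr0_norm_le _ (h _) _ e0).
apply: filterS => x' H.
rewrite -RintB; try (apply: bmeasM => //; exact: mphi).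
apply: Rint_bound.
  by apply: bmeasB; apply: bmeasM => //; exact: mphi.
move=> y; rewrite -mulrBr normrM -[e]mul1r; apply: ler_pM => //.
exact: H.
Qed.

(* The character takes at [x] the almost sure value of [m (x + y) - m y]; it
   is continuous because multiplying it by the nonzero constant
   [\int e(m) phi] gives a convolution with the continuous [phi]. *)
Lemma measurable_additive_character (m : X -> R) : Tmeasurable (m : BorelT X -> R) ->
  {ae prodP nu nu, forall p : BorelT X * BorelT X, inZ (m (add p.1 p.2) - m p.1 - m p.2)} ->
  exists chi : X -> R, character add chi /\ {ae nu, forall x : BorelT X, inZ (chi x - m x)}.
Proof.
move=> mm /ae_prodl mD; have grp := haar_measured_group.
have pt := preserving_translation grp.
(* This holds for every [x], not only almost every: with [b] and [x + b] generic, both sides of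
   [(x + b) + y = b + (x + y)] expand, which yields the value [m (x + b) - m b]. *)
have H x : exists v, {ae nu, forall y : BorelT X, inZ (m (add x y) - m y - v)}.
  have [b [h1 h2]] := ae_ex (filterI mD (ae_preserving (pt x) mD)).
  exists (m (add x b) - m b).
  apply: filterS2 h2 (ae_preserving (pt x) h1) => y {}h1 {}h2.
  have E : add (add x b) y = add b (add x y).
    by rewrite !(mg_addA grp) [add x b](mg_addC grp).
  rewrite E in h1; have := inZB h1 h2; congr inZ; ring.
have {H} [chi Hchi] := choice H.
exists chi; split; last first.
  apply: filterS mD => x h; have [y [h1 h2]] := ae_ex (filterI h (Hchi x)).
  have := inZB h1 h2; congr inZ; ring.
split.
  move=> x y; have h1 := Hchi (add x y); have h2 := Hchi y.
  have h3 := ae_preserving (pt y) (Hchi x).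
  have [z [h4 [h5 h6]]] := ae_ex (filterI h1 (filterI h2 h3)).
  rewrite -(mg_addA grp) in h4.
  have := inZB (inZD h5 h6) h4; congr inZ; ring.
(* If every such integral vanished, [ec (m y)] and [es (m y)] would be 0 almost everywhere, against
   modulus 1. *)
have [phi [cphi phi1 C0]] : exists phi : X -> R, [/\ continuous phi,
    forall x, `|phi x| <= 1 & Cint nu (fun y : BorelT X => ce (m y) * (phi y)%:C) != 0].
  apply: contrapT => /forallNP nex.
  have Z (phi : X -> R) : continuous phi -> (forall x, `|phi x| <= 1) ->
      Cint nu (fun y : BorelT X => ce (m y) * (phi y)%:C) = 0.
    move=> cphi phi1; apply/eqP; apply: contrapT => /negP h.
    by apply: (nex phi); split.
  have e1 : {ae nu, forall x : BorelT X, ec (m x) = 0}.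
    apply: ae0_continuous_test; first exact: Tmeasurable_ec.
    move=> phi cphi phi1; have /(congr1 (@complex.Re R)) /= h := Z _ cphi phi1.
    by rewrite -[RHS]h; apply: eq_Rintegral => y _; rewrite mulr0 subr0.
  have e2 : {ae nu, forall x : BorelT X, es (m x) = 0}.
    apply: ae0_continuous_test; first exact: Tmeasurable_es.
    move=> phi cphi phi1; have /(congr1 (@complex.Im R)) /= h := Z _ cphi phi1.
    by rewrite -[RHS]h; apply: eq_Rintegral => y _; rewrite mulr0 add0r.
  have [x [h1 h2]] := ae_ex (filterI e1 e2).
  by have := ec2Des2 (m x); rewrite h1 h2 expr0n addr0 => /eqP; rewrite eq_sym oner_eq0.
pose C := Cint nu (fun y : BorelT X => ce (m y) * (phi y)%:C).
pose gr x := \int[nu]_y (ec (m y) * phi (add (opp x) y)).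
pose gi x := \int[nu]_y (es (m y) * phi (add (opp x) y)).
have cgr : continuous gr.
  by apply: continuous_convolution => //; [exact: Tmeasurable_ec|move=> y; exact: norm_ec].
have cgi : continuous gi.
  by apply: continuous_convolution => //; [exact: Tmeasurable_es|move=> y; exact: norm_es].
have cphi' : cbmeas (fun y : BorelT X => (phi y)%:C).
  by apply: cbmeas_real; exact: bmeas_continuous.
have cem := cbmeas_ce mm.
(* By translation invariance the left side is the integral of [ce (m y) * phi (y - x)]; dividing by
   [C] expresses the character through continuous functions. *)
have E x : ce (chi x) * C = gr x +i* gi x.
  have mt := proj1 (pt x); have mt' := proj1 (pt (opp x)).
  have cE : cbmeas (fun y : BorelT X => ce (m y) * (phi (add (opp x) y))%:C).
    apply: cbmeasM => //.
    exact: (cbmeas_comp (f := fun y : BorelT X => (phi y)%:C) mt' cphi').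
  transitivity (Cint nu (fun y : BorelT X => ce (m y) * (phi (add (opp x) y))%:C)).
    rewrite -[RHS](Cint_preserving (pt x) cE) -CintZ; last exact: cbmeasM.
    apply: ae_Cint.
    - by apply: cbmeasM; [exact: cbmeas_cst|exact: cbmeasM].
    - exact: (cbmeas_comp mt cE).
    - apply: filterS (Hchi x) => y h; rewrite (mg_addNK grp) mulrA -ceD.
      congr (_ * _); apply/inZ_ce; have := inZN h; congr inZ; ring.
  apply: complex_eq => /=; rewrite /gr /gi /=.
    by apply: eq_Rintegral => y _; rewrite mulr0 subr0.
  by apply: eq_Rintegral => y _; rewrite mulr0 add0r.
have CC : complex.Re C ^+ 2 + complex.Im C ^+ 2 != 0.
  by apply: lt0r_neq0; exact: (sqn_gt0 C0).
clearbody C.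
split.
  rewrite (_ : (fun y => _) = fun x =>
      (gr x * complex.Re C + gi x * complex.Im C) * (complex.Re C ^+ 2 + complex.Im C ^+ 2)^-1).
    move=> x; apply: cvgM; last exact: cvg_cst.
    by apply: cvgD; apply: cvgM; try exact: cvg_cst; [exact: cgr|exact: cgi].
  apply/funext => x; rewrite -/(ec _).
  have h1 := congr1 (@complex.Re R) (E x); have h2 := congr1 (@complex.Im R) (E x).
  move: h1 h2; rewrite ReM ImM /= => <- <-; field; exact: CC.
rewrite (_ : (fun y => _) = fun x =>
    (gi x * complex.Re C - gr x * complex.Im C) * (complex.Re C ^+ 2 + complex.Im C ^+ 2)^-1).
  move=> x; apply: cvgM; last exact: cvg_cst.
  by apply: cvgB; apply: cvgM; try exact: cvg_cst; [exact: cgi|exact: cgr].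
apply/funext => x; rewrite -/(es _).
have h1 := congr1 (@complex.Re R) (E x); have h2 := congr1 (@complex.Im R) (E x).
move: h1 h2; rewrite ReM ImM /= => <- <-; field; exact: CC.
Qed.

End haar.

Local Close Scope complex_scope.

Section product_transposition.
Context {R : realType} {d : measure_display} {X : measurableType d}.
Variable nu : probability X R.

Lemma preserving_Rint {d1 d2} {T1 : measurableType d1} {T2 : measurableType d2}
    (P1 : probability T1 R) (P2 : probability T2 R) (f : T1 -> T2) :
  measurable_fun setT f ->
  (forall A, measurable A -> \int[P1]_x \1_A (f x) = \int[P2]_x \1_A x) ->
  measure_preserving P1 P2 f.
Proof.
move=> mf If; split=> // A mA.
have mfA : measurable (f @^-1` A) by rewrite -[X in measurable X]setTI; exact: mf.
rewrite -[LHS](fineK (fin_num_measure P1 _ mfA)) -[RHS](fineK (fin_num_measure P2 _ mA)).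
by congr EFin; rewrite -!Rint_indic // -If.
Qed.

Lemma preserving_swap12 : measure_preserving (prodP nu (prodP nu nu))
  (prodP nu (prodP nu nu)) (fun q : X * (X * X) => (q.2.1, (q.1, q.2.2))).
Proof.
apply: preserving_Rint; first by meas.
move=> A mA; pose f : X * (X * X) -> R := \1_A.
have bf : bmeas f by exact: bmeas_indic.
have b1 : bmeas (fun q : X * (X * X) => f (q.2.1, (q.1, q.2.2))) by bmeas_tac.
rewrite -(Rint_prod1 nu (prodP nu nu) b1) -(Rint_prod1 nu (prodP nu nu) bf) /=.
have I1 t : \int[prodP nu nu]_p f (p.1, (t, p.2)) = \int[nu]_s \int[nu]_x f (s, (t, x)).
  by rewrite -(Rint_prod1 nu nu (f := fun p : X * X => f (p.1, (t, p.2)))) //; bmeas_tac.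
have I2 s : \int[prodP nu nu]_p f (s, p) = \int[nu]_t \int[nu]_x f (s, (t, x)).
  by rewrite -(Rint_prod1 nu nu (f := fun p : X * X => f (s, p))) //; bmeas_tac.
under eq_Rintegral do rewrite I1.
under [RHS]eq_Rintegral do rewrite I2.
have b3 : bmeas (fun q : (X * X) * X => f (q.1.2, (q.1.1, q.2))) by bmeas_tac.
have b2 : bmeas (fun p : X * X => \int[nu]_x f (p.2, (p.1, x))).
  exact: (bmeas_Rint1 (prodP nu nu) nu b3).
exact: (Rint_fubini nu nu b2).
Qed.

End product_transposition.

(** * Dual 2-cocycles *)

Section injectivity.
Context {R : realType} (G : countType) (mul : G -> G -> G) (one : G) (inv : G -> G).
Context (X : pseudoPMetricType R) (add : X -> X -> X) (zero : X) (opp : X -> X).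
Variables (nu : probability (BorelT X) R) (sigma : G -> X -> X).
Hypothesis groupG : group_axioms mul one inv.
Hypothesis cX : compact_metrizable_abelian_group add zero opp.
Hypothesis haar : haar_probability add nu.
Hypothesis act : algebraic_action mul one add sigma.
Hypothesis wm : weakly_mixing nu sigma.
Hypothesis rigid4 : T_cocycle_superrigid mul one inv (prodP (prodP nu nu) (prodP nu nu))
    (diag4 (sigma : G -> BorelT X -> BorelT X)).

Let Y := BorelT X.
Let sg : G -> Y -> Y := sigma.
Let grp : measured_group nu (add : Y -> Y -> Y) zero opp := haar_measured_group cX haar.
Let mps : mp_action mul one nu sg := algebraic_mp_action cX haar groupG act.

Let preserving_add : measure_preserving (prodP nu nu) nu (fun p : Y * Y => add p.1 p.2 : Y).
Proof.
exact: (preserving_comp (preserving_skew grp (@measurable_id _ _ setT)) (preserving_snd nu nu)).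
Qed.

(* If the coboundary of [b] is additive up to the constant cocycle [d], then
   [b (x + y) - b x - b y] has coboundary [d] on the square, where [d] can
   therefore be removed. *)
Lemma additive_defect (c : G -> G -> X -> R) (d : G -> G -> R) (b : G -> Y -> R) :
  (forall g h x y, inZ (c g h (add x y) - c g h x - c g h y)) ->
  (forall g, Tmeasurable (b g)) ->
  (forall g h, {ae nu, forall x : Y, inZ (c g h x - d g h -
    (b g x + b h (sigma (inv g) x) - b (mul g h) x))}) ->
  exists b' : G -> Y -> R, exists w : Y * Y -> R,
    [/\ forall g, Tmeasurable (b' g), Tmeasurable w,
      (forall g h, {ae nu, forall x : Y, inZ (c g h x -
        (b' g x + b' h (sigma (inv g) x) - b' (mul g h) x))}) &
      (forall g, {ae prodP nu nu, forall p : Y * Y,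
        inZ (b' g (add p.1 p.2) - b' g p.1 - b' g p.2 - w p + w (diag2 sg (inv g) p))})].
Proof.
move=> cD mb cb; have [sD _ _ _] := act; have [_ madd _ _] := grp.
pose a g (p : Y * Y) := b g (add p.1 p.2) - b g p.1 - b g p.2.
have ma g : Tmeasurable (a g).
  apply: TmeasurableB; [apply: TmeasurableB|].
  - exact: (Tmeasurable_comp madd (mb g)).
  - exact: (Tmeasurable_comp measurable_fst (mb g)).
  - exact: (Tmeasurable_comp measurable_snd (mb g)).
have mp2 : mp_action mul one (prodP nu nu) (diag2 sg) := mp_action_prod mps mps.
have cob g h : {ae prodP nu nu, forall p,
    inZ (d g h - (a g p + a h (diag2 sg (inv g) p) - a (mul g h) p))}.
  have e := cb g h; have e1 := ae_fst nu e; have e2 := ae_snd nu e.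
  have e3 := ae_preserving preserving_add e.
  apply: filterS2 (filterI e1 e2) e3 => -[x y] /= [h1 h2] h3.
  have := inZB (inZB (inZB h3 h1) h2) (cD g h x y); congr inZ.
  rewrite /a /diag2 /sg /= sD; ring.
have [beta [w [mw aw dbeta]]] := superrigid_split_cst groupG mp2 rigid4 ma cob.
(* Adding the constants [beta] absorbs [d] and at the same time turns [a g] into [a g - beta g],
   since [b g] occurs there once positively and twice negatively. *)
exists (fun g x => b g x + beta g), w; split=> //.
- by move=> g; apply: TmeasurableD => //; exact: Tmeasurable_cst.
- move=> g h; apply: filterS (cb g h) => x h1.
  have := inZD h1 (dbeta g h); congr inZ; ring.
- move=> g; apply: filterS (aw g) => p; congr inZ; rewrite /a; ring.
Qed.

Let ergodic_cube : ergodic (prodP nu (prodP nu nu))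
  (fun g p => (sg g p.1, (sg g p.2.1, sg g p.2.2))).
Proof. exact: (ergodic_prod groupG mps (mp_action_prod mps mps) wm wm). Qed.

(* The commutation defect of [w] is invariant, hence constant, and changes
   sign when [s] and [t] are exchanged. *)
Lemma defect_commutes (b : G -> Y -> R) (w : Y * Y -> R) : Tmeasurable w ->
  (forall g, {ae prodP nu nu, forall p : Y * Y,
    inZ (b g (add p.1 p.2) - b g p.1 - b g p.2 - w p + w (diag2 sg (inv g) p))}) ->
  {ae nu, forall t : Y, {ae prodP nu nu, forall p : Y * Y,
    inZ (2 * w (p.1, p.2) + 2 * w (t, add p.1 p.2) - 2 * w (t, p.2) - 2 * w (p.1, add t p.2))}}.
Proof.
move=> mw bw; have [sD _ _ _] := act; have [_ madd _ _] := grp.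
pose D (q : Y * (Y * Y)) := w (q.2.1, q.2.2) + w (q.1, add q.2.1 q.2.2)
  - w (q.1, q.2.2) - w (q.2.1, add q.1 q.2.2).
have mD : Tmeasurable D.
  have m1 : measurable_fun setT (fun q : Y * (Y * Y) => (q.1, add q.2.1 q.2.2) : Y * Y).
    by apply: measurable_fun_pair; [meas|apply: (measurable_add2 grp); meas].
  have m2 : measurable_fun setT (fun q : Y * (Y * Y) => (q.2.1, add q.1 q.2.2) : Y * Y).
    by apply: measurable_fun_pair; [meas|apply: (measurable_add2 grp); meas].
  apply: TmeasurableB; [apply: TmeasurableB; [apply: TmeasurableD|]|].
  - by apply: (Tmeasurable_comp _ mw); meas.
  - exact: (Tmeasurable_comp m1 mw).
  - by apply: (Tmeasurable_comp _ mw); meas.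
  - exact: (Tmeasurable_comp m2 mw).
have pid := preserving_id nu.
(* For [b g (x + y) - b g x - b g y] in place of [w], the same four-term expression is identically
   0, so [w] and its translate give the same [D]. *)
have [k Dk] : exists k, {ae prodP nu (prodP nu nu), forall q, inZ (D q - k)}.
  have m3 := mp_action_prod mps (mp_action_prod mps mps).
  apply: (ergodic_const groupG m3 ergodic_cube mD) => g.
  have := bw (inv g); rewrite (group_invK groupG) => e.
  have e1 := ae_preserving (preserving_snd nu (prodP nu nu)) e.
  have e2 := ae_preserving (preserving_prod pid preserving_add) e.
  have e3 := ae_preserving (preserving_prod pid (preserving_snd nu nu)) e.
  have e4 := ae_preserving (preserving_swap12 nu) e2.
  apply: filterS2 (filterI e1 e2) (filterI e3 e4) => -[t [s x]] /= [h1 h2] [h3 h4].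
  have := inZB (inZB (inZD h1 h2) h3) h4; congr inZ.
  rewrite /D /diag2 /sg /= !sD.
  have -> : add t (add s x) = add s (add t x).
    by rewrite !(mg_addA grp) [add t s](mg_addC grp).
  ring.
have k2 : inZ (k + k).
  have [q [h1 h2]] := ae_ex (filterI Dk (ae_preserving (preserving_swap12 nu) Dk)).
  have := inZN (inZD h1 h2); congr inZ; rewrite /D /=; ring.
have : {ae prodP nu (prodP nu nu), forall q, inZ (2 * D q)}.
  apply: filterS Dk => q h; have := inZD (inZD h h) k2; congr inZ; ring.
move=> /ae_prodl; apply: filterS => t; apply: filterS => p; congr inZ; rewrite /D /=; ring.
Qed.

(** With [2 w (x, y) = k x + u y - u (x + y)], the relation for [w] becomes
    [B g (x + y) = B g y + m g x]. Exchanging [x] and [y] shows that [B g - m g] is constant, so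
    [m g] is additive almost everywhere and agrees with a character [chi g]; the [k] terms telescope
    in the coboundary. *)
Lemma double_dual_coboundary (c : G -> G -> X -> R) (d : G -> G -> R) (b : G -> Y -> R) :
  (forall g h, character add (c g h)) ->
  (forall g, Tmeasurable (b g)) ->
  (forall g h, {ae nu, forall x : Y, inZ (c g h x - d g h -
    (b g x + b h (sigma (inv g) x) - b (mul g h) x))}) ->
  dual_coboundary mul inv add sigma (fun g h x => 2%:R * c g h x).
Proof.
move=> cc mb cb; have cD g h := proj1 (cc g h); have [sD _ _ sM] := act.
have [b' [w [mb' mw cb' bw]]] := additive_defect cD mb cb.
have com := defect_commutes mw bw.
have m2 d' (T : measurableType d') (f : T -> R) : Tmeasurable f -> Tmeasurable (fun x => 2 * f x).
  move=> mf; rewrite (_ : (fun x => _) = fun x => f x + f x); first exact: TmeasurableD.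
  by apply/funext => x; ring.
have [k [u [mk mu wku]]] := commuting_cocycle_trivial grp (m2 _ _ _ mw) com.
have [_ madd _ _] := grp; have [msg _ _] := mps.
have msg' g : measurable_fun setT (sg g) by case: (msg g).
pose m g (x : Y) := 2 * b' g x + k x - k (sg (inv g) x).
pose B g (x : Y) := 2 * b' g x + u x - u (sg (inv g) x).
have mm g : Tmeasurable (m g).
  apply: TmeasurableB; [apply: TmeasurableD => //; exact: m2|].
  exact: (Tmeasurable_comp (msg' (inv g)) mk).
have wku2 : {ae prodP nu nu, forall p : Y * Y, inZ (2 * w p - k p.1 - u p.2 + u (add p.1 p.2))}.
  apply/(ae_prodP nu nu (A := [set p : Y * Y | inZ (2 * w p - k p.1 - u p.2 + u (add p.1 p.2))])).
    apply: measurable_inZ; apply: TmeasurableD; [apply: TmeasurableB; [apply: TmeasurableB|]|].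
    - exact: m2.
    - exact: (Tmeasurable_comp measurable_fst mk).
    - exact: (Tmeasurable_comp measurable_snd mu).
    - exact: (Tmeasurable_comp madd mu).
  exact: wku.
have Bm g : {ae prodP nu nu, forall p : Y * Y, inZ (B g (add p.1 p.2) - B g p.2 - m g p.1)}.
  have wg := ae_preserving (preserving_prod (msg (inv g)) (msg (inv g))) wku2.
  apply: filterS2 (bw g) (filterI wku2 wg) => p h1 [h2 h3].
  have := inZB (inZD (inZD h1 h1) h2) h3; congr inZ.
  rewrite /B /m /diag2 /sg /= !sD; ring.
have gam g : exists gamma, {ae nu, forall x : Y, inZ (B g x - m g x - gamma)}.
  have e : {ae prodP nu nu, forall p : Y * Y, inZ (B g p.2 - m g p.2 - (B g p.1 - m g p.1))}.
    apply: filterS2 (Bm g) (ae_preserving (preserving_swap nu nu) (Bm g)) => p h1 h2.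
    have := inZB h2 h1; congr inZ; rewrite /= [add p.2 _](mg_addC grp); ring.
  by have [y hy] := ae_ex (ae_prodl e); exists (B g y - m g y).
have mD g : {ae prodP nu nu, forall p : Y * Y, inZ (m g (add p.1 p.2) - m g p.1 - m g p.2)}.
  have [gamma e] := gam g.
  apply: filterS2 (Bm g) (filterI (ae_preserving preserving_add e)
    (ae_preserving (preserving_snd nu nu) e)) => p h1 [h2 h3].
  have := inZD (inZB h1 h2) h3; congr inZ; rewrite /=; ring.
have [chi chiP] := choice (fun g => measurable_additive_character cX haar (mm g) (mD g)).
exists chi; split=> [g|g h]; first by case: (chiP g).
have chim g' := proj2 (chiP g'); have chiD g' := proj1 (proj1 (chiP g')).
(* The discrepancy is additive in [x] for fixed [g] and [h], so vanishing almost everywhere gives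
   vanishing everywhere. *)
apply: (additive_ae_inZ cX haar) => [x y|].
  have := inZB (inZD (cD g h x y) (cD g h x y))
    (inZD (inZB (chiD h (sigma (inv g) x) (sigma (inv g) y)) (chiD (mul g h) x y)) (chiD g x y)).
  congr inZ; rewrite sD; ring.
apply: filterS2 (filterI (cb' g h) (chim g))
  (filterI (chim (mul g h)) (ae_preserving (msg (inv g)) (chim h))) => x [h1 h2] [h3 h4].
have := inZD (inZB (inZB (inZD h1 h1) h2) h4) h3; congr inZ.
rewrite /m /sg /= (group_invM groupG) sM; ring.
Qed.

End injectivity.

Section characters.
Context {R : realType} (X : pseudoPMetricType R) (add : X -> X -> X).

Lemma character_measurable (chi : X -> R) :
  character add chi -> Tmeasurable (chi : BorelT X -> R).
Proof. by move=> [_ [cc cs]]; split; exact: continuous_measurable_real. Qed.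

Lemma characterB (chi psi : X -> R) :
  character add chi -> character add psi -> character add (fun x => chi x - psi x).
Proof.
move=> [aD [ac as_]] [bD [bc bs]]; split.
  by move=> x y; have := inZB (aD x y) (bD x y); congr inZ; ring.
split.
  rewrite (_ : (fun _ => _) = fun x => ec (chi x) * ec (psi x) + es (chi x) * es (psi x)).
    by move=> x; apply: cvgD; apply: cvgM; [exact: ac|exact: bc|exact: as_|exact: bs].
  by apply/funext => x; rewrite mulrBr cosB.
rewrite (_ : (fun _ => _) = fun x => es (chi x) * ec (psi x) - ec (chi x) * es (psi x)).
  by move=> x; apply: cvgB; apply: cvgM; [exact: as_|exact: bc|exact: ac|exact: bs].
by apply/funext => x; rewrite mulrBr sinB.
Qed.

End characters.

Theorem theorem1p1 (R : realType) (G : countType)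
  (mul : G -> G -> G) (one : G) (inv : G -> G)
  (X : pseudoPMetricType R) (add : X -> X -> X) (zero : X) (opp : X -> X)
  (nu : probability (BorelT X) R) (sigma : G -> X -> X) :
  group_axioms mul one inv ->
  infinite_type G ->
  compact_metrizable_abelian_group add zero opp ->
  haar_probability add nu ->
  algebraic_action mul one add sigma ->
  weakly_mixing nu sigma ->
  T_cocycle_superrigid mul one inv (prodP nu nu)
    (diag2 (sigma : G -> BorelT X -> BorelT X)) ->
  T_cocycle_superrigid mul one inv (prodP (prodP nu nu) (prodP nu nu))
    (diag4 (sigma : G -> BorelT X -> BorelT X)) ->
  dual_H2_torsion_free mul inv add sigma ->
  [/\
   (* Psi_2 : H^2(G,T) -> H^2(G ~ X; T) is injective *)
   (forall c : G -> G -> R, T_cocycle mul c ->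
      meas_coboundary mul inv nu sigma (fun g h _ => c g h) ->
      T_coboundary mul c),
   (* Phi_2 is well defined: c~ is a measurable cocycle ... *)
   (forall c : G -> G -> X -> R, dual_cocycle mul inv add sigma c ->
      meas_cocycle mul inv nu sigma c),
   (* ... whose class modulo Psi_2(H^2(G,T)) only depends on [c] *)
   (forall c c' : G -> G -> X -> R,
      dual_cocycle mul inv add sigma c -> dual_cocycle mul inv add sigma c' ->
      dual_coboundary mul inv add sigma (fun g h x => c g h x - c' g h x) ->
      exists d : G -> G -> R, T_cocycle mul d /\
        meas_coboundary mul inv nu sigma (fun g h x => c g h x - c' g h x - d g h)),
   (* Phi_2 is a group homomorphism *)
   (forall c c' : G -> G -> X -> R,
      dual_cocycle mul inv add sigma c -> dual_cocycle mul inv add sigma c' ->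
      exists d : G -> G -> R, T_cocycle mul d /\
        meas_coboundary mul inv nu sigma
          (fun g h x => (c g h x + c' g h x) - c g h x - c' g h x - d g h)) &
   (* Phi_2 is injective *)
   (forall c c' : G -> G -> X -> R,
      dual_cocycle mul inv add sigma c -> dual_cocycle mul inv add sigma c' ->
      (exists d : G -> G -> R, T_cocycle mul d /\
        meas_coboundary mul inv nu sigma (fun g h x => c g h x - c' g h x - d g h)) ->
      dual_coboundary mul inv add sigma (fun g h x => c g h x - c' g h x))].
Proof.
move=> groupG _ cX haar act wm rigid2 rigid4 tf.
have mps := algebraic_mp_action cX haar groupG act.
have inZ00 : inZ (0 : R) by exact: inZ0.
have T0 : T_cocycle mul (fun _ _ : G => 0 : R).
  by move=> g h k; rewrite !(subr0, addr0).
have Tm0 : Tmeasurable (fun _ : BorelT X => 0 : R) by exact: Tmeasurable_cst.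
split.
- move=> c cc [b [mb cb]].
  have [beta [u [_ _ h]]] := superrigid_split_cst groupG mps rigid2 mb cb.
  by exists beta => g h'; have := h g h'; congr inZ; ring.
- move=> c [ch cc]; split=> [g h|g h k]; first exact: character_measurable (ch g h).
  by apply: aeW => x; exact: cc.
- move=> c c' _ _ [b [cb db]]; exists (fun _ _ => 0); split=> //.
  exists b; split=> [g|g h]; first exact: character_measurable (cb g).
  by apply: aeW => x; have := db g h x; congr inZ; ring.
- move=> c c' _ _; exists (fun _ _ => 0); split=> //.
  exists (fun _ _ => 0); split=> // g h; apply: aeW => x.
  by have := inZ00; congr inZ; ring.
- move=> c c' [ch cc] [ch' cc'] [d [dd [b [mb cb]]]].
  have cch g h := characterB (ch g h) (ch' g h).
  (* Torsion-freeness at [n = 2], applied to the dual cocycle [c - c']. *)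
  apply: (tf _ 2%N) => //.
    split=> // g h k x; have := inZB (cc g h k x) (cc' g h k x); congr inZ; ring.
  exact: (double_dual_coboundary groupG cX haar act wm rigid4 cch mb cb).
Qed.
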